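(* Let $s\in(0,1)$ and let $n\ge 1$ be an integer with $n>2s$. Then there exists a non-constant weak solution $u\in H^s_{\mathbb{R}^n_+}$ of the problem $$\begin{cases}(-\Delta)^s u=u^{\frac{n+2s}{n-2s}} & \text{in }\mathbb{R}^n_+,\\ u\ge 0 & \text{in }\mathbb{R}^n_+,\\ \mathcal N_s u=0 & \text{in }\mathbb{R}^n_-.\end{cases}$$
   Context: Notation: $\mathbb{R}^n_+=\{x\in\mathbb{R}^n: x_n>0\}$, $\mathbb{R}^n_-=\{x\in\mathbb{R}^n: x_n<0\}$, $T(\mathbb{R}^n_+)=\mathbb{R}^{2n}\setminus(\mathbb{R}^n_-)^2$, $2^*_s=\frac{2n}{n-2s}$. $c_{n,s}>0$ is the normalization constant of the fractional Laplacian $(-\Delta)^su(x)=c_{n,s}\,\mathrm{PV}\int_{\mathbb{R}^n}\frac{u(x)-u(y)}{|x-y|^{n+2s}}dy$, and the nonlocal normal derivative is $\mathcal N_su(x)=c_{n,s}\int_{\mathbb{R}^n_+}\frac{u(x)-u(y)}{|x-y|^{n+2s}}dy$ for $x\in\mathbb{R}^n_-$. For measurable $u:\mathbb{R}^n\to\mathbb{R}$ and $\Gamma\subseteq\mathbb{R}^{2n}$ set $\mathcal E(u,\Gamma)=\iint_\Gamma\frac{(u(x)-u(y))^2}{|x-y|^{n+2s}}dxdy$. The space $H^s_{\mathbb{R}^n_+}$ consists of the measurable $u:\mathbb{R}^n\to\mathbb{R}$ with $u\in L^{2^*_s}(\mathbb{R}^n_+)$ and $\mathcal E(u,T(\mathbb{R}^n_+))<\infty$.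 Weak solution (for the equation with right-hand side $u^p$, here $p=\frac{n+2s}{n-2s}$): $u\in H^s_{\mathbb{R}^n_+}$ with $u\ge0$ a.e. in $\mathbb{R}^n_+$ such that for every $v\in H^s_{\mathbb{R}^n_+}$ $$\frac{c_{n,s}}{2}\iint_{T(\mathbb{R}^n_+)}\frac{(u(x)-u(y))(v(x)-v(y))}{|x-y|^{n+2s}}\,dx\,dy=\int_{\mathbb{R}^n_+}u^pv\,dx .$$ *)

(* Defs.v *)
From HB Require Import structures.
From mathcomp Require Import all_boot all_order all_algebra.
From mathcomp Require Import all_classical all_reals all_analysis.
Import Order.TTheory GRing.Theory Num.Theory.
Import numFieldNormedType.Exports.

Set Implicit Arguments.
Unset Strict Implicit.
Unset Printing Implicit Defensive.

Local Open Scope classical_set_scope.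
Local Open Scope ring_scope.

(* R^n, with the sigma-algebra generated by the coordinates (the Borel sets). *)
Notation Rn R n := (n.-tuple (measurableTypeR R)).

Section LebesgueTuple.
Context (R : realType).

Definition tcons n (p : measurableTypeR R * Rn R n) : Rn R n.+1 :=
  [the n.+1.-tuple _ of p.1 :: p.2].

Lemma measurable_tcons n : measurable_fun setT (@tcons n).
Proof. exact: measurable_cons. Qed.

Section Step.
Context n (mu : {sigma_finite_measure set (Rn R n) -> \bar R}).

Let nu : {measure set _ -> \bar R} := (@lebesgue_measure R \x mu)%E.

Definition lebesgue_tcons : set (Rn R n.+1) -> \bar R :=
  pushforward nu (@tcons n).

Let mtcons A : measurable A -> measurable (@tcons n @^-1` A).
Proof. by move=> mA; rewrite -[X in measurable X]setTI; exact: measurable_tcons. Qed.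

Let lebesgue_tcons0 : lebesgue_tcons set0 = 0%E.
Proof. by rewrite /lebesgue_tcons /pushforward preimage_set0 measure0. Qed.

Let lebesgue_tcons_ge0 A : (0 <= lebesgue_tcons A)%E.
Proof. exact: (measure_ge0 nu). Qed.

Let lebesgue_tcons_sigma_additive : semi_sigma_additive lebesgue_tcons.
Proof.
move=> F mF tF mUF; rewrite /lebesgue_tcons /pushforward preimage_bigcup.
apply: measure_semi_sigma_additive.
- by move=> k; exact: mtcons.
- apply/trivIsetP => /= i j _ _ ij; rewrite -preimage_setI.
  by move/trivIsetP : tF => /(_ _ _ _ _ ij) ->//; rewrite preimage_set0.
- by rewrite -preimage_bigcup; exact: mtcons.
Qed.

HB.instance Definition _ := isMeasure.Build _ _ _ lebesgue_tcons
  lebesgue_tcons0 lebesgue_tcons_ge0 lebesgue_tcons_sigma_additive.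

Let lebesgue_tcons_sigma_finite : sigma_finite setT lebesgue_tcons.
Proof.
have /sigma_finiteP[F [TF ndF Foo]] := sigma_finiteT (@lebesgue_measure R).
have /sigma_finiteP[G [TG ndG Goo]] := sigma_finiteT mu.
pose g (x : Rn R n.+1) : measurableTypeR R * Rn R n :=
  (thead x, [tuple of behead x]).
have mg : measurable_fun setT g.
  apply: measurable_fun_pair; first exact: measurable_tnth.
  exact: measurable_behead.
have gK A : @tcons n @^-1` (g @^-1` A) = A.
  rewrite -comp_preimage (_ : g \o _ = id) ?preimage_id//.
  by apply/funext => -[x y]; congr pair; exact/val_inj.
exists (fun k => g @^-1` (F k `*` G k)).
  rewrite -preimage_bigcup (_ : \bigcup_k _ = setT) ?preimage_setT//.
  apply/seteqP; split => // -[x y] _.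
  have [i _ Fix] : (\bigcup_k F k) x by rewrite -TF.
  have [j _ Gjy] : (\bigcup_k G k) y by rewrite -TG.
  exists (maxn i j) => //; split => /=.
    by move: x Fix; exact/subsetPset/ndF/leq_maxl.
  by move: y Gjy; exact/subsetPset/ndG/leq_maxr.
move=> k; have [? ?] := Foo k; have [? ?] := Goo k; split.
  by rewrite -[X in measurable X]setTI; apply: mg => //; exact: measurableX.
rewrite /lebesgue_tcons /pushforward gK /= product_measure1E//.
by rewrite lte_mul_pinfty// ge0_fin_numE.
Qed.

HB.instance Definition _ := Measure_isSigmaFinite.Build _ _ _ lebesgue_tcons
  lebesgue_tcons_sigma_finite.

End Step.

Fixpoint lebesgue_Rn n : {sigma_finite_measure set (Rn R n) -> \bar R} :=
  match n with
  | 0 => \d_ (nil_tuple (measurableTypeR R))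
  | m.+1 => lebesgue_tcons (lebesgue_Rn m)
  end.

Lemma tnth_tcons0 n (p : measurableTypeR R * Rn R n) :
  tnth (tcons p) ord0 = p.1.
Proof. by []. Qed.

Lemma tnth_tconsS n (p : measurableTypeR R * Rn R n) (i : 'I_n) :
  tnth (tcons p) (lift ord0 i) = tnth p.2 i.
Proof. by rewrite !(tnth_nth p.1). Qed.

Lemma lebesgue_Rn_prod n (A : 'I_n -> set (measurableTypeR R)) :
  (forall i, measurable (A i)) ->
  lebesgue_Rn n [set x | forall i, A i (tnth x i)] =
  (\prod_(i < n) lebesgue_measure (A i))%E.
Proof.
elim: n A => [A _|n IHn A mA].
  by rewrite big_ord0 /= diracE mem_set// => -[].
rewrite big_ord_recl -IHn//=.
rewrite /lebesgue_tcons /pushforward.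
rewrite -product_measure1E//; last first.
  rewrite (_ : [set _ | _] = \bigcap_(i in [set: 'I_n])
      ((fun x : Rn R n => tnth x i) @^-1` A (lift ord0 i))).
    apply: fin_bigcap_measurable => // i _.
    by rewrite -[X in measurable X]setTI; exact: measurable_tnth.
  by apply/seteqP; split => [x Ax i _|x Ax i]; [exact: Ax|exact: (Ax i I)].
congr (_ _); apply/seteqP; split => [p /= Ap|p /= [Ax Ay] i].
  split => [|i]; first exact: (Ap ord0).
  by rewrite -tnth_tconsS; exact: Ap.
by case: (unliftP ord0 i) => [j|] ->//; rewrite tnth_tconsS; exact: Ay.
Qed.

End LebesgueTuple.

Section HalfSpace.
Context (R : realType) (n : nat).
Implicit Types (x y : Rn R n) (u v : Rn R n -> R) (s p : R).

(* Coordinates are numbered from 0: for n >= 1 the n-th coordinate has index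
   n.-1 and the first one index 0. *)
Definition half_space_pos : set (Rn R n) := [set x | 0 < nth 0 x n.-1].
Definition half_space_neg : set (Rn R n) := [set x | nth 0 x n.-1 < 0].

Definition T_half_space : set (Rn R n * Rn R n) :=
  ~` (half_space_neg `*` half_space_neg).

Definition lebesgue_RnRn : {measure set (Rn R n * Rn R n) -> \bar R} :=
  (lebesgue_Rn R n \x lebesgue_Rn R n)%E.

Definition eucl_norm x : R := Num.sqrt (\sum_(i < n) tnth x i ^+ 2).
Definition eucl_dist x y : R :=
  Num.sqrt (\sum_(i < n) (tnth x i - tnth y i) ^+ 2).

(* The normalization constant for which the singular integral defining
   (-Delta)^s has Fourier symbol |xi|^(2s). *)
Definition frac_lap_const s : R :=
  (\int[lebesgue_Rn R n]_z
    ((1 - cos (nth 0 z 0)) / eucl_norm z `^ (n%:R + 2 * s)))^-1.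

Definition crit_exp s : R := 2 * n%:R / (n%:R - 2 * s).

(* No kernel value is needed at x = y: the diagonal is a null set for n >= 1. *)
Definition gagliardo s u v (D : set (Rn R n * Rn R n)) : \bar R :=
  (\int[lebesgue_RnRn]_(z in D)
    ((u z.1 - u z.2) * (v z.1 - v z.2)
      / eucl_dist z.1 z.2 `^ (n%:R + 2 * s))%:E)%E.

Definition energy s u D : \bar R :=
  (\int[lebesgue_RnRn]_(z in D)
    ((u z.1 - u z.2) ^+ 2 / eucl_dist z.1 z.2 `^ (n%:R + 2 * s))%:E)%E.

Definition Hs_half_space s u : Prop :=
  [/\ measurable_fun setT u,
      (\int[lebesgue_Rn R n]_(x in half_space_pos)
        (`|u x| `^ crit_exp s)%:E < +oo)%E &
      (energy s u T_half_space < +oo)%E].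

Definition weak_solution s p u : Prop :=
  [/\ Hs_half_space s u,
      {ae lebesgue_Rn R n, forall x, half_space_pos x -> 0 <= u x} &
      forall v, Hs_half_space s v ->
        ((frac_lap_const s / 2)%:E * gagliardo s u v T_half_space =
         \int[lebesgue_Rn R n]_(x in half_space_pos) (u x `^ p * v x)%:E)%E].

Definition non_constant u : Prop :=
  ~ exists c : R, {ae lebesgue_Rn R n, forall x, u x = c}.

End HalfSpace.

(* Main.v *)
(* The solution is a multiple of a maximizer of the mass \int |u|^q, q = 2n/(n - 2s),
   among the functions whose energy on T(R^n_+) is at most 1.

   A maximizing sequence concentrates: comparing u x with the average of u on a cube
   and optimizing the size of the cube (Hedberg) yields a Sobolev inequality in which
   the constant is small unless some cube carries a definite amount of u. Dilations and
   translations, which preserve mass and energy, bring this cube to a fixed place; the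
   half space becomes {x_n >= -t}. Along a subsequence the functions converge almost
   everywhere, and outside the half space too once they are replaced by their extension
   of least energy. Fatou's lemma, applied to differences of energies and of masses as
   in the Brezis-Lieb lemma, shows that the limit U and the remainder share the energy,
   and x^(q/2) < x on ]0, 1[ then gives the whole energy to U, which is a maximizer.

   If t tends to infinity, U would be a maximizer on the whole space with the constant
   of the half space. Splitting U along {x_n = -t}, the energy e left below this level
   satisfies lambda e <= K e^(q/2), hence is either 0 or at least some kappa > 0; but it
   varies continuously with t from the full energy to 0, a contradiction.

   So U lives on the half space, and a^q + q a^(q-1) b <= |a + b|^q, applied to
   U + t v for t of both signs, gives the Euler-Lagrange equation. *)
Require Import Defs.
From mathcomp Require Import all_boot all_order all_algebra.
From mathcomp Require Import all_classical all_reals all_analysis.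
From mathcomp Require Import measurable_realfun ring lra.
Import Order.TTheory GRing.Theory Num.Theory.
Import numFieldNormedType.Exports.
Set Implicit Arguments.
Unset Strict Implicit.
Unset Printing Implicit Defensive.
Local Open Scope classical_set_scope.
Local Open Scope ring_scope.


(** Dilations and translations along the boundary are symmetries of the problem, but a translation
    across the boundary changes the domain. Concentration far inside, measured in units of its own
    scale, is therefore a loss of compactness that no symmetry repairs, and the moving half spaces
    [hspace t] keep track of it. The usual remedy, a strict inequality between the best constants of
    half space and whole space obtained from explicit extremals, is replaced by an argument by
    contradiction: the inequality with [best_constant] passes to the whole space by exhaustion, so
    an escaping sequence would yield a whole-space maximizer for that very constant.

    Outside the half space the mass does not see the functions, and the energy contains no pair of
    exterior points, so no compactness is available there. Fatou's lemma on [T_set] nevertheless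
    needs convergence at exterior points; it is obtained by making the exterior values explicit
    integrals of the interior ones.

    The Neumann condition is the natural boundary condition: it is encoded by test functions that
    are not prescribed outside the half space. *)

(** * Affine changes of variables and Tonelli's theorem *)

Section AffineChange.
Context (R : realType).
Implicit Types (r : R) (f : measurableTypeR R -> \bar R).

(** Lebesgue measure is determined by its values on half-open intervals, so the identity is checked
    only there; a negative [r] reverses the interval and moves the closed end to the other side. *)
Lemma lebesgue_measure_affine r (h : R) (A : set (measurableTypeR R)) :
  r != 0 -> measurable A ->
  lebesgue_measure A =
  (`|r|%:E * lebesgue_measure ((fun x : R => (r * x + h)%R) @^-1` A))%E.
Proof.
move=> r0 mA.
have mphi : measurable_fun setT (fun x : measurableTypeR R => r * x + h : measurableTypeR R).
  by apply: measurable_funD => //; apply: measurable_funM.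
have k0 : 0 <= `|r| by []. pose k : {nonneg R} := NngNum k0.
rewrite -[RHS]/(pushforward (mscale k (@lebesgue_measure R)) (fun x : measurableTypeR R => r * x + h : measurableTypeR R) A).
apply: lebesgue_measure_unique => // _ [[a b]] _ <- /=.
rewrite /pushforward /mscale /=.
have [rp|rn|/eqP] := ltgtP r 0; last by rewrite (negbTE r0).
- rewrite (_ : _ @^-1` _ = `[(b - h) / r, (a - h) / r[%classic); last first.
    apply/seteqP; split => x /=; rewrite !in_itv/= => /andP[xa xb].
      by rewrite ler_ndivrMr// ltr_ndivlMr//; apply/andP; split; lra.
    by move: xa xb; rewrite ler_ndivrMr// ltr_ndivlMr// => ? ?; apply/andP; split; lra.
  rewrite !lebesgue_measure_itv/= !lte_fin ltr_nM2r ?invr_lt0//.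
  rewrite ltrD2r; case: ifPn => _; last by rewrite mule0.
  by rewrite -!EFinD -EFinM; congr EFin; rewrite ltr0_norm//; field.
- rewrite (_ : _ @^-1` _ = `](a - h) / r, (b - h) / r]%classic); last first.
    apply/seteqP; split => x /=; rewrite !in_itv/= => /andP[xa xb].
      by rewrite ltr_pdivrMr// ler_pdivlMr//; apply/andP; split; lra.
    by move: xa xb; rewrite ltr_pdivrMr// ler_pdivlMr// => ? ?; apply/andP; split; lra.
  rewrite !lebesgue_measure_itv/= !lte_fin ltr_pM2r ?invr_gt0//.
  rewrite ltrD2r; case: ifPn => _; last by rewrite mule0.
  by rewrite -!EFinD -EFinM; congr EFin; rewrite gtr0_norm//; field.
Qed.

Lemma integral_affine1 r (h : R) f : r != 0 -> measurable_fun setT f ->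
  (forall x, 0 <= f x)%E ->
  (\int[lebesgue_measure]_x f x =
   `|r|%:E * \int[lebesgue_measure]_x f (r * x + h)%R)%E.
Proof.
move=> r0 mf f0.
have mphi : measurable_fun setT (fun x : measurableTypeR R => r * x + h : measurableTypeR R).
  by apply: measurable_funD => //; apply: measurable_funM.
have k0 : 0 <= `|r| by []. pose k : {nonneg R} := NngNum k0.
rewrite -(@ge0_integral_mscale _ _ _ (@lebesgue_measure R) _ measurableT k)//; last exact: measurableT_comp.
rewrite -(@ge0_integral_pushforward _ _ _ _ _ _ mphi (mscale k (@lebesgue_measure R)) setT f)//.
by apply: eq_measure_integral => A mA _; exact: lebesgue_measure_affine.
Qed.

Definition affine n r (h : 'I_n -> R) (x : Rn R n) : Rn R n :=
  [tuple r * tnth x i + h i | i < n].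

Lemma measurable_affine n r (h : 'I_n -> R) :
  measurable_fun setT (affine r h).
Proof.
apply/measurable_fun_tnthP => i.
rewrite (_ : _ \o _ = (fun x => r * tnth x i + h i)); last first.
  by apply/funext => x /=; rewrite tnth_mktuple.
apply: measurable_funD => //; apply: measurable_funM => //.
exact: measurable_tnth.
Qed.

Lemma integral_tcons n (f : Rn R n.+1 -> \bar R) :
  measurable_fun setT f -> (forall x, 0 <= f x)%E ->
  (\int[lebesgue_Rn R n.+1]_x f x =
   \int[lebesgue_measure]_x \int[lebesgue_Rn R n]_y f (tcons (x, y)))%E.
Proof.
move=> mf f0 /=; rewrite /lebesgue_tcons.
rewrite (ge0_integral_pushforward (@measurable_tcons R n))//.
rewrite fubini_tonelli1//.
  by apply: measurableT_comp => //; exact: measurable_tcons.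
by move=> x; exact: f0.
Qed.

Lemma affine_tcons n r (h : 'I_n.+1 -> R) x (y : Rn R n) :
  affine r h (tcons (x, y)) =
  tcons (r * x + h ord0, affine r (h \o lift ord0) y).
Proof.
apply: eq_from_tnth => i; rewrite tnth_mktuple.
by case: (unliftP ord0 i) => [j|] ->; rewrite ?tnth_tconsS ?tnth_tcons0//= tnth_mktuple.
Qed.

(** Induction on the dimension: [lebesgue_Rn] is built by adjoining a first coordinate, and
    [affine_tcons] splits the map accordingly, so that each coordinate contributes one factor
    [|r|]. *)
Lemma integral_affine n r (h : 'I_n -> R) (f : Rn R n -> \bar R) :
  r != 0 -> measurable_fun setT f -> (forall x, 0 <= f x)%E ->
  (\int[lebesgue_Rn R n]_x f x =
   (`|r| ^+ n)%:E * \int[lebesgue_Rn R n]_x f (affine r h x))%E.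
Proof.
move=> r0; elim: n h f => [|n IH] h f mf f0.
  rewrite expr0 mul1e; apply: eq_integral => x _.
  by congr f; rewrite [LHS]tuple0 [RHS]tuple0.
have mc x : measurable_fun setT (fun y : Rn R n => tcons (x, y)).
  by apply: measurableT_comp; [exact: measurable_tcons|exact: measurable_pair1].
have mfa : measurable_fun setT (f \o affine r h).
  by apply: measurableT_comp => //; exact: measurable_affine.
have mfc : measurable_fun setT (fun z => f (tcons z)).
  by apply: measurableT_comp => //; exact: measurable_tcons.
have mF : measurable_fun setT (fun x => \int[lebesgue_Rn R n]_y f (tcons (x, y)))%E.
  apply: (@measurable_fun_fubini_tonelli_F _ _ _ _ _ (lebesgue_Rn R n) (fun z => f (tcons z))) => //.
rewrite (integral_tcons mf f0) (integral_tcons mfa)//=.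
rewrite (integral_affine1 (h ord0) r0 mF); last by move=> x; exact: integral_ge0.
rewrite exprS EFinM -muleA; congr (_ * _)%E.
rewrite -ge0_integralZl//; last 2 first.
  - apply: (@measurable_fun_fubini_tonelli_F _ _ _ _ _ (lebesgue_Rn R n) (fun z => f (affine r h (tcons z)))) => //.
    by apply: (measurableT_comp mfa); exact: measurable_tcons.
  - by move=> x _; exact: integral_ge0.
apply: eq_integral => x _.
rewrite (IH (h \o lift ord0) _ (measurableT_comp mf (mc _)))//.
  by congr (_ * _)%E; apply: eq_integral => y _; rewrite affine_tcons.
by move=> y; exact: f0.
Qed.

Lemma tonelliF n (f : Rn R n * Rn R n -> \bar R) :
  measurable_fun setT f -> (forall x, 0 <= f x)%E ->
  (\int[lebesgue_RnRn R n]_z f z =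
   \int[lebesgue_Rn R n]_x \int[lebesgue_Rn R n]_y f (x, y))%E.
Proof. by move=> mf f0; rewrite /lebesgue_RnRn fubini_tonelli1. Qed.

Lemma tonelliG n (f : Rn R n * Rn R n -> \bar R) :
  measurable_fun setT f -> (forall x, 0 <= f x)%E ->
  (\int[lebesgue_RnRn R n]_z f z =
   \int[lebesgue_Rn R n]_y \int[lebesgue_Rn R n]_x f (x, y))%E.
Proof. by move=> mf f0; rewrite /lebesgue_RnRn fubini_tonelli2. Qed.

Lemma measurable_tonelliF n (f : Rn R n * Rn R n -> \bar R) :
  measurable_fun setT f -> (forall x, 0 <= f x)%E ->
  measurable_fun setT (fun x => \int[lebesgue_Rn R n]_y f (x, y))%E.
Proof. by move=> mf f0; exact: (@measurable_fun_fubini_tonelli_F _ _ _ _ _ (lebesgue_Rn R n) f). Qed.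

Lemma measurable_tonelliG n (f : Rn R n * Rn R n -> \bar R) :
  measurable_fun setT f -> (forall x, 0 <= f x)%E ->
  measurable_fun setT (fun y => \int[lebesgue_Rn R n]_x f (x, y))%E.
Proof. by move=> mf f0; exact: (@measurable_fun_fubini_tonelli_G _ _ _ _ _ (lebesgue_Rn R n) f). Qed.

Lemma integral_affine2 n r (h : 'I_n -> R) (f : Rn R n * Rn R n -> \bar R) :
  r != 0 -> measurable_fun setT f -> (forall x, 0 <= f x)%E ->
  (\int[lebesgue_RnRn R n]_z f z =
   (`|r| ^+ n * `|r| ^+ n)%:E *
    \int[lebesgue_RnRn R n]_z f (affine r h z.1, affine r h z.2))%E.
Proof.
move=> r0 mf f0.
have ma := @measurable_affine n r h.
pose g z := f (affine r h z.1, affine r h z.2).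
have mg : measurable_fun setT g.
  apply: (measurableT_comp mf); apply: measurable_fun_pair.
    by apply: measurableT_comp.
  by apply: measurableT_comp.
have g0 z : (0 <= g z)%E by exact: f0.
rewrite (tonelliF mf f0) (tonelliF mg g0).
have mF := measurable_tonelliF mf f0.
rewrite (integral_affine h r0 mF); last by move=> x; exact: integral_ge0.
rewrite EFinM -muleA; congr (_ * _)%E.
rewrite -ge0_integralZl//; last 2 first.
  - exact: (measurable_tonelliF mg).
  - by move=> x _; exact: integral_ge0.
apply: eq_integral => x _.
by rewrite (integral_affine h r0)//; exact: measurableT_comp.
Qed.

End AffineChange.

(** * Half spaces, cubes and the Euclidean distance *)

Section Boxes.
Context (R : realType) (n : nat).
Implicit Types (x y : Rn R n) (r t : R).

Lemma measurable_nth i : measurable_fun setT (fun x : Rn R n => nth 0 x i : R).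
Proof.
have [lin|lni] := ltnP i n.
  rewrite (_ : (fun _ => _) = (fun x => tnth x (Ordinal lin))).
    exact: measurable_tnth.
  by apply/funext => x; rewrite (tnth_nth 0).
rewrite (_ : (fun _ => _) = cst 0); first exact: measurable_cst.
by apply/funext => x; rewrite nth_default// size_tuple.
Qed.

Lemma measurable_box (A : 'I_n -> set (measurableTypeR R)) :
  (forall i, measurable (A i)) -> measurable [set x | forall i, A i (tnth x i)].
Proof.
move=> mA; rewrite (_ : [set _ | _] = \bigcap_(i in [set: 'I_n])
    ((fun x : Rn R n => tnth x i) @^-1` A i)).
  apply: fin_bigcap_measurable => // i _.
  by rewrite -[X in measurable X]setTI; exact: measurable_tnth.
by apply/seteqP; split => [x Ax i _|x Ax i]; [exact: Ax|exact: (Ax i I)].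
Qed.

(** The level is [- t], so that the sets grow with [t] and exhaust the space. *)
Definition hspace t : set (Rn R n) := [set x | - t <= nth 0 x n.-1].

Lemma measurable_half t : measurable (hspace t).
Proof.
rewrite (_ : hspace t = (fun x : Rn R n => nth 0 x n.-1 : R) @^-1` `[- t, +oo[%classic).
  by rewrite -[X in measurable X]setTI; apply: measurable_nth.
by apply/seteqP; split=> x; rewrite /hspace/= in_itv/= andbT.
Qed.

Definition cube x r : set (Rn R n) :=
  [set y | forall i, `|tnth y i - tnth x i| <= r].

Let cubeE x r : cube x r =
  [set y | forall i, `[tnth x i - r, tnth x i + r]%classic (tnth y i)].
Proof.
by apply/seteqP; split => y /= xy i; move: (xy i); rewrite in_itv/= ler_distl.
Qed.

Lemma measurable_cube x r : measurable (cube x r).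
Proof. by rewrite cubeE; apply: (@measurable_box (fun i => _)) => i; exact: measurable_itv. Qed.

Lemma lebesgue_itvcc (a b : R) : a <= b -> lebesgue_measure `[a, b]%classic = (b - a)%:E.
Proof.
move=> ab; rewrite lebesgue_measure_itv/= lte_fin EFinB; case: ifPn => //.
by rewrite -leNgt => ba; have -> : a = b by [apply/le_anti/andP]; rewrite subee.
Qed.

Lemma prode_cst (c : R) : (\prod_(i < n) c%:E = (c ^+ n)%:E)%E.
Proof.
elim: n => [|m IH]; first by rewrite big_ord0.
by rewrite big_ord_recr/= IH exprSr.
Qed.

Lemma lebesgue_cube x r : 0 <= r ->
  lebesgue_Rn R n (cube x r) = ((2 * r) ^+ n)%:E.
Proof.
move=> r0; rewrite cubeE (@lebesgue_Rn_prod _ _ (fun i => `[tnth x i - r, tnth x i + r]%classic)); last first.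
  by move=> i; exact: measurable_itv.
rewrite -prode_cst; apply: eq_bigr => i _.
by rewrite lebesgue_itvcc; [congr EFin|]; lra.
Qed.

(** The box with lower corner [x] and side [r] stays in the half space, however close [x] is to the
    boundary. This uniform density makes averaging work up to the boundary. *)
Lemma lebesgue_half_cube t x r : hspace t x -> 0 <= r ->
  ((r ^+ n)%:E <= lebesgue_Rn R n (hspace t `&` cube x r))%E.
Proof.
move=> tx r0.
pose A (i : 'I_n) : set (measurableTypeR R) := `[tnth x i, tnth x i + r]%classic.
have mA i : measurable (A i) by exact: measurable_itv.
apply: (@le_trans _ _ (lebesgue_Rn R n [set y | forall i, A i (tnth y i)])).
  rewrite lebesgue_Rn_prod// -prode_cst.
  by under [leRHS]eq_bigr do rewrite lebesgue_itvcc ?lerDl// [tnth x _ + r]addrC addrK.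
apply: le_measure; rewrite ?inE; first exact: measurable_box.
  by apply: measurableI; [exact: measurable_half|exact: measurable_cube].
move=> y /= Ay; split => [|i]; last first.
  by move: (Ay i); rewrite /A/= in_itv/= ler_distl => /andP[? ?]; apply/andP; split; lra.
rewrite /hspace/=; apply: (le_trans tx); have [n0|n0] := posnP n.
  by rewrite !nth_default// size_tuple n0.
have ln : (n.-1 < n)%N by rewrite prednK.
move: (Ay (Ordinal ln)); rewrite /A/= in_itv/= !(tnth_nth 0)/=.
by move=> /andP[].
Qed.

Lemma lebesgue_lower_half_cube t x r : ~ hspace t x -> 0 <= r ->
  ((r ^+ n)%:E <= lebesgue_Rn R n (~` hspace t `&` cube x r))%E.
Proof.
move=> tx r0.
pose A (i : 'I_n) : set (measurableTypeR R) := `[tnth x i - r, tnth x i]%classic.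
have mA i : measurable (A i) by exact: measurable_itv.
apply: (@le_trans _ _ (lebesgue_Rn R n [set y | forall i, A i (tnth y i)])).
  rewrite lebesgue_Rn_prod// -prode_cst.
  by under [leRHS]eq_bigr do rewrite lebesgue_itvcc ?gerBl// opprB addrC subrK.
apply: le_measure; rewrite ?inE; first exact: measurable_box.
  by apply: measurableI; [apply: measurableC; exact: measurable_half|exact: measurable_cube].
move=> y /= Ay; split => [|i]; last first.
  by move: (Ay i); rewrite /A/= in_itv/= ler_distl => /andP[? ?]; apply/andP; split; lra.
move=> ty; apply: tx; apply: (le_trans ty); have [n0|n0] := posnP n.
  by rewrite !nth_default// size_tuple n0.
have ln : (n.-1 < n)%N by rewrite prednK.
move: (Ay (Ordinal ln)); rewrite /A/= in_itv/= !(tnth_nth 0)/=.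
by move=> /andP[].
Qed.

Lemma measurable_eucl_dist :
  measurable_fun setT (fun z : Rn R n * Rn R n => eucl_dist z.1 z.2).
Proof.
rewrite /eucl_dist; apply: measurableT_comp => /=.
  (* [Num.sqrt] vanishes on negative numbers, which the case distinction reproduces. *)
  rewrite (_ : Num.sqrt = (fun y : R => if 0 <= y then y `^ (2^-1) else 0)).
    apply: measurable_fun_ifT => /=.
    - by apply: measurable_fun_ler.
    - exact: measurable_powR.
    - exact: measurable_cst.
  apply/funext => y; case: ifPn => [y0|]; first by rewrite powR12_sqrt.
  by rewrite -ltNge => /ltW y0; rewrite ler0_sqrtr.
apply: measurable_sum => i; apply: measurable_funX; apply: measurable_funB.
  exact: (measurableT_comp (measurable_tnth i) measurable_fst).
exact: (measurableT_comp (measurable_tnth i) measurable_snd).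
Qed.

Lemma eucl_distC x y : eucl_dist x y = eucl_dist y x.
Proof.
rewrite /eucl_dist; congr Num.sqrt; apply: eq_bigr => i _.
by rewrite -sqrrN opprB.
Qed.

Lemma eucl_dist_ge0 x y : 0 <= eucl_dist x y.
Proof. exact: sqrtr_ge0. Qed.

Lemma tnth_eucl_dist x y i : `|tnth x i - tnth y i| <= eucl_dist x y.
Proof.
rewrite -sqrtr_sqr ler_sqrt; last by apply: sumr_ge0 => j _; rewrite sqr_ge0.
by rewrite (bigD1 i)//= lerDl sumr_ge0// => j _; rewrite sqr_ge0.
Qed.

Lemma eucl_dist_le x y r : 0 <= r -> cube x r y ->
  eucl_dist x y <= Num.sqrt n%:R * r.
Proof.
move=> r0 xy; rewrite -[X in _ * X](ger0_norm r0) -sqrtr_sqr -sqrtrM// ler_sqrt; last first.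
  by rewrite mulr_ge0// sqr_ge0.
have -> : n%:R * r ^+ 2 = \sum_(i < n) r ^+ 2 by rewrite sumr_const card_ord mulr_natl.
apply: ler_sum => i _.
by rewrite -[leLHS]real_normK ?num_real// ler_sqr ?nnegrE// distrC.
Qed.

Lemma eucl_dist_affine r (h : 'I_n -> R) x y :
  eucl_dist (affine r h x) (affine r h y) = `|r| * eucl_dist x y.
Proof.
rewrite /eucl_dist -sqrtr_sqr -sqrtrM ?sqr_ge0//; congr Num.sqrt.
by rewrite mulr_sumr; apply: eq_bigr => i _; rewrite !tnth_mktuple; ring.
Qed.

Lemma eucl_dist_norm x y :
  eucl_dist x y = eucl_norm (affine 1 (fun i => - tnth x i) y).
Proof.
rewrite eucl_distC /eucl_dist /eucl_norm; congr Num.sqrt.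
by apply: eq_bigr => i _; rewrite tnth_mktuple mul1r.
Qed.

Hypothesis n0 : (0 < n)%N.

Lemma hyperplane_null (c : R) :
  lebesgue_Rn R n [set x | nth 0 x n.-1 = c] = 0%E.
Proof.
have ln : (n.-1 < n)%N by rewrite prednK.
pose A (i : 'I_n) : set (measurableTypeR R) := if i == Ordinal ln then [set c] else setT.
have mA i : measurable (A i) by rewrite /A; case: ifP.
transitivity (lebesgue_Rn R n [set x | forall i, A i (tnth x i)]); last first.
  by rewrite lebesgue_Rn_prod// (bigD1 (Ordinal ln))//= /A eqxx lebesgue_measure_set1 mul0e.
congr (lebesgue_Rn R n _); apply/seteqP; split => [x /= xc i|x /= /(_ (Ordinal ln))].
  by rewrite /A; case: eqP => // ->; rewrite (tnth_nth 0).
by rewrite /A eqxx (tnth_nth 0).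
Qed.

End Boxes.

(** * Integrability of the kernel away from its singularity *)

Lemma gt1_ltr_powR (R : realType) (a x y : R) : 1 < a -> x < y -> a `^ x < a `^ y.
Proof.
move=> a1 xy; have a0 : 0 < a by lra.
by rewrite /powR gt_eqF// ltr_expR ltr_pM2r// ln_gt0.
Qed.

Section KernelIntegrability.
Context (R : realType) (n : nat) (s : R).
Hypotheses (hs0 : 0 < s) (hs1 : s < 1) (n0 : (0 < n)%N).
Implicit Types (z : Rn R n) (r t : R).

Local Notation p := (n%:R + 2 * s).

Let p0 : 0 < p. Proof. by rewrite ltr_wpDl// mulr_gt0. Qed.

Definition origin : Rn R n := nseq_tuple n 0.

Lemma eucl_norm_dist z : eucl_norm z = eucl_dist z origin.
Proof.
rewrite /eucl_norm /eucl_dist; congr Num.sqrt; apply: eq_bigr => i _.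
by rewrite /origin tnth_nseq subr0.
Qed.

Lemma measurable_eucl_norm : measurable_fun setT (@eucl_norm R n).
Proof.
rewrite (_ : @eucl_norm R n = (fun w : Rn R n * Rn R n => eucl_dist w.1 w.2) \o (fun z => (z, origin))).
  by apply: measurableT_comp; [exact: measurable_eucl_dist|exact: measurable_pair2].
by apply/funext => z /=; rewrite eucl_norm_dist.
Qed.

Lemma measurable_eucl_dist1 z : measurable_fun setT (eucl_dist z).
Proof. exact: (measurableT_comp (@measurable_eucl_dist R n) (measurable_pair1 z)). Qed.

Lemma nneseries_bounded (u : nat -> \bar R) (M : \bar R) :
  (forall k, 0 <= u k)%E -> (forall N, \sum_(0 <= i < N) u i <= M)%E ->
  (\sum_(i <oo) u i <= M)%E.
Proof.
move=> u0 uM; apply: lime_le; first by apply: is_cvg_nneseries => *.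
by apply: nearW => N; exact: uM.
Qed.

Lemma nneseries_geometric_lty (c r : R) : 0 <= c -> 0 <= r -> r < 1 ->
  (\sum_(i <oo) (c * r ^+ i)%:E < +oo)%E.
Proof.
move=> c0 r0 r1.
have S N : \sum_(0 <= i < N) (c * r ^+ i) <= c / (1 - r).
  rewrite -mulr_sumr ler_wpM2l//.
  have : (1 - r) * \sum_(0 <= i < N) r ^+ i <= 1.
    rewrite -[1 - r]opprB mulNr big_mkord -subrX1 opprB lerBlDr lerDl exprn_ge0//.
  by rewrite -ler_pdivlMl ?mulr1// subr_gt0.
apply: (@le_lt_trans _ _ (c / (1 - r))%:E); last exact: ltry.
apply: nneseries_bounded => [k|N]; first by rewrite lee_fin mulr_ge0// exprn_ge0.
by rewrite sumEFin lee_fin.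
Qed.

Lemma le_nneseries_term (u : nat -> \bar R) k : (forall k, 0 <= u k)%E ->
  (u k <= \sum_(i <oo) u i)%E.
Proof.
move=> u0; apply: le_trans (nneseries_lim_ge k.+1 _) => //.
by rewrite big_nat_recr//= leeDr// sume_ge0.
Qed.

Lemma dyadic_ge1 r : 1 <= r -> exists k, 2 ^+ k <= r < 2 ^+ k.+1.
Proof.
move=> r1; have ex : exists k, r < 2 ^+ k.+1.
  exists (Num.truncn r); apply: (lt_trans (truncnS_gt r)).
  by rewrite -natrX ltr_nat ltn_expl.
case: (ex_minnP ex) => -[|k] rk mk; first by exists 0%N; rewrite rk andbT expr0.
by exists k.+1; rewrite rk andbT leNgt; apply/negP => /mk; rewrite ltnn.
Qed.

(** The weight [min(1, |z|^2) / |z|^(n + 2s)] attached to the Levy measure of the fractional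
    Laplacian: an integrable majorant wherever a bounded Lipschitz difference compensates the
    singularity. *)
Definition trunc_kernel (d : R) := Num.min 1 (d ^+ 2) / d `^ p.

Lemma trunc_kernel_ge0 d : 0 <= trunc_kernel d.
Proof. by rewrite divr_ge0// ?powR_ge0// le_min ler01 sqr_ge0. Qed.

Lemma measurable_trunc_kernel : measurable_fun setT trunc_kernel.
Proof.
apply: measurable_funM; first by apply: measurable_minr => //; exact: measurable_funX.
rewrite (_ : (fun _ => _) = (fun x => x `^ (- p))); first exact: measurable_powR.
by apply/funext => x; rewrite powRN.
Qed.

Let P := 2 `^ p : R.
Let P_gt0 : 0 < P. Proof. exact: powR_gt0. Qed.

Let powP k : (2 ^+ k) `^ p = P ^+ k.
Proof. by rewrite -powR_mulrn// -powRrM mulrC powRrM powR_mulrn// powR_ge0. Qed.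

Let ratio1 : 2 ^+ n / P < 1.
Proof.
rewrite ltr_pdivrMr// mul1r /P powRD; last by rewrite pnatr_eq0 implybT.
rewrite powR_mulrn// ltr_pMr ?exprn_gt0//.
by rewrite -[ltLHS](powRr0 2) gt1_ltr_powR ?ltr1n// mulr_gt0.
Qed.

Let ratio2 : P / (4 * 2 ^+ n) < 1.
Proof.
rewrite ltr_pdivrMr ?mulr_gt0 ?exprn_gt0// mul1r /P powRD; last by rewrite pnatr_eq0 implybT.
rewrite powR_mulrn// mulrC ltr_pM2r ?exprn_gt0//.
rewrite (_ : 4 = 2 `^ 2); last by rewrite (powR_mulrn 2) //; lra.
by apply: gt1_ltr_powR; rewrite ?ltr1n// gtr_pMr.
Qed.

(** Dyadic shells: those with [|z|] about [2^k] contribute a multiple of [(2^n / 2^p)^k], those with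
    [|z|] about [2^-k] a multiple of [(2^p / (4 * 2^n))^k]. The ratios are [2^(-2s)] and
    [2^(2s - 2)], so [s > 0] is used at infinity and [s < 1] at the origin. *)
Lemma trunc_kernel_integral :
  (\int[lebesgue_Rn R n]_z (trunc_kernel (eucl_norm z))%:E < +oo)%E.
Proof.
pose C r := cube origin r.
have Cn r z : eucl_norm z <= r -> C r z.
  rewrite eucl_norm_dist => zr i; apply: le_trans zr.
  by rewrite eucl_distC; have := tnth_eucl_dist origin z i; rewrite distrC.
pose a k := P ^- k; pose b k := 4 ^- k * P ^+ k.+1.
have a0 k : 0 <= a k by rewrite invr_ge0 exprn_ge0// ltW.
have b0 k : 0 <= b k by rewrite mulr_ge0 ?invr_ge0 ?exprn_ge0// ltW.
have cE r : 0 <= r -> (\int[lebesgue_Rn R n]_x (\1_(C r) x)%:E = ((2 * r) ^+ n)%:E)%E.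
  by move=> r0; rewrite integral_indic// ?setIT; [exact: lebesgue_cube|exact: measurable_cube].
have i0 A z : 0 <= \1_A z :> R by rewrite indicE.
(* Shells are enlarged to cubes, whose measure is known from the product formula; an upper bound
   does not require the pieces to be disjoint. *)
pose f k z := (a k * \1_(C (2 ^+ k.+1)) z + b k * \1_(C (2 ^- k)) z)%:E.
have f0 k z : (0 <= f k z)%E by rewrite lee_fin addr_ge0// mulr_ge0.
have mC r : measurable (C r) by exact: measurable_cube.
have mf k : measurable_fun setT (f k).
  apply/measurable_EFinP; apply: measurable_funD; apply: measurable_funM => //;
  exact: measurable_indic.
apply: (@le_lt_trans _ _ (\int[lebesgue_Rn R n]_z \sum_(k <oo) f k z)%E).
  apply: ge0_le_integral => //.
  - by move=> z _; rewrite lee_fin trunc_kernel_ge0.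
  - apply/measurable_EFinP; apply: measurableT_comp; first exact: measurable_trunc_kernel.
    exact: measurable_eucl_norm.
  - by apply: ge0_emeasurable_sum => //.
  (* At the origin the numerator is [0], so the singular denominator does no harm. *)
  move=> z _; have [z0|z0] := eqVneq (eucl_norm z) 0.
    rewrite /trunc_kernel z0 expr0n/= min_r// mul0r.
    by apply: nneseries_ge0 => k _ _.
  have zp : 0 < eucl_norm z by rewrite lt_neqAle eq_sym z0/= sqrtr_ge0.
  have [z1|z1] := leP 1 (eucl_norm z).
    have [k /andP[kz zk]] := dyadic_ge1 z1.
    apply: (le_trans _ (le_nneseries_term k (f0^~ z))).
    rewrite lee_fin (ler_wpDr (mulr_ge0 (b0 k) (i0 _ _)))//.
    rewrite indicE mem_set ?mulr1; last by apply: Cn; exact: ltW.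
    rewrite /trunc_kernel ler_pdivrMr ?powR_gt0//.
    apply: (@le_trans _ _ 1); first by rewrite ge_min lexx.
    rewrite /a -powP mulrC ler_pdivlMr ?powR_gt0 ?exprn_gt0// mul1r.
    by rewrite ge0_ler_powR ?nnegrE ?exprn_ge0// ?ltW.
  have z1' : 1 <= (eucl_norm z)^-1 by rewrite -invr1 lef_pV2 ?posrE// ltW.
  have [k /andP[kz zk]] := dyadic_ge1 z1'.
  have k2 : 0 < 2 ^+ k :> R by rewrite exprn_gt0.
  have zk1 : eucl_norm z <= 2 ^- k by rewrite -(invrK (eucl_norm z)) lef_pV2 ?posrE ?invr_gt0.
  have zk2 : 2 ^- k.+1 <= eucl_norm z by rewrite -(invrK (eucl_norm z)) lef_pV2 ?posrE ?invr_gt0 ?exprn_gt0// ltW.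
  apply: (le_trans _ (le_nneseries_term k (f0^~ z))).
  rewrite lee_fin (ler_wpDl (mulr_ge0 (a0 k) (i0 _ _)))//.
  rewrite indicE mem_set ?mulr1; last exact: Cn.
  rewrite /trunc_kernel ler_pM ?invr_ge0 ?powR_ge0 ?le_min ?sqr_ge0 ?ler01//.
    rewrite ge_min; apply/orP; right.
    have -> : 4 ^- k = (2 ^- k) ^+ 2 :> R.
      by rewrite exprVn -exprM mulnC exprM; congr ((_ ^+ _)^-1); ring.
    by rewrite ler_pXn2r ?nnegrE ?sqrtr_ge0 ?invr_ge0 ?exprn_ge0.
  rewrite -[leRHS]invrK lef_pV2 ?posrE ?invr_gt0 ?powR_gt0 ?exprn_gt0//.
  rewrite -[leLHS]mul1r ler_pdivrMr ?exprn_gt0// -powP -powRM ?exprn_ge0// ?sqrtr_ge0//.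
  apply: (@le_trans _ _ (1 `^ p)); first by rewrite powR1.
  rewrite ge0_ler_powR ?nnegrE ?mulr_ge0 ?exprn_ge0 ?sqrtr_ge0 ?(ltW p0)//.
  by rewrite -ler_pdivrMr ?exprn_gt0// mul1r.
rewrite integral_nneseries//.
rewrite (eq_eseriesr (g := fun k => (4 ^+ n * (2 ^+ n / P) ^+ k)%:E +
    (P * 2 ^+ n * (P / (4 * 2 ^+ n)) ^+ k)%:E)%E); last first.
  move=> k _; rewrite /f; under eq_integral do rewrite EFinD (EFinM (a k)) (EFinM (b k)).
  rewrite ge0_integralD//; last 4 first.
  - by move=> z _; rewrite -EFinM lee_fin mulr_ge0.
  - by apply/measurable_EFinP; apply: measurable_funM => //; exact: measurable_indic.
  - by move=> z _; rewrite -EFinM lee_fin mulr_ge0.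
  - by apply/measurable_EFinP; apply: measurable_funM => //; exact: measurable_indic.
  have mi A : measurable A -> measurable_fun setT (EFin \o (\1_A : Rn R n -> R)).
    by move=> mA; apply/measurable_EFinP; exact: measurable_indic.
  rewrite !ge0_integralZl//; try (by move=> z _; rewrite lee_fin); try exact: mi; try by rewrite lee_fin ?a0 ?b0.
  rewrite !cE ?exprn_ge0 ?invr_ge0 ?exprn_ge0//.
  have E : (2 ^+ k) ^+ n = (2 ^+ n) ^+ k :> R by rewrite -!exprM mulnC.
  rewrite -!EFinM; congr (_%:E + _%:E)%E.
    have -> : 2 * 2 ^+ k.+1 = 4 * 2 ^+ k :> R by rewrite exprS; ring.
    by rewrite /a [LHS]mulrC !exprMn E exprVn; ring.
  by rewrite /b !exprMn !exprVn exprMn E invfM exprS; ring.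
rewrite nneseriesD; last 2 first.
  by move=> k _ _; rewrite lee_fin mulr_ge0 ?exprn_ge0 ?divr_ge0 ?exprn_ge0// ltW.
  by move=> k _ _; rewrite lee_fin !mulr_ge0 ?exprn_ge0 ?divr_ge0 ?mulr_ge0 ?exprn_ge0// ltW.
rewrite lte_add_pinfty// nneseries_geometric_lty//.
- by rewrite divr_ge0 ?exprn_ge0// ltW.
- by rewrite mulr_ge0 ?exprn_ge0// ltW.
- by rewrite divr_ge0 ?mulr_ge0 ?exprn_ge0// ltW.
Qed.

Definition riesz (z : Rn R n * Rn R n) : R := (eucl_dist z.1 z.2 `^ p)^-1.

Lemma riesz_ge0 w : 0 <= riesz w.
Proof. by rewrite invr_ge0 powR_ge0. Qed.

Lemma rieszC (x y : Rn R n) : riesz (x, y) = riesz (y, x).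
Proof. by rewrite /riesz eucl_distC. Qed.

Lemma measurable_riesz : measurable_fun setT riesz.
Proof.
rewrite /riesz (_ : (fun _ => _) = (fun d : R => d `^ (- p)) \o (fun w : Rn R n * Rn R n => eucl_dist w.1 w.2)).
  by apply: measurableT_comp; [exact: measurable_powR|exact: measurable_eucl_dist].
by apply/funext => w /=; rewrite powRN.
Qed.

Lemma riesz_le (x y : Rn R n) r : 0 < r -> r <= eucl_dist x y ->
  riesz (x, y) <= (r `^ p)^-1.
Proof.
move=> r0 rxy; rewrite lef_pV2 ?posrE ?powR_gt0//; last exact: lt_le_trans rxy.
by rewrite ge0_ler_powR ?nnegrE ?(ltW r0) ?(ltW p0) ?eucl_dist_ge0.
Qed.

Lemma riesz_ge (x y : Rn R n) r : 0 < eucl_dist x y -> eucl_dist x y <= r ->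
  (r `^ p)^-1 <= riesz (x, y).
Proof.
move=> xy0 rxy; rewrite lef_pV2 ?posrE ?powR_gt0//; last exact: lt_le_trans rxy.
by rewrite ge0_ler_powR ?nnegrE ?(ltW p0) ?eucl_dist_ge0// (le_trans _ rxy)// ltW.
Qed.

Definition kernel_mass : \bar R := (\int[lebesgue_Rn R n]_z (trunc_kernel (eucl_norm z))%:E)%E.

Lemma trunc_kernel_translate (x : Rn R n) :
  (\int[lebesgue_Rn R n]_y (trunc_kernel (eucl_dist x y))%:E = kernel_mass)%E.
Proof.
apply/esym; apply: (etrans (integral_affine (fun i => - tnth x i) (oner_neq0 _) _ _)).
- apply/measurable_EFinP; apply: measurableT_comp; first exact: measurable_trunc_kernel.
  exact: measurable_eucl_norm.
- by move=> z; rewrite lee_fin trunc_kernel_ge0.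
rewrite normr1 expr1n mul1e; apply: eq_integral => y _.
by rewrite eucl_dist_norm.
Qed.

Lemma riesz_trunc_le (x y : Rn R n) r : 0 < r -> r <= eucl_dist x y ->
  riesz (x, y) <= (Num.min 1 (r ^+ 2))^-1 * trunc_kernel (eucl_dist x y).
Proof.
move=> r0 rxy; have r20 : 0 < Num.min 1 (r ^+ 2) by rewrite lt_min ltr01 exprn_gt0.
rewrite ler_pdivlMl// /trunc_kernel /riesz/= ler_wpM2r ?invr_ge0 ?powR_ge0//.
by rewrite le_min2// ler_sqr ?nnegrE ?eucl_dist_ge0// ltW.
Qed.

(** At distance at least [r] from [y] the factor [min(1, d^2)] is bounded below, so the kernel is
    dominated by a multiple of the truncated one, whose integral does not depend on [y]. *)
Lemma integral_riesz_away (A : set (Rn R n)) (y : Rn R n) r : measurable A -> 0 < r ->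
  (forall x, A x -> r <= eucl_dist x y) ->
  (\int[lebesgue_Rn R n]_(x in A) (riesz (x, y))%:E < +oo)%E.
Proof.
move=> mA r0 Ar.
have r20 : 0 < Num.min 1 (r ^+ 2) by rewrite lt_min ltr01 exprn_gt0.
have mt : measurable_fun setT (fun x => (trunc_kernel (eucl_dist y x))%:E).
  apply/measurable_EFinP; apply: measurableT_comp; first exact: measurable_trunc_kernel.
  exact: measurable_eucl_dist1.
apply: (@le_lt_trans _ _ (\int[lebesgue_Rn R n]_x
   ((Num.min 1 (r ^+ 2))^-1%:E * (trunc_kernel (eucl_dist y x))%:E))%E).
  rewrite integral_mkcond; apply: ge0_le_integral => //.
  - by move=> x _; rewrite patchE; case: ifP => // _; rewrite lee_fin riesz_ge0.
  - apply/(measurable_restrictT _ _).1 => //; apply/measurable_EFinP.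
    apply: measurable_funTS => //.
    apply: (measurableT_comp measurable_riesz); exact: measurable_pair2.
  - exact: measurable_funeM.
  - move=> x _; rewrite patchE; case: ifP => [|_].
      by rewrite inE => Ax; rewrite -EFinM lee_fin [eucl_dist y x]eucl_distC; apply: riesz_trunc_le => //; exact: Ar.
    by rewrite -EFinM lee_fin mulr_ge0 ?invr_ge0 ?(ltW r20)// trunc_kernel_ge0.
rewrite ge0_integralZl//; last 2 first.
- by move=> x _; rewrite lee_fin trunc_kernel_ge0.
- by rewrite lee_fin invr_ge0 ltW.
rewrite trunc_kernel_translate lte_mul_pinfty ?lee_fin ?invr_ge0 ?(ltW r20)//.
by exact: trunc_kernel_integral.
Qed.

End KernelIntegrability.

Lemma ge0_integralZl_real d (T : measurableType d) (R : realType)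
    (mu : {measure set T -> \bar R}) (D : set T) (f : T -> R) (c : R) :
  measurable D -> 0 <= c -> measurable_fun D f -> (forall x, 0 <= f x) ->
  (\int[mu]_(x in D) (c * f x)%:E = c%:E * \int[mu]_(x in D) (f x)%:E)%E.
Proof.
move=> mD c0 mf f0; under eq_integral do rewrite EFinM.
by apply: ge0_integralZl => //; [exact/measurable_EFinP|move=> x _; rewrite lee_fin].
Qed.

(** * The normalization constant is positive *)

Section Constant.
Context (R : realType) (n : nat) (s : R).
Hypotheses (hs0 : 0 < s) (hs1 : s < 1) (n0 : (0 < n)%N).

Local Notation p := (n%:R + 2 * s).

Let p0 : 0 < p. Proof. by rewrite ltr_wpDl// mulr_gt0. Qed.

Lemma norm_sin_le (x : R) : `|sin x| <= `|x|.
Proof.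
have H (y : R) : 0 <= y -> `|sin y| <= y.
  move=> y0; have [c _ yc] : exists2 c, c \in `[0, y] & sin y - sin 0 = cos c * (y - 0).
    apply: MVT_segment => //.
    by apply: continuous_subspaceT => z; exact: continuous_sin.
  rewrite -[sin y]subr0 -[X in sin y - X](@sin0 R) yc subr0 normrM (ger0_norm y0).
  by rewrite ler_piMl// ler_norml cos_geN1 cos_le1.
have [x0|x0] := leP 0 x; first by rewrite (ger0_norm x0) H.
by rewrite (ltr0_norm x0) -normrN -sinN H// oppr_ge0 ltW.
Qed.

Lemma subr1_cos_le (x : R) : 1 - cos x <= 2 * Num.min 1 (x ^+ 2).
Proof.
have x2 : 1 - cos x <= x ^+ 2.
  (* The half angle turns [1 - cos x] into [2 * sin (x / 2) ^+ 2]. *)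
  have -> : x = x / 2 + x / 2 by field.
  rewrite cosD; set y := x / 2.
  have sy : sin y ^+ 2 <= y ^+ 2.
    by rewrite -[leLHS]real_normK ?num_real// -[leRHS]real_normK ?num_real// ler_sqr ?nnegrE ?norm_sin_le.
  have := cos2Dsin2 y; have := sqr_ge0 y; rewrite -!expr2; move: sy; lra.
have c1 := cos_geN1 x; rewrite minr_pMr// le_min; apply/andP; split; first lra.
by apply: (le_trans x2); have := sqr_ge0 x; lra.
Qed.

Let phi (z : Rn R n) : R := (1 - cos (nth 0 z 0)) / eucl_norm z `^ p.

Let phi_ge0 z : 0 <= phi z.
Proof. by rewrite divr_ge0 ?powR_ge0// subr_ge0 cos_le1. Qed.

Let mphi : measurable_fun setT phi.
Proof.
apply: measurable_funM.
  apply: measurable_funB => //; apply: measurableT_comp; last exact: measurable_nth.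
  by apply: continuous_measurable_fun => x; exact: continuous_cos.
rewrite (_ : (fun _ => _) = (fun d : R => d `^ (- p)) \o @eucl_norm R n).
  by apply: measurableT_comp; [exact: measurable_powR|exact: measurable_eucl_norm].
by apply/funext => z /=; rewrite powRN.
Qed.

Let phi_le z : phi z <= 2 * trunc_kernel n s (eucl_norm z).
Proof.
rewrite /phi /trunc_kernel mulrA ler_wpM2r ?invr_ge0 ?powR_ge0//.
apply: (le_trans (subr1_cos_le _)); rewrite ler_pM2l// le_min2//.
rewrite -[leLHS]real_normK ?num_real// ler_sqr ?nnegrE ?sqrtr_ge0//.
rewrite eucl_norm_dist; apply: le_trans (tnth_eucl_dist z (origin R n) (Ordinal n0)).
by rewrite /origin tnth_nseq subr0 (tnth_nth 0).
Qed.

Let phi_int : (\int[lebesgue_Rn R n]_z (phi z)%:E < +oo)%E.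
Proof.
apply: (@le_lt_trans _ _ (\int[lebesgue_Rn R n]_z (2%:E * (trunc_kernel n s (eucl_norm z))%:E))%E).
  apply: ge0_le_integral => //.
  - by move=> z _; rewrite lee_fin.
  - exact/measurable_EFinP.
  - apply: measurable_funeM; apply/measurable_EFinP; apply: measurableT_comp; first exact: measurable_trunc_kernel.
    exact: measurable_eucl_norm.
  - by move=> z _; rewrite -EFinM lee_fin.
rewrite ge0_integralZl//; last 2 first.
- apply/measurable_EFinP; apply: measurableT_comp; first exact: measurable_trunc_kernel.
  exact: measurable_eucl_norm.
- by move=> z _; rewrite lee_fin trunc_kernel_ge0.
by rewrite lte_mul_pinfty//; exact: trunc_kernel_integral.
Qed.

Let phi_pos : (0 < \int[lebesgue_Rn R n]_z (phi z)%:E)%E.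
Proof.
(* On this box the coordinates lie in [[1, 2]], inside [[0, pi]] where the cosine decreases, and the
   norm lies between [1] and [2 * sqrt n]; the integrand is at least the constant [c] below. *)
pose A (i : 'I_n) : set (measurableTypeR R) := `[1, 2]%classic.
pose B : set (Rn R n) := [set z | forall i, A i (tnth z i)].
have mB : measurable B by apply: measurable_box => i; exact: measurable_itv.
pose r : R := Num.sqrt n%:R * 2.
have r0 : 0 < r by rewrite mulr_gt0// sqrtr_gt0 ltr0n.
pose c := (1 - cos 1) / r `^ p.
have c0 : 0 < c.
  rewrite divr_gt0 ?powR_gt0// subr_gt0; have pi2 := pi_ge2 R.
  have : cos 1 < cos 0 :> R by rewrite ltr_cos ?in_itv//= ?ltr01//; apply/andP; split; lra.
  by rewrite cos0.
apply: (@lt_le_trans _ _ (\int[lebesgue_Rn R n]_(z in B) c%:E)%E).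
  rewrite integral_cst//.
  have lB : lebesgue_Rn R n B = 1%E; last by rewrite [X in (_ * X)%E]lB mule1 lte_fin.
  rewrite /B lebesgue_Rn_prod; last by move=> i; exact: measurable_itv.
  rewrite -[RHS](_ : ((1 : R) ^+ n)%:E = _)%E; last by rewrite expr1n.
  by rewrite -prode_cst; apply: eq_bigr => i _; rewrite lebesgue_itvcc; [congr EFin|]; lra.
rewrite [leLHS]integral_mkcond; apply: ge0_le_integral => //.
- by move=> z _; rewrite patchE; case: ifP => // _; rewrite lee_fin ltW.
- by apply/(measurable_restrictT _ _).1 => //; exact: measurable_cst.
- exact/measurable_EFinP.
move=> z _; rewrite patchE; case: ifP => [|_]; last by rewrite lee_fin.
rewrite inE => Bz; rewrite lee_fin /c /phi.
have zi i : 1 <= tnth z i <= 2 by have := Bz i; rewrite /A/= in_itv.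
have z1 : 1 <= eucl_norm z.
  rewrite eucl_norm_dist; apply: le_trans (tnth_eucl_dist z (origin R n) (Ordinal n0)).
  rewrite /origin tnth_nseq subr0; have /andP[z1 _] := zi (Ordinal n0).
  by apply: (le_trans z1); rewrite ler_norm.
have z2 : eucl_norm z <= r.
  rewrite eucl_norm_dist eucl_distC; apply: eucl_dist_le => // i.
  by rewrite /origin tnth_nseq subr0; have /andP[a b] := zi i; rewrite ger0_norm//; lra.
rewrite ler_pM ?invr_ge0 ?powR_ge0 ?subr_ge0 ?cos_le1//.
  rewrite lerD2l lerN2; have := zi (Ordinal n0); rewrite (tnth_nth 0)/= => /andP[a b].
  have pi2 := pi_ge2 R.
  move: a; rewrite le_eqVlt => /predU1P[<-//|a]; apply/ltW.
  by rewrite ltr_cos ?in_itv//=; apply/andP; split; lra.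
rewrite lef_pV2 ?posrE ?powR_gt0//; last exact: lt_le_trans z1.
by rewrite ge0_ler_powR ?nnegrE ?(ltW p0)// ?ltW//; lra.
Qed.

(** Finiteness matters as much as positivity: [fine] sends an infinite integral to [0], whose
    inverse is [0]. *)
Lemma frac_lap_const_gt0 : 0 < @frac_lap_const R n s.
Proof.
rewrite /frac_lap_const invr_gt0 /Rintegral fine_gt0//.
by apply/andP; split; [exact: phi_pos|exact: phi_int].
Qed.

End Constant.

(** * An explicit test function *)

Section Tent.
Context (R : realType) (n : nat) (s : R).
Hypotheses (hs0 : 0 < s) (hs1 : s < 1) (n0 : (0 < n)%N).
Implicit Types x y : Rn R n.

(** A nonzero Lipschitz function supported in a cube; its finite energy and positive mass will show
    that the best constant is positive. *)
Definition tent x : R := Num.max 0 (1 - \sum_(i < n) `|tnth x i|).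

Lemma measurable_tent : measurable_fun setT tent.
Proof.
apply: measurable_maxr => //; apply: measurable_funB => //.
apply: measurable_sum => i; apply: measurableT_comp => //; exact: measurable_tnth.
Qed.

Lemma tent_ge0 x : 0 <= tent x. Proof. by rewrite le_max lexx. Qed.

Lemma tent_le1 x : tent x <= 1.
Proof. by rewrite ge_max ler01/= gerBl sumr_ge0. Qed.

Lemma tent_support x : ~ cube (origin R n) 1 x -> tent x = 0.
Proof.
move=> xC; apply/max_idPl; rewrite subr_le0 leNgt; apply/negP => x1; apply: xC => i.
rewrite /origin tnth_nseq subr0; apply: ltW; apply: le_lt_trans x1.
by rewrite (bigD1 i)//= lerDl sumr_ge0.
Qed.

Lemma tent_lip x y : `|tent x - tent y| <= n%:R * eucl_dist x y.
Proof.
have H a b : `|Num.max 0 a - Num.max 0 b| <= `|a - b| :> R.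
  have h1 := ler_norm (a - b); have h2 := ler_norm (b - a); rewrite distrC in h2.
  by rewrite ler_norml /Num.max; case: ltP => ?; case: ltP => ?; apply/andP; split; lra.
apply: (le_trans (H _ _)).
rewrite (_ : _ - _ = \sum_(i < n) (`|tnth y i| - `|tnth x i|)); last by rewrite sumrB; ring.
apply: (le_trans (ler_norm_sum _ _ _)).
rewrite mulr_natl -[X in _ *+ X](card_ord n) -sumr_const; apply: ler_sum => i _.
by apply: le_trans (tnth_eucl_dist x y i); rewrite [leRHS]distrC ler_dist_dist.
Qed.

(** The squared difference is at most [n^2 * min(1, d^2)] and vanishes unless one of the two points
    lies in the cube [C]. Integrating the truncated kernel over the other point leaves the measure
    of [C]. *)
Lemma energy_tent_lty D : measurable D -> (energy s tent D < +oo)%E.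
Proof.
move=> mD.
pose C : set (Rn R n) := cube (origin R n) 1.
have mC : measurable C by exact: measurable_cube.
pose T (z : Rn R n * Rn R n) := trunc_kernel n s (eucl_dist z.1 z.2).
have T0 z : 0 <= T z by exact: trunc_kernel_ge0.
have mT : measurable_fun setT T.
  by apply: measurableT_comp; [exact: measurable_trunc_kernel|exact: measurable_eucl_dist].
have i0 x : 0 <= \1_C x :> R by rewrite indicE.
have mi : measurable_fun setT (\1_C : Rn R n -> R) by exact: measurable_indic.
have mi1 : measurable_fun setT (fun z : Rn R n * Rn R n => \1_C z.1 : R) by exact: measurableT_comp.
have mi2 : measurable_fun setT (fun z : Rn R n * Rn R n => \1_C z.2 : R) by exact: measurableT_comp.
pose c : R := n%:R ^+ 2.
have c0 : 0 <= c by rewrite exprn_ge0.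
pose F1 (z : Rn R n * Rn R n) := (c * \1_C z.1 * T z)%:E.
pose F2 (z : Rn R n * Rn R n) := (c * \1_C z.2 * T z)%:E.
have F10 z : (0 <= F1 z)%E by rewrite lee_fin; apply: mulr_ge0 => //; exact: mulr_ge0.
have F20 z : (0 <= F2 z)%E by rewrite lee_fin; apply: mulr_ge0 => //; exact: mulr_ge0.
have mF1 : measurable_fun setT F1.
  by apply/measurable_EFinP; do 2! apply: measurable_funM => //.
have mF2 : measurable_fun setT F2.
  by apply/measurable_EFinP; do 2! apply: measurable_funM => //.
have KC : (\int[lebesgue_Rn R n]_x ((c * \1_C x)%:E * @kernel_mass R n s) < +oo)%E.
  rewrite ge0_integralZr//; last 3 first.
  - by apply/measurable_EFinP; apply: measurable_funM.
  - by move=> x _; rewrite lee_fin mulr_ge0.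
  - by apply: integral_ge0 => z _; rewrite lee_fin trunc_kernel_ge0.
  have K0lty : (@kernel_mass R n s < +oo)%E by exact: trunc_kernel_integral.
  have K0ge0 : (0 <= @kernel_mass R n s)%E by apply: integral_ge0 => z _; rewrite lee_fin trunc_kernel_ge0.
  rewrite ge0_integralZl_real// integral_indic// setIT.
  have lC : lebesgue_Rn R n C = ((2 * 1) ^+ n)%:E by exact: lebesgue_cube.
  by rewrite [X in (_ * X * _)%E]lC -EFinM lte_mul_pinfty// lee_fin mulr_ge0// exprn_ge0.
have F1lty : (\int[lebesgue_RnRn R n]_z F1 z < +oo)%E.
  rewrite (tonelliF mF1 F10); apply: le_lt_trans KC; apply: ge0_le_integral => //.
  - by move=> x _; apply: integral_ge0.
  - exact: (measurable_tonelliF mF1).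
  - apply: emeasurable_funM => //.
    by apply/measurable_EFinP; apply: measurable_funM.
  move=> x _.
  rewrite /F1 /= (@ge0_integralZl_real _ _ _ _ setT (fun y => T (x, y)) (c * \1_C x) measurableT (mulr_ge0 c0 (i0 x)) (measurableT_comp mT (measurable_pair1 x)) (fun y => T0 _)).
  by rewrite /T /= trunc_kernel_translate lexx.
have F2lty : (\int[lebesgue_RnRn R n]_z F2 z < +oo)%E.
  rewrite (tonelliG mF2 F20); apply: le_lt_trans KC; apply: ge0_le_integral => //.
  - by move=> x _; apply: integral_ge0.
  - exact: (measurable_tonelliG mF2).
  - apply: emeasurable_funM => //.
    by apply/measurable_EFinP; apply: measurable_funM.
  move=> y _.
  rewrite /F2 /= (@ge0_integralZl_real _ _ _ _ setT (fun x => T (x, y)) (c * \1_C y) measurableT (mulr_ge0 c0 (i0 y)) (measurableT_comp mT (measurable_pair2 y)) (fun x => T0 _)).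
  rewrite (eq_integral (fun x => (trunc_kernel n s (eucl_dist y x))%:E)).
    by rewrite trunc_kernel_translate lexx.
  by move=> x _; rewrite /T /= eucl_distC.
apply: (@le_lt_trans _ _ (\int[lebesgue_RnRn R n]_z (F1 z + F2 z))%E); last first.
  by rewrite ge0_integralD// lte_add_pinfty.
rewrite /energy integral_mkcond; apply: ge0_le_integral => //.
- move=> z _; rewrite patchE; case: ifP => // _.
  by rewrite lee_fin divr_ge0 ?sqr_ge0 ?powR_ge0.
- apply/(measurable_restrictT _ _).1 => //; apply: measurable_funTS => //.
  apply/measurable_EFinP; apply: measurable_funM.
    apply: measurable_funX; apply: measurable_funB.
      exact: (measurableT_comp measurable_tent measurable_fst).
    exact: (measurableT_comp measurable_tent measurable_snd).
  exact: measurable_riesz.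
- exact: emeasurable_funD.
move=> [x y] _; rewrite patchE; case: ifP => [_|_]; last exact: adde_ge0.
have H : (tent x - tent y) ^+ 2 <= c * Num.min 1 (eucl_dist x y ^+ 2).
  have c1 : 1 <= c by rewrite /c -[leLHS](expr1n _ 2) ler_sqr ?nnegrE ?ler1n.
  rewrite minr_pMr// le_min; apply/andP; split.
    rewrite mulr1; apply: le_trans c1; rewrite -(expr1n _ 2) -[leLHS]real_normK ?num_real//.
    rewrite ler_sqr ?nnegrE// ler_norml.
    have b1 := tent_ge0 x; have b2 := tent_ge0 y.
    by have b3 := tent_le1 x; have b4 := tent_le1 y; apply/andP; split; lra.
  rewrite /c -exprMn -[leLHS]real_normK ?num_real//.
  by rewrite ler_sqr ?nnegrE ?mulr_ge0 ?eucl_dist_ge0// tent_lip.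
have m0 : 0 <= c * Num.min 1 (eucl_dist x y ^+ 2).
  by rewrite mulr_ge0// le_min ler01 sqr_ge0.
have [Cxy|/not_orP[xC yC]] := pselect (C x \/ C y); last first.
  by rewrite /= !tent_support// subrr expr0n/= mul0r adde_ge0.
rewrite -EFinD lee_fin -mulrDl /= /T /trunc_kernel mulrA ler_wpM2r ?invr_ge0 ?powR_ge0//=.
apply: (le_trans H); rewrite -mulrDr -[leRHS]mulrA ler_wpM2l// ler_peMl ?le_min ?ler01 ?sqr_ge0//.
case: Cxy => [xC|yC].
  by rewrite [\1_C x]indicE mem_set// lerDl.
by rewrite [\1_C y]indicE mem_set// lerDr.
Qed.

End Tent.

(** * Inequalities for real powers *)

Section PowerInequalities.
Context (R : realType).
Implicit Types (a b x q e : R).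

(** Convexity of [|.|^q]: the tangent at [a] lies below the graph. Young's inequality for [|a + b|]
    and [a^(q - 1)] covers [a = 0] and negative [a + b] alike. *)
Lemma powR_tangent a b q : 0 <= a -> 1 < q ->
  a `^ q + q * (a `^ (q - 1) * b) <= `|a + b| `^ q.
Proof.
move=> a0 q1; have q0 : 0 < q by lra.
have q10 : 0 < q - 1 by lra.
have H := @conjugate_powR R `|a + b| (a `^ (q - 1)) q (q / (q - 1)) (normr_ge0 _)
  (powR_ge0 _ _) q0 (divr_gt0 q0 q10).
have {H} := H _; have -> : q^-1 + (q / (q - 1))^-1 = 1 by field; apply/andP; split; lra.
rewrite -powRrM (_ : (q - 1) * (q / (q - 1)) = q); last by field; lra.
move=> /(_ erefl) H.
have ab : (a + b) * a `^ (q - 1) <= `|a + b| * a `^ (q - 1).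
  by rewrite ler_wpM2r ?powR_ge0 ?ler_norm.
have aq : a * a `^ (q - 1) = a `^ q by rewrite mulr_powRB1.
have {}H : q * (`|a + b| * a `^ (q - 1)) <= `|a + b| `^ q + (q - 1) * a `^ q.
  rewrite -ler_pdivlMl//; apply: (le_trans H); rewrite mulrDr le_eqVlt; apply/orP; left; apply/eqP.
  by field; apply/andP; split; lra.
have {}ab : q * ((a + b) * a `^ (q - 1)) <= q * (`|a + b| * a `^ (q - 1)) by rewrite ler_pM2l.
have := le_trans ab H; rewrite [(a + b) * _]mulrDl aq; nra.
Qed.

(** With [(1 + d)^q = 1 + e]: if [|b| <= d * |a|], the sum is at most [(1 + d) * |a|]; otherwise
    [|a|] is itself controlled by [|b|]. This is the pointwise inequality behind the splitting of
    the mass. *)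
Lemma powR_split q e : 0 < q -> 0 < e ->
  exists2 C, 0 <= C & forall a b, `|a + b| `^ q <= (1 + e) * `|a| `^ q + C * `|b| `^ q.
Proof.
move=> q0 e0; pose d := (1 + e) `^ q^-1 - 1.
have d1 : (1 + d) `^ q = 1 + e.
  by rewrite /d addrC subrK -powRrM mulVf ?gt_eqF// powRr1//; lra.
have d0 : 0 < d.
  rewrite subr_gt0 -[ltLHS](_ : 1 `^ q^-1 = 1); last by rewrite powR1.
  by rewrite gt0_ltr_powR ?invr_gt0 ?nnegrE//; lra.
exists ((1 + d^-1) `^ q) => [|a b]; first exact: powR_ge0.
have mono x y : 0 <= x -> x <= y -> x `^ q <= y `^ q.
  by move=> x0 xy; rewrite ge0_ler_powR ?nnegrE ?(ltW q0)// (le_trans x0).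
have d'0 : 0 < d^-1 by rewrite invr_gt0.
have [ba|ab] := leP `|b| (d * `|a|).
  apply: (@le_trans _ _ (((1 + d) * `|a|) `^ q)).
    by apply: mono => //; apply: (le_trans (ler_normD _ _)); rewrite mulrDl mul1r lerD2l.
  by rewrite powRM//; [rewrite d1 lerDl mulr_ge0 ?powR_ge0|lra].
apply: (@le_trans _ _ (((1 + d^-1) * `|b|) `^ q)).
  apply: mono => //; apply: (le_trans (ler_normD _ _)); rewrite mulrDl mul1r addrC lerD2l.
  by rewrite ler_pdivlMl// ltW.
by rewrite powRM//; [rewrite lerDr mulr_ge0 ?powR_ge0//; lra|lra].
Qed.

(** Above the threshold [e] the factor [(x / e)^(q - 1)] is at least [1]. With the threshold free,
    this takes the place of Hoelder's inequality. *)
Lemma powR_linear_bound x e q : 0 <= x -> 0 < e -> 1 <= q ->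
  x <= e + e `^ (1 - q) * x `^ q.
Proof.
move=> x0 e0 q1; have [xe|ex] := leP x e.
  by rewrite (le_trans xe)// lerDl mulr_ge0 ?powR_ge0.
have xp : 0 < x by lra.
rewrite ler_wpDl// ?(ltW e0)//.
rewrite -ler_pdivrMr ?powR_gt0// -powRN -[X in X * _](powRr1 x0) -powRD; last by rewrite (gt_eqF xp) implybT.
rewrite -[X in _ <= X]invrK -[X in X <= _]invrK lef_pV2 ?posrE ?invr_gt0 ?powR_gt0//.
rewrite -!powRN ge0_ler_powR ?nnegrE; lra.
Qed.

Lemma powR_lt_id x q : 0 < x < 1 -> 1 < q -> x `^ q < x.
Proof.
move=> /andP[x0 x1] q1.
rewrite -(mulr_powRB1 (ltW x0)); last lra.
rewrite gtr_pMr// -[ltRHS](_ : 1 `^ (q - 1) = 1); last by rewrite powR1.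
by rewrite gt0_ltr_powR ?nnegrE//; lra.
Qed.

Lemma powR_le_id x q : 0 <= x <= 1 -> 1 <= q -> x `^ q <= x.
Proof.
move=> /andP[]; rewrite le_eqVlt => /predU1P[<- _ q1|x0 x1 q1].
  by rewrite powR0//; lra.
by apply: ge1r_powR => //; rewrite x0.
Qed.

(** Comparison of first-order terms at [0] from the right. Convexity bounds the power by
    [1 + k * X^(k - 1) * (X - 1)]; after division by [t] this leaves [f t], which tends to
    [k * b]. *)
Lemma powR_variation_le a b c k : 1 < k ->
  (forall t, 0 <= 1 + t * b + t ^+ 2 * c) ->
  (forall t, 0 < t -> 1 + t * a <= (1 + t * b + t ^+ 2 * c) `^ k) -> a <= k * b.
Proof.
move=> k1 X0 H; rewrite leNgt; apply/negP => ka.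
pose X t := 1 + t * b + t ^+ 2 * c.
pose f t := k * (X t `^ (k - 1)) * (b + t * c).
have af t : 0 < t -> a <= f t.
  move=> t0; have T := @powR_tangent (X t) (1 - X t) k (X0 t) k1.
  rewrite (_ : X t + (1 - X t) = 1) in T; last by ring.
  rewrite normr1 powR1 in T.
  rewrite -(ler_pM2l t0); have := H t t0; rewrite -/(X t) /f => Ht.
  have -> : t * (k * X t `^ (k - 1) * (b + t * c)) = - (k * (X t `^ (k - 1) * (1 - X t))).
    by rewrite /X; ring.
  lra.
have Xc : X t @[t --> 0^'+] --> X 0.
  apply: cvg_at_right_filter; apply: cvgD; first apply: cvgD; first exact: cvg_cst.
    by apply: cvgM; [exact: cvg_id|exact: cvg_cst].
  by apply: cvgM; [exact: exprn_continuous|exact: cvg_cst].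
have X01 : X 0 = 1 by rewrite /X; ring.
have fc : f t @[t --> 0^'+] --> f 0.
  apply: cvgM; last first.
    apply: cvg_at_right_filter; apply: cvgD; first exact: cvg_cst.
    by apply: cvgM; [exact: cvg_id|exact: cvg_cst].
  apply: cvgM; first exact: cvg_cst.
  have pc : {for X 0, continuous (fun x : R => x `^ (k - 1))}.
    apply: differentiable_continuous; apply/derivable1_diffP.
    by apply: derivable_powR; rewrite in_itv/= andbT X01.
  exact: (cvg_comp _ _ Xc pc).
have f0 : f 0 = k * b by rewrite /f X01 powR1; ring.
rewrite f0 in fc.
have /filter_ex[t /= [t0 ft]] : \forall t \near 0^'+, 0 < t /\ f t < a.
  near=> t; split; first by near: t; exact: nbhs_right_gt.
  by near: t; exact: (cvgr_lt _ fc).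
by have := af t t0; rewrite leNgt ft.
Unshelve. all: by end_near. Qed.

Lemma powR_variation a b c k : 1 < k ->
  (forall t, 0 <= 1 + t * b + t ^+ 2 * c) ->
  (forall t, 1 + t * a <= (1 + t * b + t ^+ 2 * c) `^ k) -> a = k * b.
Proof.
move=> k1 X0 H; apply/le_anti/andP; split.
  by apply: (@powR_variation_le a b c).
rewrite -lerN2 -mulrN; apply: (@powR_variation_le _ _ c) => // t.
  by have := X0 (- t); rewrite sqrrN mulNr mulrN.
by move=> _; have := H (- t); rewrite sqrrN !mulNr !mulrN.
Qed.

End PowerInequalities.

(** * Arithmetic of the critical exponent *)

Section CriticalExponent.
Context (R : realType) (n : nat) (s : R).
Hypotheses (hs0 : 0 < s) (n0 : (0 < n)%N) (hns : 2 * s < n%:R).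
Local Notation q := (@crit_exp R n s).

Let N : R := n%:R.
Let N0 : 0 < N. Proof. by rewrite ltr0n. Qed.

Lemma crit_exp_gt2 : 2 < q.
Proof.
rewrite /crit_exp -/N ltr_pdivlMr; last by rewrite subr_gt0.
by rewrite mulrBr gtrBl mulr_gt0// mulr_gt0.
Qed.

Lemma crit_expN : (n%:R + 2 * s) / (n%:R - 2 * s) = q - 1.
Proof. by rewrite /crit_exp; field; rewrite subr_eq0 gt_eqF. Qed.

(** In the application [d ^+ 2] is the inner energy at one point and [m] bounds the averages over
    cubes. The outcome is quadratic in [d], so that it integrates to the energy, and the surplus
    [q - 2] falls on [m]. *)
Lemma hedberg_optimization (C m d X : R) : 0 <= C -> 0 < m -> 0 < d -> 0 <= X ->
  (forall r, 0 < r -> X <= C * (r `^ s * d) + m * r `^ (- (N / q))) ->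
  X `^ q <= (C + 1) `^ q * (m `^ (q - 2) * d ^+ 2).
Proof.
move=> C0 m0 d0 X0 H.
have q2 := crit_exp_gt2.
have Ns : N - 2 * s != 0 by rewrite subr_eq0 gt_eqF.
have N1 : N != 0 by rewrite gt_eqF.
have Nq : N / q = (N - 2 * s) / 2.
  by rewrite /crit_exp -/N; field; rewrite Ns N1.
(* The radius at which the two terms are equal up to [C], since [s + N / q = N / 2]. Their common
   value [B] satisfies [B^q = m^(q - 2) * d^2]. *)
pose r := (m / d) `^ (2 / N).
have md : 0 < m / d by rewrite divr_gt0.
have rE x : r `^ x = m `^ (2 / N * x) * d `^ (- (2 / N * x)).
  by rewrite /r -powRrM powRM ?invr_ge0 ?ltW// -[in LHS](powR_inv1 (ltW d0)) -powRrM mulN1r.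
pose B := m `^ (2 * s / N) * d `^ ((N - 2 * s) / N).
have mp x y : m `^ x * m `^ y = m `^ (x + y) by rewrite powRD// (gt_eqF m0) implybT.
have dp x y : d `^ x * d `^ y = d `^ (x + y) by rewrite powRD// (gt_eqF d0) implybT.
have E1 : r `^ s * d = B.
  rewrite rE -[X in _ * X](powRr1 (ltW d0)) -mulrA dp /B; congr (_ `^ _ * _ `^ _); by field.
have E2 : m * r `^ (- (N / q)) = B.
  rewrite rE Nq -[X in X * _](powRr1 (ltW m0)) mulrA mp /B; congr (_ `^ _ * _ `^ _); by field.
have := H r (powR_gt0 _ md); rewrite E1 E2 -[X in _ + X]mul1r -mulrDl => XB.
apply: (@le_trans _ _ (((C + 1) * B) `^ q)).
  by rewrite ge0_ler_powR ?nnegrE// ?(le_trans X0 XB)//; lra.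
have B0 : 0 <= B by rewrite mulr_ge0 ?powR_ge0.
rewrite powRM//; last lra.
rewrite ler_wpM2l ?powR_ge0// /B powRM ?powR_ge0// -!powRrM.
rewrite -(powR_mulrn 2 (ltW d0)) le_eqVlt; apply/orP; left; apply/eqP.
by congr (_ `^ _ * _ `^ _); rewrite /crit_exp -/N; field; rewrite Ns N1.
Qed.

End CriticalExponent.

Lemma ge0_integralD_real d (T : measurableType d) (R : realType)
    (mu : {measure set T -> \bar R}) (D : set T) (f g : T -> R) :
  measurable D -> measurable_fun D f -> measurable_fun D g ->
  (forall x, D x -> 0 <= f x) -> (forall x, D x -> 0 <= g x) ->
  (\int[mu]_(x in D) (f x + g x)%:E =
   \int[mu]_(x in D) (f x)%:E + \int[mu]_(x in D) (g x)%:E)%E.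
Proof.
move=> mD mf mg f0 g0; under eq_integral do rewrite EFinD.
apply: ge0_integralD => //.
- exact/measurable_EFinP.
- exact/measurable_EFinP.
Qed.

Lemma ge0_le_integral_real d (T : measurableType d) (R : realType)
    (mu : {measure set T -> \bar R}) (D : set T) (f g : T -> R) :
  measurable D -> measurable_fun D f -> measurable_fun D g ->
  (forall x, D x -> 0 <= f x) -> (forall x, D x -> f x <= g x) ->
  (\int[mu]_(x in D) (f x)%:E <= \int[mu]_(x in D) (g x)%:E)%E.
Proof.
move=> mD mf mg f0 fg; apply: ge0_le_integral => //.
- exact/measurable_EFinP.
- exact/measurable_EFinP.
Qed.

Lemma tonelli_rect (R : realType) n (A B : set (Rn R n)) (f : Rn R n * Rn R n -> \bar R) :
  measurable A -> measurable B -> measurable_fun setT f -> (forall z, 0 <= f z)%E ->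
  (\int[lebesgue_RnRn R n]_(z in A `*` B) f z =
   \int[lebesgue_Rn R n]_(x in A) \int[lebesgue_Rn R n]_(y in B) f (x, y))%E.
Proof.
move=> mA mB mf f0; rewrite integral_mkcond tonelliF; last 2 first.
- apply/(measurable_restrictT _ _).1; first exact: measurableX.
  exact: measurable_funTS.
- by move=> z; rewrite patchE; case: ifP.
rewrite [RHS]integral_mkcond; apply: eq_integral => x _; rewrite [RHS]patchE.
case: ifPn => xA; last first.
  apply: integral0_eq => y _; rewrite patchE ifF//; apply/negP; rewrite inE => -[/= Ax _].
  by move/negP: xA; apply; rewrite inE.
rewrite [RHS]integral_mkcond; apply: eq_integral => y _; rewrite !patchE.
suff -> : ((x, y) \in A `*` B) = (y \in B) by [].
rewrite inE in xA; apply/idP/idP; rewrite !inE; first by case.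
by move=> By; split.
Qed.

(** * Mass, energy and the Sobolev inequality *)

Section Functionals.
Context (R : realType) (n : nat) (s : R).
Hypotheses (hs0 : 0 < s) (hs1 : s < 1) (n0 : (0 < n)%N) (hns : 2 * s < n%:R).
Local Notation p := (n%:R + 2 * s).
Local Notation q := (@crit_exp R n s).
Local Notation J := (@riesz R n s).
Local Notation mu := (lebesgue_Rn R n).
Local Notation mu2 := (lebesgue_RnRn R n).
Implicit Types (O P : set (Rn R n)) (u v : Rn R n -> R).

Definition T_set O : set (Rn R n * Rn R n) := ~` (~` O `*` ~` O).
Local Notation Tset := T_set.

Lemma measurable_T_set O : measurable O -> measurable (Tset O).
Proof. by move=> mO; apply: measurableC; apply: measurableX; exact: measurableC. Qed.

Definition energy_density u (z : Rn R n * Rn R n) : R := (u z.1 - u z.2) ^+ 2 * J z.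
Local Notation edens := energy_density.

Lemma energy_density_ge0 u z : 0 <= edens u z.
Proof. by rewrite mulr_ge0 ?sqr_ge0 ?riesz_ge0. Qed.

Lemma measurable_energy_density u : measurable_fun setT u -> measurable_fun setT (edens u).
Proof.
move=> mu_; apply: measurable_funM; last exact: measurable_riesz.
apply: measurable_funX; apply: measurable_funB.
  exact: (measurableT_comp mu_ measurable_fst).
exact: (measurableT_comp mu_ measurable_snd).
Qed.

Definition energyT O u : \bar R := energy s u (Tset O).
Local Notation EE := energyT.
Definition mass O u : \bar R := (\int[mu]_(x in O) (`|u x| `^ q)%:E)%E.
Local Notation MM := mass.
Definition inner_energy O u x : \bar R := (\int[mu]_(y in O) (edens u (x, y))%:E)%E.
Local Notation DD := inner_energy.

Lemma energyTE O u : EE O u = (\int[mu2]_(z in Tset O) (edens u z)%:E)%E.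
Proof. by []. Qed.

Lemma energyT_ge0 O u : (0 <= EE O u)%E.
Proof. by apply: integral_ge0 => z _; rewrite lee_fin energy_density_ge0. Qed.

Lemma mass_ge0 O u : (0 <= MM O u)%E.
Proof. by apply: integral_ge0 => x _; rewrite lee_fin powR_ge0. Qed.

Lemma inner_energy_ge0 O u x : (0 <= DD O u x)%E.
Proof. by apply: integral_ge0 => y _; rewrite lee_fin energy_density_ge0. Qed.

Lemma measurable_powR_norm u : measurable_fun setT u ->
  measurable_fun setT (fun x => `|u x| `^ q).
Proof.
move=> mu_; rewrite (_ : (fun _ => _) = (fun y : R => y `^ q) \o (fun x => `|u x|))//.
by apply: measurableT_comp; [exact: measurable_powR|exact: measurableT_comp].
Qed.

Lemma measurable_inner_energy O u : measurable O -> measurable_fun setT u ->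
  measurable_fun setT (DD O u).
Proof.
move=> mO mu_; rewrite /DD.
rewrite (_ : (fun _ => _) = (fun x => \int[mu]_y (EFin \o edens u \_ (setT `*` O)) (x, y))%E).
  apply: measurable_tonelliF.
    apply/measurable_EFinP; apply/(measurable_restrictT _ _).1; first exact: measurableX.
    by apply: measurable_funTS; exact: measurable_energy_density.
  by move=> z /=; rewrite patchE; case: ifP => // _; rewrite lee_fin energy_density_ge0.
apply/funext => x; rewrite integral_mkcond; apply: eq_integral => y _; rewrite /= !patchE.
suff -> : ((x, y) \in setT `*` O) = (y \in O) by case: ifP.
by apply/idP/idP; rewrite !inE; [case|move=> Oy; split].
Qed.

Lemma integral_inner_energy O u : measurable O -> measurable_fun setT u ->
  (\int[mu]_(x in O) DD O u x = \int[mu2]_(z in O `*` O) (edens u z)%:E)%E.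
Proof.
move=> mO mu_; rewrite tonelli_rect//.
  by apply/measurable_EFinP; exact: measurable_energy_density.
by move=> z; rewrite lee_fin energy_density_ge0.
Qed.

Lemma integral_inner_energy_le_energyT O u : measurable O -> measurable_fun setT u ->
  (\int[mu]_(x in O) DD O u x <= EE O u)%E.
Proof.
move=> mO mu_; rewrite integral_inner_energy// energyTE; apply: ge0_subset_integral.
- exact: measurableX.
- exact: measurable_T_set.
- by apply: measurable_funTS; apply/measurable_EFinP; exact: measurable_energy_density.
- by move=> z _; rewrite lee_fin energy_density_ge0.
- by move=> z [z1 z2] [/= nz1 _].
Qed.

Let p0 : 0 < p. Proof. by rewrite ltr_wpDl// mulr_gt0. Qed.

(** The first summand comes from the volume [(2r)^n] of a cube, the second from its Euclidean radius
    [sqrt n * r] raised to the power [n + 2s]; the halves are those of [norm_diff_le]. *)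
Definition average_const : R := 2 ^+ n / 2 + Num.sqrt n%:R `^ p / 2.
Local Notation CC := average_const.

Lemma CC_ge0 : 0 <= CC.
Proof. by rewrite addr_ge0// divr_ge0// ?exprn_ge0 ?powR_ge0. Qed.

Lemma eucl_dist_eq0 (x y : Rn R n) : eucl_dist x y = 0 -> x = y.
Proof.
move=> xy; apply: eq_from_tnth => i; apply/eqP; rewrite -subr_eq0 -normr_le0.
by rewrite -xy tnth_eucl_dist.
Qed.

Lemma sqr_diff_le u (x y : Rn R n) r : 0 < r -> eucl_dist x y <= r ->
  (u x - u y) ^+ 2 <= r `^ p * edens u (x, y).
Proof.
(* On the diagonal the kernel takes the value [0], so the bound rests on the vanishing
   difference. *)
move=> r0 xyr; have [xy0|xy0] := eqVneq (eucl_dist x y) 0.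
  by rewrite (eucl_dist_eq0 xy0) subrr expr0n/= mulr_ge0 ?powR_ge0 ?energy_density_ge0.
have xyp : 0 < eucl_dist x y by rewrite lt_neqAle eq_sym xy0 eucl_dist_ge0.
rewrite /edens/= mulrCA ler_peMr ?sqr_ge0// -ler_pdivrMl ?powR_gt0// mulr1.
exact: riesz_ge.
Qed.

(** [D <= t / 2 + D^2 / (2t)] with a free [t] replaces the Cauchy-Schwarz inequality: the bound is
    linear in the energy density and can be integrated directly. *)
Lemma norm_diff_le u (x y : Rn R n) r t : 0 < r -> 0 < t -> eucl_dist x y <= r ->
  `|u x - u y| <= t / 2 + r `^ p / (2 * t) * edens u (x, y).
Proof.
move=> r0 t0 xyr; have H := sqr_diff_le u r0 xyr.
set e := edens u (x, y) in H *; set a := r `^ p in H *.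
rewrite (_ : a / (2 * t) * e = (a * e) / (2 * t)); last by ring.
apply: (@le_trans _ _ (t / 2 + `|u x - u y| ^+ 2 / (2 * t))).
  have -> : t / 2 + `|u x - u y| ^+ 2 / (2 * t) = `|u x - u y| + (`|u x - u y| - t) ^+ 2 / (2 * t) by field; lra.
  by rewrite lerDl divr_ge0 ?sqr_ge0//; lra.
rewrite lerD2l ler_wpM2r ?invr_ge0//; first lra.
by rewrite real_normK ?num_real.
Qed.

(** Average [|u x| <= |u x - u y| + |u y|] over [y] in the part of the cube inside [P]; the lower
    bound on its measure turns the left side into at least [r^n * |u x|]. *)
Lemma sobolev_average P u m (x : Rn R n) d r : measurable P -> measurable_fun setT u ->
  0 <= m -> 0 < d -> 0 < r -> (DD P u x <= (d ^+ 2)%:E)%E ->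
  ((r ^+ n)%:E <= mu (P `&` cube x r))%E ->
  (\int[mu]_(y in P `&` cube x r) (`|u y|)%:E <= (m * r `^ (n%:R - n%:R / q))%:E)%E ->
  `|u x| <= CC * (r `^ s * d) + m * r `^ (- (n%:R / q)).
Proof.
move=> mP mu_ m0 d0 r0 Dd Pr um.
pose Q := P `&` cube x r.
have mQ : measurable Q by apply: measurableI => //; exact: measurable_cube.
pose l := Num.sqrt n%:R * r.
have l0 : 0 < l by rewrite mulr_gt0// sqrtr_gt0 ltr0n.
(* Balances the volume term [t * r^n] against [r^(n + 2s) * d^2 / t]. *)
pose t := r `^ s * d.
have t0 : 0 < t by rewrite mulr_gt0// powR_gt0.
have a0 : 0 <= l `^ p / (2 * t) by rewrite divr_ge0 ?powR_ge0//; lra.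
have rE : r ^+ n = r `^ n%:R by rewrite powR_mulrn// ltW.
have rD a b : r `^ a * r `^ b = r `^ (a + b) by rewrite powRD// (gt_eqF r0) implybT.
have mD : measurable_fun setT (fun y => edens u (x, y)).
  exact: (measurableT_comp (measurable_energy_density mu_) (measurable_pair1 x)).
have mS (f : Rn R n -> R) : measurable_fun setT f -> measurable_fun Q f.
  by move=> mf; apply: measurable_funTS.
pose f1 y := l `^ p / (2 * t) * edens u (x, y).
have mf1 : measurable_fun Q f1 by apply: mS; exact: measurable_funM.
have mau : measurable_fun Q (fun y => `|u y|) by apply: mS; exact: measurableT_comp.
have mf2 : measurable_fun Q (fun y => f1 y + `|u y|) by exact: measurable_funD.
have f10 y : 0 <= f1 y by rewrite mulr_ge0// energy_density_ge0.
have t20 : 0 <= t / 2 by rewrite divr_ge0// ltW.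
have step1 : ((`|u x| * r ^+ n)%:E <= \int[mu]_(y in Q) (`|u x|)%:E)%E.
  by rewrite integral_cst// EFinM lee_wpmul2l.
have step2 : (\int[mu]_(y in Q) (`|u x|)%:E <=
    \int[mu]_(y in Q) (t / 2 + (f1 y + `|u y|))%:E)%E.
  apply: ge0_le_integral_real => //.
    by apply: measurable_funD => //; exact: measurable_cst.
  move=> y [_ Qy]; rewrite addrA.
  have lxy : eucl_dist x y <= l by apply: eucl_dist_le => //; exact: ltW.
  rewrite -lerBlDr; apply: le_trans (norm_diff_le u l0 t0 lxy).
  by rewrite lerBlDr (le_trans _ (ler_normD _ _))// subrK.
have step3 : (\int[mu]_(y in Q) (t / 2 + (f1 y + `|u y|))%:E <=
   (t / 2 * (2 * r) ^+ n + (l `^ p / (2 * t) * d ^+ 2 + m * r `^ (n%:R - n%:R / q)))%:E)%E.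
  rewrite (ge0_integralD_real mu mQ (measurable_cst _) mf2)//; last first.
    by move=> y _; rewrite addr_ge0.
  rewrite (ge0_integralD_real mu mQ mf1 mau)//.
  rewrite EFinD leeD//.
    rewrite /= integral_cst// [leRHS]EFinM lee_wpmul2l ?lee_fin//.
    rewrite -(lebesgue_cube x (ltW r0)); apply: le_measure; rewrite ?inE//.
      exact: measurable_cube.
    by move=> y [].
  rewrite EFinD leeD//.
  rewrite (@ge0_integralZl_real _ _ _ _ Q _ _ mQ a0 (mS _ mD) (fun y => energy_density_ge0 u _)).
  rewrite [leRHS]EFinM lee_wpmul2l ?lee_fin//; apply: le_trans Dd.
  apply: ge0_subset_integral => //.
  - by apply: measurable_funTS; apply/measurable_EFinP.
  - by move=> y _; rewrite lee_fin energy_density_ge0.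
  - by move=> y [].
have := le_trans step1 (le_trans step2 step3); rewrite lee_fin => H.
have origin : 0 < r ^+ n by rewrite exprn_gt0.
rewrite -(ler_pM2r origin); apply: (le_trans H); rewrite le_eqVlt; apply/orP; left; apply/eqP.
have lE : l `^ p = Num.sqrt n%:R `^ p * (r ^+ n * r `^ s * r `^ s).
  by rewrite /l powRM ?sqrtr_ge0 ?(ltW r0)// rE !rD; congr (_ * _ `^ _); ring.
have -> : r `^ (n%:R - n%:R / q) = r ^+ n * r `^ (- (n%:R / q)) by rewrite rE rD.
rewrite lE /CC /t exprMn; set a := r `^ s; set b := r ^+ n.
have an0 : a != 0 by rewrite gt_eqF// powR_gt0.
by field; rewrite an0 gt_eqF.
Qed.

Definition refined_sobolev_const m : R := (CC + 1) `^ q * m `^ (q - 2).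
Local Notation SobC := refined_sobolev_const.

(** Lower density with the same constant at every scale. Half spaces and their complements both have
    it, so the Sobolev inequality is available on both sides of a hyperplane. *)
Definition fat P := forall x r, P x -> 0 < r -> ((r ^+ n)%:E <= mu (P `&` cube x r))%E.

(** The hypothesis bounds a scale-invariant Morrey norm of [u]; the pointwise estimate of
    [hedberg_optimization] is then integrated over [P]. *)
Lemma sobolev_refined P u m : measurable P -> fat P -> measurable_fun setT u -> 0 < m ->
  (forall x r, P x -> (0 < r)%R ->
    \int[mu]_(y in P `&` cube x r) (`|u y|)%:E <= (m * r `^ (n%:R - n%:R / q))%:E)%E ->
  (MM P u <= (SobC m)%:E * \int[mu]_(x in P) DD P u x)%E.
Proof.
move=> mP fP mu_ m0 um.
have C0 : 0 <= SobC m by rewrite mulr_ge0 ?powR_ge0.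
have Cp : 0 < SobC m by rewrite mulr_gt0 ?powR_gt0//; have := CC_ge0; lra.
have mD : measurable_fun P (DD P u).
  by apply: measurable_funTS; exact: measurable_inner_energy.
rewrite -ge0_integralZl//; last by move=> x _; exact: inner_energy_ge0.
apply: ge0_le_integral => //.
- apply: measurable_funTS; apply/measurable_EFinP.
  exact: measurable_powR_norm.
- exact: measurable_funeM.
move=> x Px; have := inner_energy_ge0 P u x; case E : (DD P u x) => [e| |] // e0; last first.
  by rewrite gt0_muley ?lte_fin// leey.
rewrite -EFinM lee_fin; apply/ler_addgt0Pr => eps eps0.
rewrite lee_fin in e0.
(* Slightly more than [e], because the optimization divides by [d] and [e] may be [0]. *)
pose e' := e + eps / SobC m.
have e'0 : 0 < e' by rewrite ltr_wpDl// divr_gt0.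
have -> : SobC m * e + eps = SobC m * e' by rewrite /e'; field; rewrite gt_eqF.
have d2 : Num.sqrt e' ^+ 2 = e' by rewrite sqr_sqrtr// ltW.
rewrite -d2 /SobC -mulrA; apply: hedberg_optimization => //.
- exact: CC_ge0.
- by rewrite sqrtr_gt0.
move=> r r0; apply: sobolev_average (um x r Px r0) => //.
- exact: ltW.
- by rewrite sqrtr_gt0.
- by rewrite E lee_fin d2 /e' lerDl divr_ge0// ltW.
- exact: fP.
Qed.

Definition sobolev_const : R := ((CC + 1) `^ q * (2 ^+ n + 1) `^ (q - 2)) `^ (q / 2).
Local Notation SobK := sobolev_const.

(** The Morrey norm is at most a multiple of [M^(1/q)], so the refined inequality has
    [M^((q - 2) / q)] on its right side. Dividing by it, possible because the mass is finite, leaves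
    [M^(2/q)] below a multiple of the energy. *)
Lemma sobolev P u e : measurable P -> fat P -> measurable_fun setT u ->
  (MM P u < +oo)%E -> (\int[mu]_(x in P) DD P u x <= e%:E)%E ->
  (MM P u <= (SobK * e `^ (q / 2))%:E)%E.
Proof.
have q2 : 2 < q by exact: crit_exp_gt2.
have qn0 : q != 0 by rewrite gt_eqF//; lra.
have q1 : 1 <= q by lra.
have q20 : 0 <= q / 2 by lra.
move=> mP fP mu_ Mfin De.
have := mass_ge0 P u; case EM : (MM P u) Mfin => [M| |] // _; rewrite lee_fin => M0.
have e0 : 0 <= e.
  by rewrite -lee_fin; apply: le_trans De; apply: integral_ge0 => x _; exact: inner_energy_ge0.
move: M0; rewrite le_eqVlt => /predU1P[<-|M0]; first by rewrite lee_fin mulr_ge0 ?powR_ge0.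
pose m := (2 ^+ n + 1) * M `^ q^-1.
have a0 : 0 < 2 ^+ n + 1 :> R by rewrite ltr_wpDl ?exprn_ge0.
have m0 : 0 < m by rewrite mulr_gt0// powR_gt0.
have H : (MM P u <= (SobC m)%:E * \int[mu]_(x in P) DD P u x)%E.
  apply: sobolev_refined => // x r Px r0.
  (* With this threshold both terms of [powR_linear_bound] scale alike over the cube; they account
     for the summands [2^n] and [1] in [m]. *)
  pose t := r `^ (- (n%:R / q)) * M `^ q^-1.
  have t0 : 0 < t by rewrite mulr_gt0 ?powR_gt0.
  have mQ : measurable (P `&` cube x r) by apply: measurableI => //; exact: measurable_cube.
  have mS (f : Rn R n -> R) (Q : set (Rn R n)) : measurable_fun setT f -> measurable_fun Q f.
    by move=> mf; apply: measurable_funTS.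
  have rD a b : r `^ a * r `^ b = r `^ (a + b) by rewrite powRD// (gt_eqF r0) implybT.
  have MD a b : M `^ a * M `^ b = M `^ (a + b) by rewrite powRD// (gt_eqF M0) implybT.
  apply: (@le_trans _ _ (\int[mu]_(y in P `&` cube x r) (t + t `^ (1 - q) * `|u y| `^ q)%:E)%E).
    apply: ge0_le_integral_real => //.
    - by apply: mS; exact: measurableT_comp.
    - by apply: mS; apply: measurable_funD => //; apply: measurable_funM => //; exact: measurable_powR_norm.
    - by move=> y _; exact: powR_linear_bound.
  rewrite ge0_integralD_real//; last 3 first.
  - by apply: mS; apply: measurable_funM => //; exact: measurable_powR_norm.
  - by move=> y _; exact: ltW.
  - by move=> y _; rewrite mulr_ge0 ?powR_ge0.
  rewrite (@ge0_integralZl_real _ _ _ _ _ (fun y => `|u y| `^ q) (t `^ (1 - q)) mQ (powR_ge0 _ _)); last 2 first.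
  - by apply: mS; exact: measurable_powR_norm.
  - by move=> y; rewrite powR_ge0.
  apply: (@le_trans _ _ ((t * (2 * r) ^+ n)%:E + (t `^ (1 - q) * M)%:E)%E).
    apply: leeD.
      rewrite /= integral_cst// [leRHS]EFinM lee_wpmul2l ?lee_fin ?(ltW t0)//.
      rewrite -(lebesgue_cube x (ltW r0)); apply: le_measure; rewrite ?inE//.
      exact: measurable_cube.
    rewrite EFinM lee_wpmul2l ?lee_fin ?powR_ge0// -EM; apply: ge0_subset_integral => //.
    by apply/measurable_EFinP; apply: mS; exact: measurable_powR_norm.
  rewrite -EFinD lee_fin le_eqVlt; apply/orP; left; apply/eqP.
  have tq : t `^ (1 - q) * M = r `^ (n%:R - n%:R / q) * M `^ q^-1.
    rewrite /t powRM ?powR_ge0// -!powRrM -mulrA -[X in _ * (_ * X)](powRr1 (ltW M0)) MD.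
    have e1 : - (n%:R / q) * (1 - q) = n%:R - n%:R / q by field.
    have e2 : q^-1 * (1 - q) + 1 = q^-1 by field.
    by rewrite e1 e2.
  rewrite tq exprMn -(powR_mulrn n (ltW r0)) /t /m.
  have -> : r `^ (n%:R - n%:R / q) = r `^ n%:R * r `^ (- (n%:R / q)) by rewrite rD.
  by ring.
rewrite EM in H; have : (M%:E <= (SobC m)%:E * e%:E)%E.
  by apply: (le_trans H); rewrite lee_wpmul2l// lee_fin mulr_ge0 ?powR_ge0.
rewrite -EFinM !lee_fin => {}H.
have MD a b : M `^ a * M `^ b = M `^ (a + b) by rewrite powRD// (gt_eqF M0) implybT.
pose K := (CC + 1) `^ q * (2 ^+ n + 1) `^ (q - 2).
have kernel_mass : 0 <= K by rewrite mulr_ge0 ?powR_ge0.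
have H2 : M `^ (2 / q) <= K * e.
  have Mp : 0 < M `^ ((q - 2) / q) by rewrite powR_gt0.
  rewrite -(ler_pM2l Mp) MD (_ : (q - 2) / q + 2 / q = 1); last by field.
  rewrite powRr1 ?(ltW M0)//; apply: (le_trans H); rewrite le_eqVlt; apply/orP; left; apply/eqP.
  rewrite /SobC /m powRM ?(ltW a0) ?powR_ge0// -powRrM /K (mulrC q^-1); ring.
have : (M `^ (2 / q)) `^ (q / 2) <= (K * e) `^ (q / 2).
  by apply: ge0_ler_powR; rewrite ?nnegrE ?powR_ge0//; exact: mulr_ge0.
rewrite -powRrM (_ : 2 / q * (q / 2) = 1); last by field.
by rewrite powRr1 ?(ltW M0)// powRM.
Qed.

End Functionals.

(** * Invariance of mass and energy under dilations *)

Section AffineInvariance.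
Context (R : realType) (n : nat) (s : R).
Hypotheses (hs0 : 0 < s) (hs1 : s < 1) (n0 : (0 < n)%N) (hns : 2 * s < n%:R).
Local Notation p := (n%:R + 2 * s).
Local Notation q := (@crit_exp R n s).
Local Notation mu := (lebesgue_Rn R n).
Local Notation mu2 := (lebesgue_RnRn R n).
Local Notation EE := (@energyT R n s).
Local Notation MM := (@mass R n s).
Local Notation edens := (@energy_density R n s).
Implicit Types (O : set (Rn R n)) (u v : Rn R n -> R) (h : 'I_n -> R).

Lemma integral_set_affine O r h (f : Rn R n -> R) : 0 < r -> measurable O ->
  measurable_fun setT f -> (forall x, 0 <= f x) ->
  (\int[mu]_(x in O) (f x)%:E =
   \int[mu]_(x in affine r h @^-1` O) (r ^+ n * f (affine r h x))%:E)%E.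
Proof.
move=> r0 mO mf f0.
have mr (A : set (Rn R n)) (g : Rn R n -> R) : measurable A -> measurable_fun setT g ->
    measurable_fun setT ((EFin \o g) \_ A).
  move=> mA mg; apply/(measurable_restrictT _ _).1 => //.
  by apply: measurable_funTS; exact/measurable_EFinP.
have ma := @measurable_affine R n r h.
have mO' : measurable (affine r h @^-1` O) by rewrite -[X in measurable X]setTI; exact: ma.
rewrite integral_mkcond (integral_affine h (lt0r_neq0 r0) (mr O f mO mf)); last first.
  by move=> x; rewrite patchE; case: ifP => // _; rewrite lee_fin.
rewrite gtr0_norm// -ge0_integralZl//; last 3 first.
- exact: (measurableT_comp (mr O f mO mf) ma).
- by move=> x _; rewrite patchE; case: ifP => // _; rewrite lee_fin.
- by rewrite lee_fin exprn_ge0// ltW.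
rewrite [RHS]integral_mkcond; apply: eq_integral => x _; rewrite !patchE.
have -> : (affine r h x \in O) = (x \in affine r h @^-1` O) by apply/idP/idP; rewrite !inE.
by case: ifP => _; rewrite ?mule0.
Qed.

(** The power [r^(n / q)] compensates the Jacobian in the mass; it does so in the energy as well
    because [2n / q = 2n - (n + 2s)], which is the equation for the critical exponent. *)
Definition dilate r h u (x : Rn R n) : R := r `^ (n%:R / q) * u (affine r h x).

Lemma measurable_dilate r h u : measurable_fun setT u -> measurable_fun setT (dilate r h u).
Proof.
move=> mu_; apply: measurable_funM => //; apply: measurableT_comp => //.
exact: measurable_affine.
Qed.

Let q0 : 0 < q. Proof. have := crit_exp_gt2 hs0 hns; lra. Qed.
Let qn0 : q != 0. Proof. by rewrite gt_eqF. Qed.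

Lemma mass_dilate O r h u : 0 < r -> measurable O -> measurable_fun setT u ->
  MM (affine r h @^-1` O) (dilate r h u) = MM O u.
Proof.
move=> r0 mO mu_; rewrite /mass (integral_set_affine h r0 mO (measurable_powR_norm s mu_)); last first.
  by move=> x; exact: powR_ge0.
apply: eq_integral => x _; congr EFin.
rewrite /dilate normrM powRM// ger0_norm ?powR_ge0// -powRrM divfK// powR_mulrn//.
exact: ltW.
Qed.

Lemma energyT_dilate O r h u : 0 < r -> measurable O -> measurable_fun setT u ->
  EE (affine r h @^-1` O) (dilate r h u) = EE O u.
Proof.
move=> r0 mO mu_; rewrite !energyTE [RHS]integral_mkcond.
have mr : measurable_fun setT ((EFin \o edens u) \_ (T_set O)).
  apply/(measurable_restrictT _ _).1; first exact: measurable_T_set.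
  apply: measurable_funTS; apply/measurable_EFinP.
  exact: measurable_energy_density.
rewrite (integral_affine2 h (lt0r_neq0 r0) mr); last first.
  by move=> x; rewrite patchE; case: ifP => // _; rewrite lee_fin energy_density_ge0.
have ma := @measurable_affine R n r h.
rewrite gtr0_norm// -ge0_integralZl; last 4 first.
- exact: measurableT.
- apply: (measurableT_comp mr); apply: measurable_fun_pair.
    exact: (measurableT_comp ma measurable_fst).
  exact: (measurableT_comp ma measurable_snd).
- by move=> x _; rewrite patchE; case: ifP => // _; rewrite lee_fin energy_density_ge0.
- by rewrite lee_fin mulr_ge0 ?exprn_ge0// ltW.
rewrite [LHS]integral_mkcond; apply: eq_integral => -[x y] _; rewrite !patchE.
have -> : ((x, y) \in T_set (affine r h @^-1` O)) = ((affine r h x, affine r h y) \in T_set O).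
  by apply/idP/idP; rewrite !inE.
case: ifP => _; rewrite ?mule0// /comp -EFinM; congr EFin.
have N : n%:R - 2 * s != 0 by rewrite subr_eq0 gt_eqF.
have Nn : n%:R != 0 :> R by rewrite pnatr_eq0 -lt0n.
have key : (r `^ (n%:R / q)) ^+ 2 = r ^+ n * r ^+ n * (r `^ p)^-1.
  rewrite -powRN -!(powR_mulrn n (ltW r0)) -(powR_mulrn 2 (powR_ge0 _ _)) -powRrM.
  have rD a b : r `^ a * r `^ b = r `^ (a + b) by rewrite powRD// (gt_eqF r0) implybT.
  by rewrite !rD; congr (_ `^ _); rewrite /crit_exp; field; rewrite N Nn.
rewrite /edens /dilate /riesz /= eucl_dist_affine -mulrBr exprMn gtr0_norm// key.
by rewrite powRM ?(ltW r0) ?eucl_dist_ge0// invfM; ring.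
Qed.

Lemma cube_affine r h x0 y : 0 < r ->
  cube x0 r (affine r h y) <-> cube (affine r^-1 (fun i => - h i / r) x0) 1 y.
Proof.
move=> r0; split => H i; have := H i; rewrite !tnth_mktuple.
  have -> : r * tnth y i + h i - tnth x0 i = r * (tnth y i - (r^-1 * tnth x0 i + - h i / r)).
    by field; rewrite gt_eqF.
  by rewrite normrM gtr0_norm// -ler_pdivlMl// mulVf// gt_eqF.
have -> : r * tnth y i + h i - tnth x0 i = r * (tnth y i - (r^-1 * tnth x0 i + - h i / r)).
  by field; rewrite gt_eqF.
by rewrite normrM gtr0_norm// -ler_pdivlMl// mulVf// gt_eqF.
Qed.

(** [r^(n - n / q)] is the normalization in [sobolev_refined], so a Morrey condition on a cube of
    radius [r] becomes the same condition on a cube of radius [1]. *)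
Lemma integral_cube_dilate O r h u x0 : 0 < r -> measurable O -> measurable_fun setT u ->
  (\int[mu]_(x in O `&` cube x0 r) (`|u x|)%:E =
   (r `^ (n%:R - n%:R / q))%:E *
   \int[mu]_(x in (affine r h @^-1` O) `&` cube (affine r^-1 (fun i => - h i / r)%R x0) 1)
      (`|dilate r h u x|)%:E)%E.
Proof.
move=> r0 mO mu_.
have mau : measurable_fun setT (fun x => `|u x|) by exact: measurableT_comp.
have ma := @measurable_affine R n r h.
have mOQ : measurable (O `&` cube x0 r) by apply: measurableI => //; exact: measurable_cube.
rewrite (integral_set_affine h r0 mOQ mau)//.
have -> : affine r h @^-1` (O `&` cube x0 r) =
    (affine r h @^-1` O) `&` cube (affine r^-1 (fun i => - h i / r) x0) 1.
  by apply/seteqP; split => y [Oy /(cube_affine _ _ _ r0) Qy].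
rewrite -ge0_integralZl_real ?powR_ge0//; last 2 first.
- apply: measurableI; last exact: measurable_cube.
  by rewrite -[X in measurable X]setTI; exact: ma.
- apply: measurable_funTS; apply: measurableT_comp => //.
  exact: measurable_dilate.
apply: eq_integral => x _; congr EFin.
rewrite /dilate normrM ger0_norm ?powR_ge0// mulrA -powRD ?(gt_eqF r0) ?implybT//.
by rewrite subrK powR_mulrn// ltW.
Qed.

Let lasti := Ordinal (etrans (congr1 (fun k => (n.-1 < k)%N) (esym (prednK n0))) (ltnSn n.-1)).

Lemma half_affine r h t : 0 < r ->
  affine r h @^-1` (hspace t) = hspace ((t + h lasti) / r).
Proof.
move=> r0.
have E (y : Rn R n) : nth 0 y n.-1 = tnth y lasti by rewrite (tnth_nth 0).
apply/seteqP; split => x; rewrite /preimage /hspace /mkset !E tnth_mktuple => H.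
  by rewrite -mulNr ler_pdivrMr// mulrC; lra.
by move: H; rewrite -mulNr ler_pdivrMr// mulrC => H; lra.
Qed.

Lemma fat_half t : @fat R n (hspace t).
Proof. by move=> x r tx r0; apply: lebesgue_half_cube => //; exact: ltW. Qed.

Lemma fat_lower_half t : @fat R n (~` hspace t).
Proof. by move=> x r tx r0; apply: lebesgue_lower_half_cube => //; exact: ltW. Qed.

Definition Hs_on O u := [/\ measurable_fun setT u, (MM O u < +oo)%E & (EE O u < +oo)%E].
Local Notation Hs := Hs_on.

Lemma mass_scale O u c : measurable O -> measurable_fun setT u ->
  MM O (fun x => c * u x) = ((`|c| `^ q)%:E * MM O u)%E.
Proof.
move=> mO mu_; rewrite /mass -ge0_integralZl_real ?powR_ge0//; last first.
  by apply: measurable_funTS; exact: measurable_powR_norm.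
by apply: eq_integral => x _; congr EFin; rewrite normrM powRM.
Qed.

Lemma energyT_scale O u c : measurable O -> measurable_fun setT u ->
  EE O (fun x => c * u x) = ((c ^+ 2)%:E * EE O u)%E.
Proof.
move=> mO mu_; rewrite !energyTE -ge0_integralZl_real ?sqr_ge0//; last 3 first.
- exact: measurable_T_set.
- by apply: measurable_funTS; exact: measurable_energy_density.
- exact: energy_density_ge0.
by apply: eq_integral => x _; congr EFin; rewrite /edens -mulrBr exprMn mulrA.
Qed.

Lemma mass_add_lty O u v : measurable O -> measurable_fun setT u -> measurable_fun setT v ->
  (MM O u < +oo)%E -> (MM O v < +oo)%E -> (MM O (fun x => u x + v x)%R < +oo)%E.
Proof.
move=> mO mu_ mv Mu Mv; have [C C0 HC] := powR_split q0 (@ltr01 R).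
have mS (f : Rn R n -> R) : measurable_fun setT f -> measurable_fun O f.
  by move=> mf; apply: measurable_funTS.
apply: (@le_lt_trans _ _ (\int[mu]_(x in O) ((1 + 1) * `|u x| `^ q + C * `|v x| `^ q)%:E)%E).
  apply: ge0_le_integral_real => //.
  - by apply: mS; apply: measurable_powR_norm; exact: measurable_funD.
  - by apply: mS; apply: measurable_funD; apply: measurable_funM => //; exact: measurable_powR_norm.
have mf : measurable_fun O (fun x => (1 + 1) * `|u x| `^ q).
  by apply: (mS (fun x => (1 + 1) * `|u x| `^ q)); apply: measurable_funM => //; exact: measurable_powR_norm.
have mg : measurable_fun O (fun x => C * `|v x| `^ q).
  by apply: (mS (fun x => C * `|v x| `^ q)); apply: measurable_funM => //; exact: measurable_powR_norm.
rewrite (ge0_integralD_real mu mO mf mg); last 2 first.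
- by move=> x _; rewrite mulr_ge0 ?powR_ge0.
- by move=> x _; rewrite mulr_ge0 ?powR_ge0.
have mun := mS _ (measurable_powR_norm s mu_); have mvn := mS _ (measurable_powR_norm s mv).
rewrite !ge0_integralZl_real//; try (by move=> x; rewrite powR_ge0).
by apply: lte_add_pinfty; apply: lte_mul_pinfty; rewrite ?lee_fin.
Qed.

Lemma energyT_add_lty O u v : measurable O -> measurable_fun setT u -> measurable_fun setT v ->
  (EE O u < +oo)%E -> (EE O v < +oo)%E -> (EE O (fun x => u x + v x)%R < +oo)%E.
Proof.
move=> mO mu_ mv Eu Ev.
have mT := measurable_T_set mO.
have mS (f : Rn R n * Rn R n -> R) : measurable_fun setT f -> measurable_fun (T_set O) f.
  by move=> mf; apply: measurable_funTS.
have mun : measurable_fun (T_set O) (edens u) by apply: measurable_funTS; exact: measurable_energy_density.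
have mvn : measurable_fun (T_set O) (edens v) by apply: measurable_funTS; exact: measurable_energy_density.
apply: (@le_lt_trans _ _ (\int[mu2]_(x in T_set O) (2 * edens u x + 2 * edens v x)%:E)%E).
  rewrite energyTE; apply: ge0_le_integral_real => //.
  - apply: measurable_funTS; apply: measurable_energy_density; exact: measurable_funD.
  - by apply: measurable_funD; exact: measurable_funM.
  - by move=> z _; exact: energy_density_ge0.
  move=> z _; rewrite /edens !mulrA -mulrDl ler_wpM2r ?riesz_ge0//.
  by have := sqr_ge0 ((u z.1 - u z.2) - (v z.1 - v z.2)); nra.
rewrite ge0_integralD_real//; try exact: measurable_funM; try (by move=> z _; rewrite mulr_ge0 ?energy_density_ge0).
rewrite !ge0_integralZl_real//; try exact: energy_density_ge0.
by apply: lte_add_pinfty; apply: lte_mul_pinfty; rewrite ?lee_fin.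
Qed.

Lemma Hs_on_add O u v : measurable O -> Hs O u -> Hs O v -> Hs O (fun x => u x + v x).
Proof.
move=> mO [mu_ Mu Eu] [mv Mv Ev]; split; first exact: measurable_funD.
  exact: mass_add_lty.
exact: energyT_add_lty.
Qed.

Lemma Hs_on_scale O u c : measurable O -> Hs O u -> Hs O (fun x => c * u x).
Proof.
move=> mO [mu_ Mu Eu]; split; first exact: measurable_funM.
  by rewrite mass_scale// lte_mul_pinfty// lee_fin powR_ge0.
by rewrite energyT_scale// lte_mul_pinfty// lee_fin sqr_ge0.
Qed.

Lemma mass_abs O u : MM O (fun x => `|u x|) = MM O u.
Proof. by apply: eq_integral => x _; rewrite normr_id. Qed.

Lemma energyT_abs_le O u : measurable O -> measurable_fun setT u ->
  (EE O (fun x => `|u x|%R) <= EE O u)%E.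
Proof.
move=> mO mu_; rewrite !energyTE; apply: ge0_le_integral_real => //.
- exact: measurable_T_set.
- by apply: measurable_funTS; apply: measurable_energy_density; exact: measurableT_comp.
- by apply: measurable_funTS; exact: measurable_energy_density.
- by move=> z _; exact: energy_density_ge0.
move=> z _; rewrite /edens ler_wpM2r ?riesz_ge0//.
by rewrite -[leLHS]real_normK ?num_real// -[leRHS]real_normK ?num_real// ler_sqr ?nnegrE// ler_dist_dist.
Qed.

Lemma Hs_on_abs O u : measurable O -> Hs O u -> Hs O (fun x => `|u x|).
Proof.
move=> mO [mu_ Mu Eu]; split; first exact: measurableT_comp.
  by rewrite mass_abs.
by apply: le_lt_trans Eu; exact: energyT_abs_le.
Qed.

End AffineInvariance.

(** * The best constant of the half space *)

Section BestConstant.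
Context (R : realType) (n : nat) (s : R).
Hypotheses (hs0 : 0 < s) (hs1 : s < 1) (n0 : (0 < n)%N) (hns : 2 * s < n%:R).
Local Notation q := (@crit_exp R n s).
Local Notation mu := (lebesgue_Rn R n).
Local Notation EE := (@energyT R n s).
Local Notation MM := (@mass R n s).
Local Notation Hs := (@Hs_on R n s).
Local Notation SobK := (@sobolev_const R n s).
Implicit Types (O : set (Rn R n)) (u v : Rn R n -> R) (t : R).

Let q2 : 2 < q. Proof. exact: crit_exp_gt2. Qed.
Let q0 : 0 < q. Proof. by move: q2; lra. Qed.
Let q20 : 0 <= q / 2. Proof. by move: q2; lra. Qed.

(** [fine] reads an infinite mass as [0]; inequalities for [massR] and [energyR] are therefore
    stated for functions in [Hs_on]. *)
Definition massR O u : R := fine (MM O u).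
Local Notation mR := massR.
Definition energyR O u : R := fine (EE O u).
Local Notation eR := energyR.

Lemma massRE O u : (MM O u < +oo)%E -> MM O u = (mR O u)%:E.
Proof. by move=> Mu; rewrite /mR fineK// ge0_fin_numE// mass_ge0. Qed.

Lemma energyRE O u : (EE O u < +oo)%E -> EE O u = (eR O u)%:E.
Proof. by move=> Eu; rewrite /eR fineK// ge0_fin_numE// energyT_ge0. Qed.

Lemma massR_ge0 O u : 0 <= mR O u.
Proof. by apply: fine_ge0; exact: mass_ge0. Qed.

Lemma energyR_ge0 O u : 0 <= eR O u.
Proof. by apply: fine_ge0; exact: energyT_ge0. Qed.

Lemma sobolev_Hs_on O u : measurable O -> fat O -> Hs O u -> mR O u <= SobK * eR O u `^ (q / 2).
Proof.
move=> mO fO [mu_ Mu Eu]; rewrite -lee_fin -massRE//; apply: sobolev => //.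
by rewrite -energyRE//; exact: integral_inner_energy_le_energyT.
Qed.

(** The constraint is [<= 1] rather than [= 1], a condition that passes to limits by Fatou's lemma;
    homogeneity makes the supremum the same. *)
Definition bubbles := [set mR (hspace 0) u | u in
  [set u | Hs (hspace 0) u /\ eR (hspace 0) u <= 1]].
Definition best_constant : R := sup bubbles.
Local Notation lam := best_constant.

Let mH t : measurable (@hspace R n t). Proof. exact: measurable_half. Qed.

Lemma has_sup_bubbles : has_sup bubbles.
Proof.
split.
  exists (mR (hspace 0) (fun x => 0 * (@tent R n x))).
  exists (fun x => 0 * (@tent R n x)) => //.
  have mb := @measurable_tent R n.
  have E0 : EE (hspace 0) (fun x => 0 * (@tent R n x)) = 0%E.
    rewrite energyTE; apply: integral0_eq => z _.
    by rewrite /energy_density !mul0r subrr expr0n/= mul0r.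
  have M0 : MM (hspace 0) (fun x => 0 * (@tent R n x)) = 0%E.
    by apply: integral0_eq => z _; rewrite mul0r normr0 powR0// gt_eqF.
  by split; [split; [exact: measurable_funM|rewrite M0|rewrite E0]|rewrite /eR E0].
exists SobK => _ [u [Hu eu] <-].
apply: (le_trans (sobolev_Hs_on (mH 0) (@fat_half R n 0) Hu)).
have Kge0 : 0 <= SobK by exact: powR_ge0.
rewrite -[leRHS]mulr1 ler_wpM2l//.
apply: (@le_trans _ _ (1 `^ (q / 2))); last by rewrite powR1.
by apply: ge0_ler_powR; rewrite ?nnegrE ?energyR_ge0.
Qed.

Lemma best_constant_ge0 : 0 <= lam.
Proof.
have [[m hm] _] := has_sup_bubbles; have := ub_le_sup has_sup_bubbles.2 hm.
by apply: le_trans; case: hm => u _ <-; exact: massR_ge0.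
Qed.

Lemma Hs_on_unit_le u : Hs (hspace 0) u -> eR (hspace 0) u <= 1 -> mR (hspace 0) u <= lam.
Proof.
by move=> Hu eu; apply: (ub_le_sup has_sup_bubbles.2); exists u.
Qed.

Lemma best_constant_sup_adherent e : 0 < e -> exists u, [/\ Hs (hspace 0) u, eR (hspace 0) u <= 1 &
  lam - e < mR (hspace 0) u].
Proof.
move=> e0; have [_ [u [Hu eu] <-] H] := sup_adherent e0 has_sup_bubbles.
by exists u.
Qed.

Lemma massR_scale O u c : measurable O -> Hs O u -> mR O (fun x => c * u x) = `|c| `^ q * mR O u.
Proof.
move=> mO Hu; have [mu_ Mu Eu] := Hu; have [_ Mcu _] := Hs_on_scale c mO Hu.
by apply: EFin_inj; rewrite -massRE// mass_scale// massRE.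
Qed.

Lemma energyR_scale O u c : measurable O -> Hs O u -> eR O (fun x => c * u x) = c ^+ 2 * eR O u.
Proof.
move=> mO Hu; have [mu_ Mu Eu] := Hu; have [_ _ Ecu] := Hs_on_scale c mO Hu.
by apply: EFin_inj; rewrite -energyRE// energyT_scale// energyRE.
Qed.

(** Mass and energy are homogeneous of degrees [q] and [2], so the factor [e^(-1/2)] normalizes the
    energy. Zero energy cannot be normalized and is left to the Sobolev inequality. *)
Let best_constant_ineq0 u : Hs (hspace 0) u -> mR (hspace 0) u <= lam * eR (hspace 0) u `^ (q / 2).
Proof.
move=> Hu; have := energyR_ge0 (hspace 0) u; rewrite le_eqVlt => /predU1P[e0|e0].
  apply: (le_trans (sobolev_Hs_on (mH 0) (@fat_half R n 0) Hu)).
  by rewrite -e0 powR0 ?mulr0// gt_eqF//; move: q0; lra.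
set e := eR _ _ in e0 *.
pose c := e `^ (- 2^-1).
have c0 : 0 <= c by exact: powR_ge0.
have ce : c ^+ 2 * e = 1.
  rewrite -powR_mulrn// -powRrM (_ : - 2^-1 * 2 = -1); last by field.
  by rewrite powR_inv1 ?(ltW e0)// mulVf// gt_eqF.
have := @Hs_on_unit_le (fun x => c * u x) (Hs_on_scale c (mH 0) Hu).
rewrite (energyR_scale _ (mH 0) Hu) (massR_scale _ (mH 0) Hu) -/e ce => /(_ (lexx _)).
rewrite ger0_norm// -powRrM (_ : - 2^-1 * q = - (q / 2)); last by field.
by rewrite powRN -ler_pdivlMl ?invr_gt0 ?powR_gt0// invrK mulrC.
Qed.

(** A translation across the boundary carries [hspace t] to [hspace 0], so one constant serves all
    levels. *)
Lemma best_constant_ineq t u : Hs (hspace t) u -> mR (hspace t) u <= lam * eR (hspace t) u `^ (q / 2).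
Proof.
move=> [mu_ Mu Eu].
pose h (i : 'I_n) : R := - t.
have r1 : 0 < 1 :> R by [].
have E := half_affine n0 h t r1.
rewrite /h subrr mul0r in E.
have Mt := mass_dilate hs0 hns h r1 (mH t) mu_; have Et := energyT_dilate n0 hns h r1 (mH t) mu_.
rewrite E in Mt Et.
have H : Hs (hspace 0) (dilate s 1 h u).
  by split; [exact: measurable_dilate|rewrite Mt|rewrite Et].
by have := best_constant_ineq0 H; rewrite /mR /eR Mt Et.
Qed.

Lemma Hs_on_tent t : Hs (hspace t) (@tent R n).
Proof.
have mC : measurable (@cube R n (origin R n) 1) by exact: measurable_cube.
split; first exact: measurable_tent.
  apply: (@le_lt_trans _ _ (\int[mu]_x (\1_(cube (origin R n) 1) x)%:E)%E).
    rewrite /mass [leLHS]integral_mkcond; apply: ge0_le_integral => //.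
    - by move=> x _; rewrite patchE; case: ifP => // _; rewrite lee_fin powR_ge0.
    - apply/(measurable_restrictT _ _).1 => //.
      apply: measurable_funTS; apply/measurable_EFinP.
      by apply: measurable_powR_norm; exact: measurable_tent.
    - by apply/measurable_EFinP; exact: measurable_indic.
    move=> x _; rewrite patchE; case: ifP => [_|_]; last by rewrite lee_fin indicE.
    rewrite lee_fin indicE; have [xC|xC] := pselect (cube (origin R n) 1 x).
      rewrite mem_set// (_ : 1%:R = 1 `^ q); last by rewrite powR1.
      apply: ge0_ler_powR; rewrite ?nnegrE ?(ltW q0)//.
      by rewrite ger0_norm ?tent_ge0// tent_le1.
    by rewrite tent_support// normr0 powR0 ?gt_eqF.
  rewrite integral_indic// setIT.
  have -> : (lebesgue_Rn R n (cube (origin R n) 1) < +oo)%E by rewrite lebesgue_cube// ltry.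
  by [].
exact: (energy_tent_lty hs0 hs1 n0 (measurable_T_set (mH t))).
Qed.

Lemma massR_tent_gt0 : 0 < mR (hspace 0) (@tent R n).
Proof.
have [_ Mb _] := Hs_on_tent 0.
rewrite -lte_fin -massRE//.
(* On the box of this side the coordinates sum to at most [1 / 2], so [tent] is at least [1 / 2]
   there. *)
pose d : R := (2 * n%:R)^-1.
have d0 : 0 < d by rewrite invr_gt0 mulr_gt0// ltr0n.
pose A (i : 'I_n) : set (measurableTypeR R) := `[0, d]%classic.
pose B : set (Rn R n) := [set z | forall i, A i (tnth z i)].
have mB : measurable B by apply: measurable_box => i; exact: measurable_itv.
have BH : B `<=` hspace 0.
  move=> x Bx; rewrite /hspace/= oppr0.
  have ln : (n.-1 < n)%N by rewrite prednK.
  by have := Bx (Ordinal ln); rewrite /A/= in_itv/= (tnth_nth 0) => /andP[].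
apply: (@lt_le_trans _ _ (\int[mu]_(z in B) (2^-1 `^ q)%:E)%E).
  rewrite integral_cst//.
  have lB : lebesgue_Rn R n B = (d ^+ n)%:E.
    rewrite /B lebesgue_Rn_prod; last by move=> i; exact: measurable_itv.
    by rewrite -prode_cst; apply: eq_bigr => i _; rewrite lebesgue_itvcc ?subr0// ltW.
  by rewrite [X in (_ * X)%E]lB -EFinM lte_fin; apply: mulr_gt0; [apply: powR_gt0; rewrite invr_gt0|exact: exprn_gt0].
have mb : measurable_fun setT (fun x => `|@tent R n x| `^ q).
  by apply: measurable_powR_norm; exact: measurable_tent.
apply: (@le_trans _ _ (\int[mu]_(z in B) (`|@tent R n z| `^ q)%:E)%E).
  apply: ge0_le_integral_real => //.
  - exact: measurable_funTS.
  move=> x Bx; apply: ge0_ler_powR; rewrite ?nnegrE ?(ltW q0) ?invr_ge0//.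
  rewrite ger0_norm ?tent_ge0// /tent le_max; apply/orP; right.
  have : \sum_(i < n) `|tnth x i| <= \sum_(i < n) d.
    apply: ler_sum => i _; have := Bx i; rewrite /A/= in_itv/= => /andP[x1 x2].
    by rewrite ger0_norm.
  have dn : d *+ n = 2^-1.
    by rewrite /d -mulr_natr; field; rewrite pnatr_eq0 -lt0n.
  rewrite sumr_const card_ord dn.
  by lra.
apply: ge0_subset_integral => //.
by apply: measurable_funTS; exact/measurable_EFinP.
Qed.

Lemma best_constant_gt0 : 0 < lam.
Proof.
have := best_constant_ineq (Hs_on_tent 0); have := massR_tent_gt0 => m0 ml.
rewrite lt_neqAle best_constant_ge0 andbT; apply/eqP => l0.
by move: (lt_le_trans m0 ml); rewrite -l0 mul0r ltxx.
Qed.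

End BestConstant.

(** * Almost everywhere convergence along a subsequence *)

Section Telescope.
Context (R : realType).

Lemma cvgn_summable_steps (v w : nat -> R) (j0 : nat) (M : R) :
  (forall j, (j0 <= j)%N -> `|v j.+1 - v j| <= w j) -> (forall j, 0 <= w j) ->
  (forall N, \sum_(0 <= j < N) w j <= M) -> cvgn v.
Proof.
move=> vw w0 wM.
pose v' j := v (j + j0)%N.
have H : cvgn (series (telescope v')).
  apply: normed_cvg; apply: (@nondecreasing_is_cvgn).
    apply/nondecreasing_seqP => N.
    change (series (fun k => `|telescope v' k|) N <= series (fun k => `|telescope v' k|) N.+1).
    by rewrite seriesSr lerDl.
  exists M => _ [N _ <-]; apply: le_trans (wM (N + j0)%N).
  rewrite /series/= [leRHS](@big_cat_nat _ _ _ j0)//=; last exact: leq_addl.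
  rewrite ler_wpDl//; first by apply: sumr_ge0.
  rewrite -{1}[j0]add0n big_addn addnK; apply: ler_sum => j _.
  exact: (vw (j + j0)%N (leq_addl _ _)).
have [l vl] : exists l : R, v' @ \oo --> l.
  have -> : v' = (fun N => series (telescope v') N + v' 0%N).
    by rewrite telescopeK; apply/funext => N; rewrite subrK.
  by exists (limn (series (telescope v')) + v' 0%N); apply: cvgD => //; exact: cvg_cst.
by apply/cvg_ex; exists l; rewrite -(cvg_shiftn j0).
Qed.

(** The image filter clusters in a compact interval, and a cluster point of an ultrafilter is a
    limit. *)
Lemma ultra_limit (F : set_system nat) (a : nat -> R) (C : R) : UltraFilter F ->
  (forall k, `|a k| <= C) -> exists l : R, a @ F --> l.
Proof.
move=> UF aC.
have aF : ProperFilter (a @ F) by apply: fmap_proper_filter.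
have [] := @segment_compact R (- C) C (a @ F) aF.
  suff : F (a @^-1` `[- C, C]%classic) by [].
  by apply: filterE => k /=; rewrite in_itv/= -ler_norml; exact: aC.
move=> l [_ cl]; exists l => V lV.
have [//|FnV] := in_ultra_setVsetC (a @^-1` V) UF.
by have [x []] := cl (~` V) V FnV lV.
Qed.

End Telescope.

Section Cells.
Context (R : realType) (n : nat).
Implicit Types (l : nat) (z : 'I_n -> int) (x y : Rn R n).

Definition cell l z : set (Rn R n) :=
  [set y | forall i, (z i)%:~R <= 2 ^+ l * tnth y i < (z i + 1)%:~R].

Let cellE l z : cell l z = [set y | forall i,
  `[(z i)%:~R / 2 ^+ l, (z i + 1)%:~R / 2 ^+ l[%classic (tnth y i)].
Proof.
have l0 : 0 < 2 ^+ l :> R by rewrite exprn_gt0.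
apply/seteqP; split => y H i; have := H i; rewrite /=.
  by rewrite in_itv/= ler_pdivrMr// ltr_pdivlMr// mulrC.
by rewrite in_itv/= ler_pdivrMr// ltr_pdivlMr// mulrC.
Qed.

Lemma measurable_cell l z : measurable (cell l z).
Proof. by rewrite cellE; apply: (@measurable_box _ _ (fun i => _)) => i; exact: measurable_itv. Qed.

Lemma lebesgue_cell l z : lebesgue_Rn R n (cell l z) = ((2 ^- l) ^+ n)%:E.
Proof.
have l0 : 0 < 2 ^+ l :> R by rewrite exprn_gt0.
rewrite cellE (@lebesgue_Rn_prod _ _ (fun i => `[(z i)%:~R / 2 ^+ l, (z i + 1)%:~R / 2 ^+ l[%classic)); last first.
  by move=> i; exact: measurable_itv.
rewrite -prode_cst; apply: eq_bigr => i _.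
rewrite lebesgue_measure_itv/= lte_fin ltr_pM2r ?invr_gt0// ltr_int ltrDl ltr01.
by rewrite -EFinB -mulrBl intrD addrC addKr mul1r.
Qed.

Lemma cell_cube l z x y : cell l z x -> cell l z y -> cube x (2 ^- l) y.
Proof.
have l0 : 0 < 2 ^+ l :> R by rewrite exprn_gt0.
move=> xz yz i; rewrite -(ler_pM2l l0) mulfV ?gt_eqF//.
rewrite -[X in X * _](gtr0_norm l0) -normrM mulrBr ler_norml.
have := xz i; have := yz i; rewrite intrD => /andP[a b] /andP[c d].
by apply/andP; split; lra.
Qed.

Lemma cell_exists l x : exists z, cell l z x.
Proof.
exists (fun i => Num.floor (2 ^+ l * tnth x i)) => i.
by rewrite ge_floor/= intrD; have := lt_succ_floor (2 ^+ l * tnth x i); rewrite intrD.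
Qed.

(** A finite type covering all integer vectors with entries between [- N] and [N]: the cells met at
    one stage then impose only finitely many conditions on a filter. *)
Definition index_vec (N : nat) (w : {ffun 'I_n -> 'I_(2 * N).+1}) (i : 'I_n) : int :=
  (w i)%:Z - N%:Z.

Lemma idx_surj (N : nat) z : (forall i, `|z i| <= N%:Z) -> exists w, index_vec (N := N) w = z.
Proof.
move=> zN; exists [ffun i => inord (absz (z i + N%:Z)%R)]; apply/funext => i.
have := zN i; rewrite ler_norml => /andP[a b].
have zi0 : 0 <= z i + N%:Z by rewrite -(opprK N%:Z) subr_ge0.
rewrite /index_vec ffunE inordK; first by rewrite gez0_abs// addrK.
rewrite ltnS -lez_nat gez0_abs// mul2n -addnn PoszD lerD2r//.
Qed.

Lemma cell_bounded l z x : cell l z x -> (forall i, `|tnth x i| <= 2 ^+ l) ->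
  forall i, `|z i| <= (4 ^ l)%:Z.
Proof.
move=> xz xl i; have := xz i; rewrite intrD => /andP[a b].
have l0 : 0 < 2 ^+ l :> R by rewrite exprn_gt0.
have {}xl : `|2 ^+ l * tnth x i| <= (4 ^ l)%:R.
  rewrite normrM gtr0_norm// natrX (_ : 4%:R = 2 * 2); last by ring.
  by rewrite exprMn ler_pM2l.
move: xl; rewrite ler_norml => /andP[c d].
rewrite ler_norml -(ler_int R) -(ler_int R) intrN; apply/andP; split; last first.
  by rewrite -pmulrn; lra.
have : (- (4 ^ l)%:Z)%:~R < (z i + 1)%:~R :> R by rewrite intrN -pmulrn intrD; lra.
by rewrite ltr_int ltzD1 -(ler_int R) intrN -pmulrn.
Qed.

End Cells.

Section LocalCompactness.
Context (R : realType) (n : nat) (s : R).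
Hypotheses (hs0 : 0 < s) (hs1 : s < 1) (n0 : (0 < n)%N) (hns : 2 * s < n%:R).
Local Notation p := (n%:R + 2 * s).
Local Notation q := (@crit_exp R n s).
Local Notation mu := (lebesgue_Rn R n).
Local Notation MM := (@mass R n s).
Local Notation DD := (@inner_energy R n s).
Local Notation edens := (@energy_density R n s).
Implicit Types (A : set (Rn R n)) (x y : Rn R n).

Let q2 : 2 < q. Proof. exact: crit_exp_gt2. Qed.
Let q1 : 1 <= q. Proof. by move: q2; lra. Qed.

Lemma integrable_loc A O (u : Rn R n -> R) (B m : R) : measurable A -> measurable O ->
  A `<=` O -> measurable_fun setT u -> mu A = m%:E -> (MM O u <= B%:E)%E ->
  mu.-integrable A (EFin \o u) /\ \int[mu]_(x in A) `|u x| <= m + B.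
Proof.
move=> mA mO AO mu_ Am MB.
have mS (f : Rn R n -> R) : measurable_fun setT f -> measurable_fun A f.
  by move=> mf; apply: measurable_funTS.
have H : (\int[mu]_(x in A) (`|u x|)%:E <= (m + B)%:E)%E.
  apply: (@le_trans _ _ (\int[mu]_(x in A) (1 + `|u x| `^ q)%:E)%E).
    apply: ge0_le_integral_real => //.
    - by apply: mS; exact: measurableT_comp.
    - by apply: mS; apply: measurable_funD => //; exact: measurable_powR_norm.
    move=> x _; have := @powR_linear_bound R `|u x| 1 q (normr_ge0 _) ltr01 q1.
    by rewrite powR1 mul1r.
  have m1 : measurable_fun A (fun=> 1 : R) by exact: measurable_cst.
  rewrite (ge0_integralD_real mu mA m1 (mS _ (measurable_powR_norm s mu_)))//.
  rewrite EFinD; apply: leeD.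
    rewrite /= integral_cst// mul1e.
    by rewrite -Am lexx.
  apply: le_trans MB; apply: ge0_subset_integral => //.
  apply: measurable_funTS; apply/measurable_EFinP.
  exact: measurable_powR_norm.
have iu : mu.-integrable A (EFin \o u).
  apply/integrableP; split; first by apply/measurable_EFinP; exact: mS.
  by apply: le_lt_trans (ltry (m + B)).
split=> //; rewrite -lee_fin /Rintegral fineK//.
rewrite ge0_fin_numE; last by apply: integral_ge0.
by apply: le_lt_trans (ltry (m + B)).
Qed.

Variables (O : nat -> set (Rn R n)) (u : nat -> Rn R n -> R) (B : R).
Hypothesis mO : forall k, measurable (O k).
Hypothesis mu_ : forall k, measurable_fun setT (u k).
Hypothesis MB : forall k, (MM (O k) (u k) <= B%:E)%E.
Hypothesis DB : forall k, (\int[mu]_(x in O k) DD (O k) (u k) x <= B%:E)%E.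

Let B0 : 0 <= B.
Proof. by rewrite -lee_fin; apply: le_trans (MB 0%N); exact: mass_ge0. Qed.

(** The divisor is the volume of the whole cell even where the cell leaves [O k]. For such cells
    only boundedness matters; [avg_close] concerns cells inside [O k]. *)
Definition avg k l z : R :=
  (2 ^+ l) ^+ n * \int[mu]_(y in cell l z `&` O k) u k y.

Let cellO k l z : exists2 m, 0 <= m <= (2 ^- l) ^+ n & mu (cell l z `&` O k) = m%:E.
Proof.
have mc := @measurable_cell R n l z.
have H : (mu (cell l z `&` O k) <= ((2 ^- l) ^+ n)%:E)%E.
  by rewrite -(lebesgue_cell R l z); apply: le_measure; rewrite ?inE//; exact: measurableI.
have fn : mu (cell l z `&` O k) \is a fin_num.
  by rewrite ge0_fin_numE//; apply: le_lt_trans H (ltry _).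
exists (fine (mu (cell l z `&` O k))); last by rewrite fineK.
by rewrite fine_ge0//= -lee_fin fineK.
Qed.

Lemma avg_bound k l z : `|avg k l z| <= 1 + (2 ^+ l) ^+ n * B.
Proof.
have [m /andP[m0 m1] Em] := cellO k l z.
have mc : measurable (cell l z `&` O k) by apply: measurableI => //; exact: measurable_cell.
have [iu Hu] := integrable_loc mc (mO k) (@subIsetr _ _ _) (mu_ k) Em (MB k).
have L0 : 0 < (2 ^+ l) ^+ n :> R by rewrite !exprn_gt0.
rewrite /avg normrM gtr0_norm//.
apply: (@le_trans _ _ ((2 ^+ l) ^+ n * (m + B))).
  by rewrite ler_pM2l//; apply: le_trans Hu; exact: le_normr_Rintegral.
rewrite mulrDr lerD2r; apply: (@le_trans _ _ ((2 ^+ l) ^+ n * (2 ^- l) ^+ n)).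
  by rewrite ler_pM2l.
by rewrite -exprMn mulfV ?expr1n// gt_eqF// exprn_gt0.
Qed.

Let rho : R := 2 `^ (- s).
Let rho0 : 0 < rho. Proof. exact: powR_gt0. Qed.
Let rho1 : rho < 1.
Proof. by rewrite -[ltRHS](powRr0 2) gt1_ltr_powR// ?ltr1n//; move: hs0; lra. Qed.

Definition cell_const : R := 2^-1 + Num.sqrt n%:R `^ p / 2.

(** A pointwise Poincare inequality: where the inner energy is finite, the distance to the average
    over a cell of side [2^-l] decays like [2^(-s l)]. *)
Lemma avg_close k l z x d : cell l z x -> cell l z `<=` O k ->
  (DD (O k) (u k) x <= d%:E)%E -> `|u k x - avg k l z| <= cell_const * (rho ^+ l * (1 + d)).
Proof.
move=> xz zO Dd.
have mc : measurable (@cell R n l z) by exact: measurable_cell.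
have mcO : measurable (cell l z `&` O k) by apply: measurableI.
have cO : cell l z `&` O k = cell l z by apply/setIidPl.
have L0 : 0 < (2 ^+ l) ^+ n :> R by rewrite !exprn_gt0.
have l0 : 0 < 2 ^- l :> R by rewrite invr_gt0 exprn_gt0.
have mE := lebesgue_cell R l z.
have LL : (2 ^+ l) ^+ n * (2 ^- l) ^+ n = 1 :> R.
  by rewrite -exprMn mulfV ?expr1n// gt_eqF// exprn_gt0.
have [iu _] := integrable_loc mc (mO k) zO (mu_ k) mE (MB k).
have cfin : (mu (cell l z) < +oo)%E by rewrite (mE : mu _ = _) ltry.
have ic (c : R) : mu.-integrable (cell l z) (EFin \o (fun=> c)).
  apply/integrableP; split; first by apply/measurable_EFinP; exact: measurable_cst.
  by rewrite /= integral_cst//; apply: lte_mul_pinfty => //; rewrite lee_fin.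
have d0 : 0 <= d.
  by rewrite -lee_fin; apply: le_trans Dd; exact: inner_energy_ge0.
pose r : R := Num.sqrt n%:R * 2 ^- l.
have r0 : 0 < r by rewrite mulr_gt0// sqrtr_gt0 ltr0n.
(* [r^p] contributes [2^(-n l) * rho^(2l)]; this [t] leaves [rho^l] in both terms. *)
pose t := rho ^+ l.
have t0 : 0 < t by rewrite exprn_gt0.
have kernel_mass : 0 <= r `^ p / (2 * t) by rewrite divr_ge0 ?powR_ge0// mulr_ge0// ltW.
have ux : u k x = (2 ^+ l) ^+ n * \int[mu]_(y in cell l z) u k x.
  rewrite Rintegral_cst// (_ : fine (mu (cell l z)) = (2 ^- l) ^+ n).
    by rewrite mulrCA LL mulr1.
  by rewrite (mE : mu _ = _).
rewrite /avg cO ux -mulrBr -RintegralB// normrM gtr0_norm//.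
have iD : mu.-integrable (cell l z) (EFin \o (fun y => u k x - u k y)).
  by rewrite (_ : _ \o _ = (EFin \o (fun=> u k x)) \- (EFin \o u k))%E//; exact: integrableB.
have mS (f : Rn R n -> R) : measurable_fun setT f -> measurable_fun (cell l z) f.
  by move=> mf; apply: measurable_funTS.
have mD : measurable_fun setT (fun y => edens (u k) (x, y)).
  exact: (measurableT_comp (measurable_energy_density s (mu_ k)) (measurable_pair1 x)).
have H : (\int[mu]_(y in cell l z) (`|u k x - u k y|)%:E <=
    (t / 2 * (2 ^- l) ^+ n + r `^ p / (2 * t) * d)%:E)%E.
  apply: (@le_trans _ _ (\int[mu]_(y in cell l z) (t / 2 + r `^ p / (2 * t) * edens (u k) (x, y))%:E)%E).
    apply: ge0_le_integral_real => //.
    - by apply: mS; apply: measurableT_comp => //; exact: measurable_funB.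
    - by apply: (mS (fun y => t / 2 + r `^ p / (2 * t) * edens (u k) (x, y)));
        apply: measurable_funD => //; exact: measurable_funM.
    move=> y yz; apply: norm_diff_le => //.
    by apply: eucl_dist_le; [exact: ltW|exact: cell_cube xz yz].
  rewrite ge0_integralD_real//; last 3 first.
  - by apply: (mS (fun y => r `^ p / (2 * t) * edens (u k) (x, y))); exact: measurable_funM.
  - by move=> y _; rewrite divr_ge0// ltW.
  - by move=> y _; rewrite mulr_ge0// energy_density_ge0.
  rewrite EFinD; apply: leeD.
    by rewrite integral_cst// [X in (_ * X)%E](mE : mu _ = _) -EFinM lexx.
  rewrite (@ge0_integralZl_real _ _ _ _ _ _ _ mc kernel_mass (mS _ mD) (fun y => energy_density_ge0 s (u k) (x, y))).
  rewrite [leRHS]EFinM lee_wpmul2l ?lee_fin//; apply: le_trans Dd; apply: ge0_subset_integral => //.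
    by apply: measurable_funTS; exact/measurable_EFinP.
  by move=> y _; rewrite lee_fin energy_density_ge0.
have H2 : `|\int[mu]_(y in cell l z) (u k x - u k y)| <= t / 2 * (2 ^- l) ^+ n + r `^ p / (2 * t) * d.
  apply: (le_trans (le_normr_Rintegral mc iD)).
  rewrite -lee_fin /Rintegral fineK//.
  rewrite ge0_fin_numE; last by apply: integral_ge0.
  exact: (le_lt_trans H (ltry _)).
apply: (@le_trans _ _ ((2 ^+ l) ^+ n * (t / 2 * (2 ^- l) ^+ n + r `^ p / (2 * t) * d))).
  by rewrite ler_pM2l.
have rp : r `^ p = Num.sqrt n%:R `^ p * ((2 ^- l) ^+ n * t ^+ 2).
  rewrite /r powRM ?sqrtr_ge0 ?(ltW l0)//; congr (_ * _).
  rewrite powRD; last by rewrite (gt_eqF l0) implybT.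
  rewrite powR_mulrn ?(ltW l0)//; congr (_ * _).
  rewrite /t /rho -exprM -(powR_mulrn (l * 2)) ?powR_ge0// -powRrM.
  rewrite -(powR_invn l) ?ler0n// -powRrM; congr (_ `^ _); rewrite natrM; ring.
rewrite rp /cell_const mulrDr.
have -> : (2 ^+ l) ^+ n * (t / 2 * (2 ^- l) ^+ n) = t / 2 * ((2 ^+ l) ^+ n * (2 ^- l) ^+ n) by ring.
have -> : (2 ^+ l) ^+ n * (Num.sqrt n%:R `^ p * ((2 ^- l) ^+ n * t ^+ 2) / (2 * t) * d) =
   ((2 ^+ l) ^+ n * (2 ^- l) ^+ n) * (Num.sqrt n%:R `^ p / 2 * t * d).
  by field; rewrite gt_eqF.
rewrite LL mul1r mulr1 -/t; set c := Num.sqrt n%:R `^ p / 2.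
have c0 : 0 <= c by rewrite divr_ge0 ?powR_ge0.
have : 0 <= c * t by rewrite mulr_ge0// ltW.
have : 0 <= t * d by rewrite mulr_ge0// ltW.
by nra.
Qed.

Let avg_limits (F : set_system nat) : UltraFilter F ->
  exists a : nat * ('I_n -> int) -> R, forall l z, (fun k => avg k l z) @ F --> a (l, z).
Proof.
move=> UF.
have H (lz : nat * ('I_n -> int)) : exists L : R, (fun k => avg k lz.1 lz.2) @ F --> L.
  by apply: ultra_limit => k; exact: avg_bound.
have [a Ha] := choice H.
by exists a => l z; exact: (Ha (l, z)).
Qed.

(* Limits along an ultrafilter choose the limits of all the averages over dyadic cells
   at once, without a diagonal argument. *)
Lemma averages_subsequence : exists (sigma : nat -> nat) (a : nat * ('I_n -> int) -> R),
  (forall j, (j <= sigma j)%N) /\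
  forall j l z, (l <= j)%N -> (forall i, `|z i| <= (4 ^ j)%N%:Z) ->
    `|avg (sigma j) l z - a (l, z)| <= rho ^+ j.
Proof.
have [F [UF ooF]] := @ultraFilterLemma nat eventually _.
have [a Ha] := avg_limits UF.
have H j : exists k, (j <= k)%N /\ forall (l : 'I_j.+1) (w : {ffun 'I_n -> 'I_(2 * 4 ^ j).+1}),
    `|avg k l (index_vec w) - a (val l, index_vec w)| <= rho ^+ j.
  have Fj : F [set k | (j <= k)%N] by apply: ooF; exists j.
  have Fw : F [set k | forall (l : 'I_j.+1) (w : {ffun 'I_n -> 'I_(2 * 4 ^ j).+1}),
      `|avg k l (index_vec w) - a (val l, index_vec w)| <= rho ^+ j].
    apply: filter_forall => l; apply: filter_forall => w.
    have /cvgrPdist_le/(_ (rho ^+ j)) := Ha l (index_vec w).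
    move=> /(_ (exprn_gt0 _ rho0)).
    by apply: filterS => k /=; rewrite distrC.
  by have [k [k1 k2]] := filter_ex (filterI Fj Fw); exists k.
have [sigma Hs_on] := choice H.
exists sigma, a; split => [j|j l z lj zj]; first exact: (Hs_on j).1.
have [w <-] := idx_surj zj.
have lj1 : (l < j.+1)%N by rewrite ltnS.
exact: ((Hs_on j).2 (Ordinal lj1) w).
Qed.

Let geo N : \sum_(0 <= j < N) rho ^+ j <= (1 - rho)^-1.
Proof.
have r1 : 0 < 1 - rho by rewrite subr_gt0.
rewrite -[leRHS]mul1r ler_pdivlMr// mulrC.
rewrite -[1 - rho]opprB mulNr big_mkord -subrX1 opprB lerBlDr lerDl exprn_ge0//.
exact: ltW.
Qed.

(** The inner energies are bounded only in the integral, but with the weights [rho^j] their sum is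
    integrable, hence finite at almost every point. There two consecutive functions are close to
    their averages over the same cell of level [j], both averages are close to a common limit, and
    the steps are summable. *)
Lemma subsequence_ae : exists sigma : nat -> nat, (forall j, (j <= sigma j)%N) /\
  {ae mu, forall x, (exists d, 0 < d /\ exists k0, forall k, (k0 <= k)%N -> cube x d `<=` O k) ->
    cvgn (fun j => u (sigma j) x)}.
Proof.
have [sigma [a [sj sa]]] := averages_subsequence.
exists sigma; split => //.
pose g j x : \bar R := ((rho ^+ j)%:E * (DD (O (sigma j)) (u (sigma j)) \_ (O (sigma j))) x)%E.
have rj0 j : 0 <= rho ^+ j by rewrite exprn_ge0// ltW.
have g0 j x : (0 <= g j x)%E.
  rewrite mule_ge0 ?lee_fin// patchE; case: ifP => // _; exact: inner_energy_ge0.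
have mDp j : measurable_fun setT (DD (O (sigma j)) (u (sigma j)) \_ (O (sigma j))).
  apply/(measurable_restrictT _ _).1 => //; apply: measurable_funTS => //.
  exact: measurable_inner_energy.
have mg j : measurable_fun setT (g j) by exact: measurable_funeM.
have Sfin : (\int[mu]_x (\sum_(j <oo) g j x) < +oo)%E.
  rewrite integral_nneseries//.
  apply: (@le_lt_trans _ _ (\sum_(j <oo) (B * rho ^+ j)%:E)%E).
    apply: lee_nneseries => [j _ _|j _]; first exact: integral_ge0.
    rewrite ge0_integralZl//; last 2 first.
    - by move=> x _; rewrite patchE; case: ifP => // _; exact: inner_energy_ge0.
    - by rewrite lee_fin.
    by rewrite mulrC EFinM lee_wpmul2l ?lee_fin// -integral_mkcond.
  by apply: nneseries_geometric_lty => //; exact: ltW.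
have iS : mu.-integrable setT (fun x => \sum_(j <oo) g j x)%E.
  apply/integrableP; split; first by apply: ge0_emeasurable_sum.
  by under eq_integral do rewrite gee0_abs ?nneseries_ge0//.
have := integrable_ae measurableT iS; apply: filterS => x /(_ I) Sx [d [d0 [k0 dO]]].
set S := (\sum_(j <oo) g j x)%E in Sx.
have gS j : (g j x <= S)%E by exact: (le_nneseries_term j (g0^~ x)).
have gfin j : g j x \is a fin_num.
  by rewrite ge0_fin_numE//; apply: le_lt_trans (gS j) _; rewrite -ge0_fin_numE// nneseries_ge0.
pose T j : R := fine (g j x).
have T0 j : 0 <= T j by rewrite fine_ge0.
have TS N : \sum_(0 <= j < N) T j <= fine S.
  rewrite -lee_fin fineK// -sumEFin; under eq_bigr do rewrite fineK//.
  exact: nneseries_lim_ge.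
have CL0 : 0 <= cell_const by rewrite addr_ge0// divr_ge0 ?powR_ge0.
(* The level-[j] cell serves both functions, so the energy of index [j + 1], weighted by
   [rho^(j + 1)], enters with a factor [rho^-1]. The last term is the distance of the two
   averages. *)
pose w j : R := cell_const * (2 * rho ^+ j + T j + rho^-1 * T j.+1) + 2 * rho ^+ j.
have ri0 : 0 <= rho^-1 by rewrite invr_ge0 ltW.
pose M : R := cell_const * (2 * (1 - rho)^-1 + fine S + rho^-1 * fine S) + 2 * (1 - rho)^-1.
(* From this index on, the cell around [x] lies in the cube of radius [d], its index vector is in
   the range covered at stage [j], and [j >= k0]. *)
pose N0 := (Num.truncn (d^-1 + eucl_norm x) + k0).+1.
apply: (@cvgn_summable_steps R _ w N0 M) => [j N0j|j|N]; last 2 first.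
- by rewrite /w addr_ge0 ?mulr_ge0 ?addr_ge0 ?mulr_ge0.
- rewrite /w /M big_split/= -!mulr_sumr !big_split/= -!mulr_sumr.
  apply: lerD; last by rewrite ler_pM2l.
  apply: ler_wpM2l => //; apply: lerD; first apply: lerD => //.
    by rewrite ler_pM2l.
  apply: ler_wpM2l => //; apply: le_trans (TS N.+1).
  by rewrite [leRHS]big_nat_recl//= lerDr.
have [z xz] := cell_exists j x.
have big : d^-1 + eucl_norm x <= 2 ^+ j.
  apply: (@le_trans _ _ N0%:R).
    apply: ltW; apply: (lt_le_trans (truncnS_gt _)); rewrite ler_nat /N0 ltnS.
    exact: leq_addr.
  rewrite -natrX ler_nat (leq_trans N0j)// ltnW// ltn_expl//.
have en0 : 0 <= eucl_norm x by exact: sqrtr_ge0.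
have zb i : `|z i| <= (4 ^ j)%N%:Z.
  apply: (cell_bounded xz) => {}i; apply: le_trans big; apply: ler_wpDl.
    by rewrite invr_ge0 ltW.
  rewrite eucl_norm_dist; have := tnth_eucl_dist x (origin R n) i.
  by rewrite /origin tnth_nseq subr0.
have zb' i : `|z i| <= (4 ^ j.+1)%N%:Z.
  by apply: (le_trans (zb i)); rewrite lez_nat leq_exp2l.
have jd : 2 ^- j <= d.
  rewrite -[d]invrK lef_pV2 ?posrE ?exprn_gt0 ?invr_gt0//.
  by apply: le_trans big; rewrite lerDl.
have zO k : (k0 <= k)%N -> cell j z `<=` O k.
  move=> k0k y yz; apply: (dO k k0k) => i.
  by apply: le_trans jd; exact: cell_cube xz yz i.
have k0j : (k0 <= j)%N by apply: leq_trans N0j; rewrite /N0; apply: leqW; exact: leq_addl.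
have k1 : (k0 <= sigma j)%N by exact: leq_trans k0j (sj j).
have k2 : (k0 <= sigma j.+1)%N by apply: leq_trans (sj j.+1); exact: leqW.
have xO k : (k0 <= k)%N -> x \in O k by move=> kk; rewrite inE; exact: zO.
have DT i : (k0 <= sigma i)%N -> (DD (O (sigma i)) (u (sigma i)) x <= (T i / rho ^+ i)%:E)%E.
  move=> ki; have ri : 0 < rho ^+ i by rewrite exprn_gt0.
  have := gfin i; rewrite /T /g patchE xO//; have := inner_energy_ge0 s (O (sigma i)) (u (sigma i)) x.
  case: (DD _ _ _) => [e| |]//= e0; last by rewrite gt0_muley ?lte_fin.
  by move=> _; rewrite lee_fin mulrAC mulfV ?mul1r// gt_eqF.
have c1 := avg_close xz (zO _ k1) (DT j k1).
have c2 := avg_close xz (zO _ k2) (DT j.+1 k2).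
have a1 := sa j j z (leqnn j) zb.
have a2 := sa j.+1 j z (leqW (leqnn j)) zb'.
set x1 := u (sigma j) x in c1 *; set x2 := u (sigma j.+1) x in c2 *.
set y1 := avg (sigma j) j z in c1 a1; set y2 := avg (sigma j.+1) j z in c2 a2.
set aa := a (j, z) in a1 a2.
have -> : x2 - x1 = (x2 - y2) + (y2 - aa) + (aa - y1) + (y1 - x1) by ring.
have a2' : `|y2 - aa| <= rho ^+ j.
  by apply: (le_trans a2); rewrite exprS ler_piMl// ltW.
have r0 : rho ^+ j != 0 by rewrite gt_eqF// exprn_gt0.
have origin : rho != 0 by rewrite gt_eqF.
have e1 : rho ^+ j * (1 + T j / rho ^+ j) = rho ^+ j + T j by field.
have e2 : rho ^+ j * (1 + T j.+1 / rho ^+ j.+1) = rho ^+ j + rho^-1 * T j.+1.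
  by rewrite exprS; field; rewrite origin r0.
rewrite e1 in c1; rewrite e2 in c2.
have t3 := ler_normD (x2 - y2 + (y2 - aa) + (aa - y1)) (y1 - x1).
have t2 := ler_normD (x2 - y2 + (y2 - aa)) (aa - y1).
have t1 := ler_normD (x2 - y2) (y2 - aa).
rewrite (distrC aa y1) in t2; rewrite (distrC y1 x1) in t3.
rewrite /w; lra.
Qed.

End LocalCompactness.

(** * Convergence of integrals under a bound in L^q *)

Section LimitLemmas.
Context (R : realType).

Lemma cvgn_approx (a : nat -> R) :
  (forall e, 0 < e -> exists2 b : nat -> R, cvgn b & forall k, `|a k - b k| <= e) -> cvgn a.
Proof.
move=> H; apply/cauchy_cvgP; apply: cauchy_exP => e e0.
have e20 : 0 < e / 2 by rewrite divr_gt0.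
have [b cb ab] := H _ e20; exists (limn b).
have /cvgrPdist_lt/(_ _ e20) := cb; apply: filterS => k lb.
rewrite /ball/= (_ : limn b - a k = (limn b - b k) + (b k - a k)); last by ring.
apply: (le_lt_trans (ler_normD _ _)).
rewrite [ltRHS](splitr e) ltr_leD//; by rewrite distrC.
Qed.

Context d (T : measurableType d) (mu : {measure set T -> \bar R}).

(* Truncation at height [A] leaves a uniformly small tail, by boundedness in L^q, and
   makes the dominated convergence theorem applicable. *)
Lemma vitali_weighted (D : set T) (w f : T -> R) (fk : nat -> T -> R) (q B : R) :
  measurable D -> 1 < q -> measurable_fun D w -> (forall x, D x -> 0 <= w x) ->
  mu.-integrable D (EFin \o w) ->
  (forall k, measurable_fun D (fk k)) -> (forall k x, 0 <= fk k x) -> measurable_fun D f ->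
  (forall k, \int[mu]_(x in D) (fk k x `^ q * w x)%:E <= B%:E)%E ->
  {ae mu, forall x, D x -> fk k x @[k --> \oo] --> f x} ->
  cvgn (fun k => \int[mu]_(x in D) (fk k x * w x)).
Proof.
move=> mD q1 mw w0 iw mf f0 mf' fB cvf.
have B0 : 0 <= B.
  rewrite -lee_fin; apply: le_trans (fB 0%N); apply: integral_ge0 => x Dx.
  by rewrite lee_fin mulr_ge0 ?powR_ge0 ?w0.
apply: cvgn_approx => e e0.
(* Makes the tail bound [A^(1 - q) * B] at most [e]; the summand [1] keeps the base positive. *)
pose A : R := (((B + 1) / e) `^ (q - 1)^-1).
have q10 : 0 < q - 1 by lra.
have Be : 0 < (B + 1) / e by rewrite divr_gt0//; lra.
have A0 : 0 < A by exact: powR_gt0.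
have AE : A `^ (1 - q) * B <= e.
  rewrite /A -powRrM (_ : (q - 1)^-1 * (1 - q) = -1); last by field; lra.
  rewrite powR_inv1 ?(ltW Be)// invf_div -mulrA ler_piMr ?(ltW e0)// mulrC.
  by rewrite ler_pdivrMr ?mul1r; lra.
pose h k x := Num.min (fk k x) A.
have mh k : measurable_fun D (h k) by exact: measurable_minr.
have h0 k x : 0 <= h k x by rewrite le_min f0 ltW.
have hA k x : h k x <= A by rewrite ge_min lexx orbT.
have iAw : mu.-integrable D (EFin \o (fun x => A * w x)).
  rewrite (_ : _ \o _ = fun x => (A%:E * (EFin \o w) x)%E).
    exact: integrableZl.
  by apply/funext => x /=; rewrite EFinM.
have ihw k : mu.-integrable D (EFin \o (fun x => h k x * w x)).
  apply: le_integrable iAw => //.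
    by apply/measurable_EFinP; exact: measurable_funM.
  move=> x Dx /=; rewrite lee_fin !ger0_norm ?mulr_ge0 ?w0 ?(ltW A0)//.
  by rewrite ler_wpM2r ?w0.
have mhw k : measurable_fun D (EFin \o (fun x => h k x * w x)).
  by apply/measurable_EFinP; exact: measurable_funM.
have mfw : measurable_fun D (EFin \o (fun x => Num.min (f x) A * w x)).
  apply/measurable_EFinP; apply: measurable_funM => //.
  by apply: measurable_minr => //; exact: measurable_cst.
have cvh : {ae mu, forall x, D x -> (EFin \o (fun x => h k x * w x)) x @[k --> \oo] -->
    (EFin \o (fun x => Num.min (f x) A * w x)) x}.
  apply: filterS cvf => x cvx Dx /=.
  apply: cvg_EFin; first exact: nearW.
  apply: cvgM; last exact: cvg_cst.
  have mlip (a b : R) : `|Num.min a A - Num.min b A| <= `|a - b|.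
    have h1 := ler_norm (a - b); have h2 := ler_norm (b - a); rewrite distrC in h2.
    by rewrite ler_norml /Num.min; case: ltP => ?; case: ltP => ?; apply/andP; split; lra.
  apply/cvgrPdist_lt => e' e'0; have /cvgrPdist_lt/(_ _ e'0) := cvx Dx.
  by apply: filterS => k; apply: le_lt_trans; exact: mlip.
have bdh : {ae mu, forall x k, D x ->
    (`|(EFin \o (fun x => h k x * w x)%R) x| <= (EFin \o (fun x => A * w x)%R) x)%E}.
  apply: aeW => x k Dx /=; rewrite lee_fin ger0_norm ?mulr_ge0 ?w0//.
  by rewrite ler_wpM2r ?w0.
exists (fun k => \int[mu]_(x in D) (h k x * w x)).
  have [il _ cvi] := dominated_convergence mD mhw mfw cvh iAw bdh.
  have fl := integrable_fin_num mD il.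
  apply/cvg_ex; exists (fine (\int[mu]_(x in D) ((EFin \o (fun x => (Num.min (f x) A * w x)%R)) x))%E).
  by apply: fine_cvg; rewrite fineK.
move=> k.
have m2 : measurable_fun D (fun x => A `^ (1 - q) * (fk k x `^ q * w x)).
  apply: measurable_funM => //; apply: measurable_funM => //.
  rewrite (_ : (fun _ => _) = (fun y : R => y `^ q) \o fk k)//.
  by apply: measurableT_comp => //; exact: measurable_powR.
have m3 : measurable_fun D (fun x => (fk k x `^ q * w x)).
  apply: measurable_funM => //.
  rewrite (_ : (fun _ => _) = (fun y : R => y `^ q) \o fk k)//.
  by apply: measurableT_comp => //; exact: measurable_powR.
have i3 : mu.-integrable D (EFin \o (fun x => A `^ (1 - q) * (fk k x `^ q * w x))).
  apply/integrableP; split; first exact/measurable_EFinP.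
  rewrite (eq_integral (fun x => (A `^ (1 - q))%:E * (fk k x `^ q * w x)%:E)%E); last first.
    by move=> x /[!inE] Dx /=; rewrite -EFinM ger0_norm// !mulr_ge0 ?powR_ge0 ?w0.
  rewrite ge0_integralZl//; last 3 first.
  - exact/measurable_EFinP.
  - by move=> x Dx; rewrite lee_fin mulr_ge0 ?powR_ge0 ?w0.
  - by rewrite lee_fin powR_ge0.
  apply: lte_mul_pinfty; rewrite ?lee_fin ?powR_ge0//.
  exact: (le_lt_trans (fB k) (ltry _)).
have ifw : mu.-integrable D (EFin \o (fun x => fk k x * w x)).
  have ig := integrableD mD iAw i3.
  apply: le_integrable ig => //.
    by apply/measurable_EFinP; exact: measurable_funM.
  move=> x Dx; change (`|(fk k x * w x)%:E| <= `|(A * w x + A `^ (1 - q) * (fk k x `^ q * w x))%:E|)%E.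
  have fw0 : 0 <= fk k x * w x by rewrite mulr_ge0 ?f0 ?w0.
  have fw : fk k x * w x <= A * w x + A `^ (1 - q) * (fk k x `^ q * w x).
    rewrite mulrA -mulrDl ler_wpM2r ?w0//; apply: powR_linear_bound => //; exact: ltW.
  by rewrite lee_fin ger0_norm// ger0_norm// (le_trans fw0).
rewrite -RintegralB// ger0_norm; last first.
  apply: Rintegral_ge0 => x Dx; rewrite -mulrBl mulr_ge0 ?w0// subr_ge0.
  by rewrite ge_min lexx.
apply: (@le_trans _ _ (\int[mu]_(x in D) (A `^ (1 - q) * (fk k x `^ q * w x)))).
  apply: le_Rintegral => //.
    exact: (integrableB mD ifw (ihw k)).
  move=> x Dx; rewrite -mulrBl mulrA ler_wpM2r ?w0//.
  have H := powR_linear_bound (f0 k x) A0 (ltW q1).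
  rewrite /h /Num.min; case: ifPn => _; last by lra.
  by rewrite subrr mulr_ge0 ?powR_ge0.
apply: le_trans AE; rewrite -lee_fin /Rintegral fineK; last exact: integrable_fin_num.
rewrite (eq_integral (fun x => (A `^ (1 - q))%:E * (fk k x `^ q * w x)%:E)%E)//.
rewrite ge0_integralZl//; last 3 first.
- exact/measurable_EFinP.
- by move=> x Dx; rewrite lee_fin mulr_ge0 ?powR_ge0 ?w0.
- by rewrite lee_fin powR_ge0.
by rewrite EFinM lee_wpmul2l// lee_fin powR_ge0.
Qed.

End LimitLemmas.

(** * The extension of least energy *)

Section OptimalExtension.
Context (R : realType) (n : nat) (s : R).
Hypotheses (hs0 : 0 < s) (hs1 : s < 1) (n0 : (0 < n)%N) (hns : 2 * s < n%:R).
Local Notation p := (n%:R + 2 * s).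
Local Notation q := (@crit_exp R n s).
Local Notation J := (@riesz R n s).
Local Notation mu := (lebesgue_Rn R n).
Local Notation mu2 := (lebesgue_RnRn R n).
Local Notation EE := (@energyT R n s).
Local Notation MM := (@mass R n s).
Local Notation edens := (@energy_density R n s).
Local Notation Hs := (@Hs_on R n s).
Implicit Types (u v : Rn R n -> R) (x y : Rn R n).

Let q2 : 2 < q. Proof. exact: crit_exp_gt2. Qed.
Let q1 : 1 <= q. Proof. by move: q2; lra. Qed.

Lemma tonelli_rectG (A B : set (Rn R n)) (f : Rn R n * Rn R n -> \bar R) :
  measurable A -> measurable B -> measurable_fun setT f -> (forall z, 0 <= f z)%E ->
  (\int[mu2]_(z in A `*` B) f z =
   \int[lebesgue_Rn R n]_(y in B) \int[lebesgue_Rn R n]_(x in A) f (x, y))%E.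
Proof.
move=> mA mB mf f0; rewrite integral_mkcond tonelliG; last 2 first.
- apply/(measurable_restrictT _ _).1; first exact: measurableX.
  exact: measurable_funTS.
- by move=> z; rewrite patchE; case: ifP.
rewrite [RHS]integral_mkcond; apply: eq_integral => y _; rewrite [RHS]patchE.
case: ifPn => yB; last first.
  apply: integral0_eq => x _; rewrite patchE ifF//; apply/negP; rewrite inE => -[_ /= By].
  by move/negP: yB; apply; rewrite inE.
rewrite [RHS]integral_mkcond; apply: eq_integral => x _; rewrite !patchE.
suff -> : ((x, y) \in A `*` B) = (x \in A) by [].
rewrite inE in yB; apply/idP/idP; rewrite !inE; first by case.
by move=> Ax; split.
Qed.

Lemma edensC u x y : edens u (x, y) = edens u (y, x).
Proof. by rewrite /edens rieszC /= -sqrrN opprB. Qed.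

Definition outer_energy (O : set (Rn R n)) u y : \bar R := (\int[mu]_(x in O) (edens u (x, y))%:E)%E.

(** [T_set O] consists of three rectangles, two of them mirror images. Only these two involve values
    outside [O], and they do so one exterior point at a time, so the energy can be minimized
    pointwise. *)
Lemma energyT_decomp (O : set (Rn R n)) u : measurable O -> measurable_fun setT u ->
  EE O u = (\int[mu2]_(z in O `*` O) (edens u z)%:E +
    (\int[mu]_(y in ~` O) outer_energy O u y + \int[mu]_(y in ~` O) outer_energy O u y))%E.
Proof.
move=> mO mu_; have mC := measurableC mO.
have me : measurable_fun setT (fun z => (edens u z)%:E).
  by apply/measurable_EFinP; exact: measurable_energy_density.
have mS A : measurable_fun A (fun z => (edens u z)%:E) by exact: measurable_funTS.
have e0 z : (0 <= (edens u z)%:E)%E by rewrite lee_fin energy_density_ge0.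
have TE : T_set O = (O `*` O) `|` ((O `*` ~` O) `|` (~` O `*` O)).
  apply/seteqP; split => -[x y]; rewrite /T_set/=.
    move=> /not_andP[/contrapT Ox|/contrapT Oy].
      by have [Oy|Oy] := pselect (O y); [left|right; left].
    by have [Ox|Ox] := pselect (O x); [left|right; right].
  by move=> [[Ox Oy]|[[Ox Oy]|[Ox Oy]]] [].
rewrite energyTE TE.
have mX1 : measurable (O `*` O) by exact: measurableX.
have mX2 : measurable (O `*` ~` O) by exact: measurableX.
have mX3 : measurable (~` O `*` O) by exact: measurableX.
rewrite ge0_integral_setU//; last 2 first.
- exact: measurableU.
- apply/disj_setPLR => -[x y] /= [Ox Oy] [[]|[]]//.
congr (_ + _)%E.
rewrite ge0_integral_setU//; last first.
  by apply/disj_setPLR => -[x y] /= [Ox Oy] [].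
congr (_ + _)%E; first exact: (tonelli_rectG mO mC me e0).
apply: (etrans (tonelli_rect mC mO me e0)).
by apply: eq_integral => x _; apply: eq_integral => y _; rewrite edensC.
Qed.

Let O : set (Rn R n) := hspace 0.
Let mO : measurable O. Proof. exact: measurable_half. Qed.

(* For fixed [y] outside the half space, [c |-> \int_O (u x - c)^2 J (x, y) dx] is
   minimal at the weighted mean of [u], so this is the extension of [u] from the
   half space that has the least energy. *)
Definition ext u y : R :=
  if y \in O then u y
  else (\int[mu]_(x in O) (u x * J (x, y))) / (\int[mu]_(x in O) J (x, y)).

Let mJ y : measurable_fun setT (fun x => J (x, y)).
Proof. exact: (measurableT_comp (@measurable_riesz R n s) (measurable_pair2 y)). Qed.

Let mS (f : Rn R n -> R) : measurable_fun setT f -> measurable_fun O f.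
Proof. by move=> mf; apply: measurable_funTS. Qed.

Lemma measurable_ext u : measurable_fun setT u -> (forall x, 0 <= u x) ->
  measurable_fun setT (ext u).
Proof.
move=> mu_ u0.
have mG (f : Rn R n * Rn R n -> R) : measurable_fun setT f -> (forall z, 0 <= f z) ->
    measurable_fun setT (fun y => \int[mu]_(x in O) f (x, y)).
  move=> mf f0; apply: (measurableT_comp (fine_measurable measurableT)).
  rewrite (_ : (fun _ => _) = (fun y => \int[mu]_x ((EFin \o f) \_ (O `*` setT)) (x, y))%E).
    apply: measurable_tonelliG.
      apply/(measurable_restrictT _ _).1; first exact: measurableX.
      by apply: measurable_funTS; exact/measurable_EFinP.
    by move=> z /=; rewrite patchE; case: ifP => // _; rewrite lee_fin.
  apply/funext => y; rewrite integral_mkcond; apply: eq_integral => x _; rewrite !patchE.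
  suff -> : ((x, y) \in O `*` setT) = (x \in O) by case: ifP.
  by apply/idP/idP; rewrite !inE; [case|move=> Ox; split].
apply: measurable_fun_ifT => //.
- apply: (measurable_fun_bool true).
  rewrite setTI (_ : _ @^-1` _ = O)//; apply/seteqP; split => x; rewrite /preimage/=.
    by move=> xO; rewrite -in_setE.
  by move=> xO; rewrite mem_set.
- apply: measurable_funM.
    apply: (mG (fun z => u z.1 * J z)).
      by apply: measurable_funM; [exact: (measurableT_comp mu_ measurable_fst)|exact: measurable_riesz].
    by move=> z; rewrite mulr_ge0 ?riesz_ge0.
  rewrite (_ : (fun _ => _) = (fun r : R => r `^ (-1)) \o (fun y => \int[mu]_(x in O) J (x, y))).
    apply: measurableT_comp; first exact: measurable_powR.
    by apply: mG; [exact: measurable_riesz|move=> z; exact: riesz_ge0].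
  apply/funext => y /=; rewrite powR_inv1//; apply: Rintegral_ge0 => x _.
  exact: riesz_ge0.
Qed.

(** A point outside the closed half space has a positive distance from it; seen from there the
    kernel is bounded and integrable on [O]. *)
Let ext_away y : ~ O y -> exists2 d : R, 0 < d & forall x, O x -> d <= eucl_dist x y.
Proof.
rewrite /O /hspace/= oppr0 => /negP; rewrite -ltNge => y0.
exists (- nth 0 y n.-1); first by rewrite oppr_gt0.
move=> x; rewrite /O /hspace/= => x0.
have ln : (n.-1 < n)%N by rewrite prednK.
apply: le_trans (tnth_eucl_dist x y (Ordinal ln)); rewrite !(tnth_nth 0)/=.
by rewrite ger0_norm; lra.
Qed.

Let integrable_riesz y : ~ O y -> mu.-integrable O (EFin \o (fun x => J (x, y))).
Proof.
move=> /ext_away[d d0 dO]; apply/integrableP; split.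
  by apply/measurable_EFinP; exact: mS.
rewrite (eq_integral (fun x => (J (x, y))%:E)); last first.
  by move=> x _ /=; rewrite ger0_norm// riesz_ge0.
exact: integral_riesz_away dO.
Qed.

Let riesz_mass_gt0 y : ~ O y -> 0 < \int[mu]_(x in O) J (x, y).
Proof.
move=> yO; have [d d0 dO] := ext_away yO.
have fJ := integrable_fin_num mO (integrable_riesz yO).
rewrite -lte_fin fineK//.
pose r := eucl_dist y (origin R n) + 1.
have r0 : 0 < r by rewrite ltr_wpDl// eucl_dist_ge0.
pose l := Num.sqrt n%:R * r.
have l0 : 0 < l by rewrite mulr_gt0// sqrtr_gt0 ltr0n.
have O0 : O (origin R n) by rewrite /O /hspace/= oppr0 nth_nseq; case: ifP.
have mC : measurable (O `&` cube (origin R n) 1) by apply: measurableI => //; exact: measurable_cube.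
apply: (@lt_le_trans _ _ (\int[mu]_(x in O `&` cube (origin R n) 1) ((l `^ p)^-1)%:E)%E).
  rewrite integral_cst//; apply: mule_gt0; first by rewrite lte_fin invr_gt0 powR_gt0.
  apply: lt_le_trans (@fat_half R n 0 (origin R n) 1 O0 ltr01).
  by rewrite expr1n lte_fin.
apply: (@le_trans _ _ (\int[mu]_(x in O `&` cube (origin R n) 1) (J (x, y))%:E)%E).
  apply: ge0_le_integral_real => //.
  - by apply: measurable_funTS.
  - by move=> x _; rewrite invr_ge0 powR_ge0.
  move=> x [Ox xc]; apply: riesz_ge => //; first exact: lt_le_trans (dO x Ox).
  rewrite eucl_distC; apply: eucl_dist_le; first exact: ltW.
  move=> i; have := xc i; have := tnth_eucl_dist y (origin R n) i.
  rewrite /r !tnth_nseq !subr0 => h1 h2.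
  by apply: (le_trans (ler_normB _ _)); lra.
apply: ge0_subset_integral => //.
- by apply/measurable_EFinP; exact: mS.
- by move=> x _; rewrite lee_fin riesz_ge0.
Qed.

Let integrable_u_riesz u y : measurable_fun setT u -> (forall x, 0 <= u x) ->
  (MM O u < +oo)%E -> ~ O y -> mu.-integrable O (EFin \o (fun x => u x * J (x, y))).
Proof.
move=> mu_ u0 Mu yO; have [d d0 dO] := ext_away yO.
have muq := measurable_powR_norm s mu_.
have mP : measurable_fun O (fun x => (d `^ p)^-1 * `|u x| `^ q).
  by apply: measurable_funTS; exact: measurable_funM.
have iP : mu.-integrable O (EFin \o (fun x => (d `^ p)^-1 * `|u x| `^ q)).
  apply/integrableP; split; first exact/measurable_EFinP.
  rewrite (eq_integral (fun x => ((d `^ p)^-1 * `|u x| `^ q)%:E)); last first.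
    by move=> x _ /=; rewrite ger0_norm// mulr_ge0 ?invr_ge0 ?powR_ge0.
  rewrite ge0_integralZl_real ?invr_ge0 ?powR_ge0//; last exact: mS.
  by apply: lte_mul_pinfty; rewrite ?lee_fin ?invr_ge0 ?powR_ge0.
apply: (le_integrable mO _ _ (integrableD mO (integrable_riesz yO) iP)).
  by apply/measurable_EFinP; apply: measurable_funTS; exact: measurable_funM.
move=> x Ox; change (`|(u x * J (x, y))%:E| <= `|(J (x, y) + (d `^ p)^-1 * `|u x| `^ q)%:E|)%E.
have J0 := riesz_ge0 s (x, y); have q0 := powR_ge0 `|u x| q.
have Jd := @riesz_le R n s hs0 x y d d0 (dO x Ox).
have H := @powR_linear_bound R (u x) 1 q (u0 x) ltr01 q1.
have H0 : 0 <= u x * J (x, y) by rewrite mulr_ge0.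
have H1 : u x * J (x, y) <= J (x, y) + (d `^ p)^-1 * `|u x| `^ q.
  rewrite powR1 mul1r -{2}(ger0_norm (u0 x)) in H; nra.
by rewrite lee_fin ger0_norm// ger0_norm// (le_trans H0).
Qed.

(** The weight [J (x, y)] is integrable and bounded on [O], so the mass bound feeds
    [vitali_weighted] and the weighted means converge. Convergence inside thus forces convergence at
    every exterior point. *)
Lemma ext_cvg (uk : nat -> Rn R n -> R) (U : Rn R n -> R) B y : (forall k, measurable_fun setT (uk k)) ->
  (forall k x, 0 <= uk k x) -> measurable_fun setT U -> (forall k, MM O (uk k) <= B%:E)%E ->
  {ae mu, forall x, O x -> uk k x @[k --> \oo] --> U x} -> ~ O y ->
  cvgn (fun k => ext (uk k) y).
Proof.
move=> mk k0 mU MB cvU yO; have [d d0 dO] := ext_away yO.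
have yE u : ext u y = (\int[mu]_(x in O) (u x * J (x, y))) / (\int[mu]_(x in O) J (x, y)).
  by rewrite /ext ifF//; apply/negP; rewrite inE.
under eq_fun do rewrite yE.
apply: is_cvgM; last exact: is_cvg_cst.
apply: (@vitali_weighted _ _ _ mu O (fun x => J (x, y)) U uk q ((d `^ p)^-1 * B)) => //.
- by move: q2; lra.
- exact: mS.
- by move=> x _; exact: riesz_ge0.
- exact: integrable_riesz.
- by move=> k; exact: mS.
- exact: mS.
move=> k; have muq := measurable_powR_norm s (mk k).
apply: (@le_trans _ _ (\int[mu]_(x in O) ((d `^ p)^-1 * `|uk k x| `^ q)%:E)%E); last first.
  rewrite ge0_integralZl_real ?invr_ge0 ?powR_ge0//; last exact: mS.
  rewrite [leRHS]EFinM; apply: lee_wpmul2l; last exact: MB.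
  by rewrite lee_fin invr_ge0 powR_ge0.
have mq : measurable_fun setT (fun x => uk k x `^ q).
  by rewrite (_ : (fun _ => _) = (fun x => `|uk k x| `^ q))//; apply/funext => x; rewrite ger0_norm.
apply: ge0_le_integral_real => //.
- by apply: measurable_funTS; exact: measurable_funM.
- by apply: measurable_funTS; exact: measurable_funM.
- by move=> x _; rewrite mulr_ge0 ?powR_ge0 ?riesz_ge0.
move=> x Ox; rewrite mulrC ger0_norm// ler_wpM2r ?powR_ge0//.
exact: riesz_le (dO x Ox).
Qed.

(** Complete the square around the weighted mean [a]: the linear term integrates to [0], and the
    nonnegative term [(u y - a)^2 * J] is dropped. *)
Let outer_energy_ext u y : measurable_fun setT u -> (forall x, 0 <= u x) ->
  (MM O u < +oo)%E -> ~ O y -> (outer_energy O (ext u) y <= outer_energy O u y)%E.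
Proof.
move=> mu_ u0 Mu yO.
have iJ := integrable_riesz yO; have iuJ := integrable_u_riesz mu_ u0 Mu yO.
set a := ext u y.
have aE : \int[mu]_(x in O) (u x * J (x, y)) = a * \int[mu]_(x in O) J (x, y).
  rewrite /a /ext ifF; last by apply/negP; rewrite inE.
  by rewrite divfK// gt_eqF// riesz_mass_gt0.
have EV : outer_energy O (ext u) y = (\int[mu]_(x in O) ((u x - a) ^+ 2 * J (x, y))%:E)%E.
  by apply: eq_integral => x xO; rewrite /edens/= {1}/ext xO.
rewrite EV; have [->|Vfin] := eqVneq (outer_energy O u y) +oo%E; first exact: leey.
have me v : measurable_fun setT v -> measurable_fun setT (fun x => edens v (x, y)).
  by move=> mv; exact: (measurableT_comp (measurable_energy_density s mv) (measurable_pair2 y)).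
have mw c : measurable_fun setT (fun x => (u x - c) ^+ 2 * J (x, y)).
  apply: measurable_funM => //; apply: measurable_funX; apply: measurable_funB => //.
have iV : mu.-integrable O (EFin \o (fun x => edens u (x, y))).
  apply/integrableP; split; first by apply/measurable_EFinP; apply: mS; exact: me.
  rewrite (eq_integral (fun x => (edens u (x, y))%:E)); last first.
    by move=> x _ /=; rewrite ger0_norm// energy_density_ge0.
  by rewrite ltey.
set c := u y in iV.
have iL : mu.-integrable O (EFin \o (fun x => (2 * (u y - a)) * (u x * J (x, y) - a * J (x, y)))).
  apply: (integrableZl mO (2 * (u y - a)) (integrableB mO iuJ (integrableZl mO a iJ))).
apply: (@le_trans _ _ (\int[mu]_(x in O) (edens u (x, y) +
    (2 * (u y - a)) * (u x * J (x, y) - a * J (x, y)))%:E)%E).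
  apply: ge0_le_integral_real => //.
  - exact: mS.
  - have muJ : measurable_fun setT (fun x => u x * J (x, y)) by exact: measurable_funM.
    apply: measurable_funTS => //.
    apply: measurable_funD; first exact: me.
    by apply: measurable_funM => //; apply: measurable_funB => //; exact: measurable_funM.
  - by move=> x _; rewrite mulr_ge0 ?sqr_ge0 ?riesz_ge0.
  move=> x _; rewrite /edens/=.
  have J0 := riesz_ge0 s (x, y).
  have -> : (u x - u y) ^+ 2 * J (x, y) + 2 * (u y - a) * (u x * J (x, y) - a * J (x, y)) =
    (u x - a) ^+ 2 * J (x, y) + (u y - a) ^+ 2 * J (x, y) by ring.
  by rewrite lerDl mulr_ge0 ?sqr_ge0.
rewrite (eq_integral (fun x => (EFin \o (fun x => edens u (x, y))) x +
  (EFin \o (fun x => ((2 * (u y - a)) * (u x * J (x, y) - a * J (x, y)))%R)) x)%E)//.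
rewrite (integralD mO iV iL).
suff -> : (\int[mu]_(x in O) (EFin \o (fun x => ((2 * (u y - a)) * (u x * J (x, y) - a * J (x, y)))%R)) x = 0)%E.
  by rewrite adde0.
rewrite -(fineK (integrable_fin_num mO iL)); congr EFin.
have ia := integrableZl mO a iJ.
change (\int[mu]_(x in O) ((2 * (u y - a)) * (u x * J (x, y) - a * J (x, y))) = 0).
rewrite RintegralZl//; last exact: (integrableB mO iuJ ia).
rewrite (RintegralB mO iuJ ia) RintegralZl// aE subrr mulr0//.
Qed.

Lemma mass_ext u : MM O (ext u) = MM O u.
Proof. by apply: eq_integral => x xO; rewrite /ext xO. Qed.

Let measurable_outer_energy u : measurable_fun setT u -> measurable_fun setT (outer_energy O u).
Proof.
move=> mu_; rewrite (_ : outer_energy O u = @inner_energy R n s O u); first exact: measurable_inner_energy.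
by apply/funext => y; apply: eq_integral => x _; rewrite edensC.
Qed.

Lemma energyT_ext_le u : measurable_fun setT u -> (forall x, 0 <= u x) ->
  (MM O u < +oo)%E -> (EE O (ext u) <= EE O u)%E.
Proof.
move=> mu_ u0 Mu; have me := measurable_ext mu_ u0.
have mC : measurable (~` O) by exact: measurableC.
have H : (\int[mu]_(y in ~` O) outer_energy O (ext u) y <= \int[mu]_(y in ~` O) outer_energy O u y)%E.
  apply: ge0_le_integral => //.
  - by move=> y _; apply: integral_ge0 => x _; rewrite lee_fin energy_density_ge0.
  - by apply: measurable_funTS; exact: measurable_outer_energy.
  - by apply: measurable_funTS; exact: measurable_outer_energy.
  - by move=> y yO; exact: outer_energy_ext.
rewrite (energyT_decomp mO me) (energyT_decomp mO mu_); apply: leeD; last exact: leeD.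
rewrite le_eqVlt; apply/orP; left; apply/eqP; apply: eq_integral => z /[!inE] -[z1 z2].
by rewrite /edens /ext !mem_set.
Qed.

Lemma Hs_on_ext u : (forall x, 0 <= u x) -> Hs O u -> Hs O (ext u).
Proof.
move=> u0 [mu_ Mu Eu]; split; first exact: measurable_ext.
  by rewrite mass_ext.
by apply: le_lt_trans Eu; exact: energyT_ext_le.
Qed.

End OptimalExtension.

(** * Fatou's lemma for varying domains, and limits of powers *)

Section FatouEventually.
Context d (T : measurableType d) (R : realType) (mu : {measure set T -> \bar R}).

(** Fatou's lemma in a form suited to contradiction: a strict lower bound for the limit integral
    holds for all late terms, which keeps lower limits out of the later arguments. *)
Lemma fatou_eventually (D : set T) (fk : nat -> T -> R) (f : T -> R) (c : \bar R) :
  measurable D -> (forall k, measurable_fun D (fk k)) -> (forall k x, D x -> 0 <= fk k x) ->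
  measurable_fun D f -> (forall x, D x -> 0 <= f x) ->
  {ae mu, forall x, D x -> fk k x @[k --> \oo] --> f x} ->
  (c < \int[mu]_(x in D) (f x)%:E)%E ->
  exists N, forall k, (N <= k)%N -> (c < \int[mu]_(x in D) (fk k x)%:E)%E.
Proof.
move=> mD mk k0 mf f0 cvf cf.
pose g k x := (fk k x)%:E.
have mg k : measurable_fun D (g k) by exact/measurable_EFinP.
have g0 k x : D x -> (0 <= g k x)%E by move=> Dx; rewrite lee_fin k0.
have mi : measurable_fun D (fun x => limn_einf (g ^~ x)).
  rewrite /limn_einf; apply: measurableT_comp => //.
  apply: (measurable_fun_limn_esup (f := fun k x => (- g k x)%E)) => // k.
  exact: measurableT_comp.
have i0 x : D x -> (0 <= limn_einf (g ^~ x))%E.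
  move=> Dx; rewrite limn_einf_lim; apply: lime_ge; first exact: is_cvg_einfs.
  by apply: nearW => k; apply: le_ereal_inf_tmp => _ [m /= _ <-]; exact: g0.
have E : (\int[mu]_(x in D) (f x)%:E = \int[mu]_(x in D) limn_einf (g ^~ x))%E.
  apply: ge0_ae_eq_integral => //; first exact/measurable_EFinP.
  apply: filterS cvf => x cvx Dx.
  have gx : g ^~ x @ \oo --> (f x)%:E by apply: cvg_EFin; [exact: nearW|exact: cvx].
  by rewrite (cvg_limn_einf_sup gx).
have := fatou mu mD mg g0; rewrite -E => /(lt_le_trans cf); rewrite limn_einf_lim => H.
have [N cN] : exists N, (c < einfs (fun k => \int[mu]_(x in D) g k x) N)%E.
  apply: contrapT => /forallNP nN; move: H; apply/negP; rewrite -leNgt.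
  apply: lime_le; first exact: is_cvg_einfs.
  by apply: nearW => k; rewrite leNgt; exact/negP.
exists N => k Nk; apply: (lt_le_trans cN).
by apply: ereal_inf_lbound; exists k.
Qed.

Lemma integral_indicM (D E : set T) (f : T -> R) : E `<=` D ->
  (\int[mu]_(x in D) (\1_E x * f x)%:E = \int[mu]_(x in E) (f x)%:E)%E.
Proof.
move=> ED; rewrite integral_mkcond [RHS]integral_mkcond; apply: eq_integral => x _.
rewrite !patchE indicE; case: (boolP (x \in E)) => xE; last by rewrite mul0r if_same.
by rewrite mul1r ifT// inE; apply: ED; rewrite -inE.
Qed.

End FatouEventually.

Lemma powR_norm_cvg (R : realType) (a : nat -> R) (l q : R) : 0 < q ->
  a k @[k --> \oo] --> l -> `|a k| `^ q @[k --> \oo] --> `|l| `^ q.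
Proof.
move=> q0; have [->|l0] := eqVneq l 0 => al.
  rewrite normr0 powR0 ?gt_eqF//; apply/cvgrPdist_lt => e e0.
  have d0 : 0 < e `^ q^-1 by exact: powR_gt0.
  move/cvgrPdist_lt/(_ _ d0) : al; apply: filterS => k.
  rewrite !sub0r !normrN => ad; rewrite ger0_norm ?powR_ge0//.
  rewrite -[ltRHS](powRr1 (ltW e0)) -[X in _ < _ `^ X](mulVf (lt0r_neq0 q0)) powRrM.
  by apply: gt0_ltr_powR; rewrite ?nnegrE ?normr_ge0 ?(ltW d0).
rewrite /powR normr_eq0 (negbTE l0).
have H : (fun k => expR (q * ln `|a k|)) @ \oo --> expR (q * ln `|l|).
  apply: continuous_cvg; first exact: continuous_expR.
  apply: cvgM; first exact: cvg_cst.
  by apply: continuous_cvg; [apply: continuous_ln; rewrite normr_gt0|exact: cvg_norm].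
apply: cvg_trans H; apply: near_eq_cvg.
have /cvgrPdist_lt/(_ `|l|) := al; rewrite normr_gt0 l0 => /(_ isT); apply: filterS => k.
by rewrite normr_eq0; case: eqVneq => // ->; rewrite subr0 ltxx.
Qed.

Section ProductAe.
Context (R : realType) (n : nat).

Lemma ae_pairs (P : Rn R n -> Prop) : {ae lebesgue_Rn R n, forall x, P x} ->
  {ae lebesgue_RnRn R n, forall z, P z.1 /\ P z.2}.
Proof.
move=> [N [mN N0 NP]].
exists ((N `*` setT) `|` (setT `*` N)); split.
- by apply: measurableU; exact: measurableX.
- have E1 : lebesgue_RnRn R n (N `*` setT) = 0%E.
    apply: (etrans (product_measure1E (lebesgue_Rn R n) (lebesgue_Rn R n) mN measurableT)).
    by rewrite [X in (X * _)%E](N0 : lebesgue_Rn R n N = 0%E) mul0e.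
  have E2 : lebesgue_RnRn R n (setT `*` N) = 0%E.
    apply: (etrans (product_measure1E (lebesgue_Rn R n) (lebesgue_Rn R n) measurableT mN)).
    by rewrite [X in (_ * X)%E](N0 : lebesgue_Rn R n N = 0%E) mule0.
  by rewrite measureU0//; exact: measurableX.
- move=> [x y] /= /not_andP[Px|Py]; [left|right]; split => //; exact: NP.
Qed.

End ProductAe.

(** * Splitting of energy and mass between the limit and the remainder *)

Section Splitting.
Context (R : realType) (n : nat) (s : R).
Hypotheses (hs0 : 0 < s) (hs1 : s < 1) (n0 : (0 < n)%N) (hns : 2 * s < n%:R).
Local Notation q := (@crit_exp R n s).
Local Notation J := (@riesz R n s).
Local Notation mu := (lebesgue_Rn R n).
Local Notation mu2 := (lebesgue_RnRn R n).
Local Notation EE := (@energyT R n s).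
Local Notation MM := (@mass R n s).
Local Notation edens := (@energy_density R n s).
Local Notation Hs := (@Hs_on R n s).
Local Notation mR := (@massR R n s).
Local Notation eR := (@energyR R n s).
Local Notation lam := (@best_constant R n s).
Local Notation Tset := (@T_set R n).

Let q2 : 2 < q. Proof. exact: crit_exp_gt2. Qed.
Let q1 : 1 <= q. Proof. by move: q2; lra. Qed.

(** Two cases share this section: [O] is the half space and all levels are [0], or [O] is the whole
    space and the levels tend to infinity. *)
Variables (O : set (Rn R n)) (t : nat -> R) (uk : nat -> Rn R n -> R) (U : Rn R n -> R).
Hypothesis mO : measurable O.
Hypothesis tO : forall k, hspace (t k) `<=` O.
Hypothesis Ot : forall x, O x -> exists N, forall k, (N <= k)%N -> hspace (t k) x.
Hypothesis mU : measurable_fun setT U.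
Hypothesis Hk : forall k, Hs (hspace (t k)) (uk k).
Hypothesis ek : forall k, eR (hspace (t k)) (uk k) <= 1.
Hypothesis cvU : {ae mu, forall x, uk k x @[k --> \oo] --> U x}.

Let mH k : measurable (@hspace R n (t k)). Proof. exact: measurable_half. Qed.
Let mk k : measurable_fun setT (uk k). Proof. by have [] := Hk k. Qed.

Let T_sub k : Tset (hspace (t k)) `<=` Tset O.
Proof. by move=> z zk [z1 z2]; apply: zk; split => /tO. Qed.

Let T_ev z : Tset O z -> exists N, forall k, (N <= k)%N -> Tset (hspace (t k)) z.
Proof.
move=> /not_andP[/contrapT/Ot[N H]|/contrapT/Ot[N H]]; exists N => k /H zk [z1 z2].
  by [].
by [].
Qed.

Let indic_ev (S : Type) (Ek : nat -> set S) z (a : nat -> R) (l : R) :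
  (exists N, forall k, (N <= k)%N -> Ek k z) -> a k @[k --> \oo] --> l ->
  (\1_(Ek k) z * a k : R) @[k --> \oo] --> l.
Proof.
move=> [N EN]; apply: cvg_trans; apply: near_eq_cvg.
by exists N => // k /= Nk; rewrite indicE mem_set ?mul1r//; exact: EN.
Qed.

Let mE u D : measurable_fun setT u -> measurable_fun D (edens u).
Proof. by move=> m_; apply: measurable_funTS; exact: measurable_energy_density. Qed.

Let energy_density_cvg (vk : nat -> Rn R n -> R) (v : Rn R n -> R) z :
  vk k z.1 @[k --> \oo] --> v z.1 -> vk k z.2 @[k --> \oo] --> v z.2 ->
  edens (vk k) z @[k --> \oo] --> edens v z.
Proof.
move=> c1 c2; apply: cvgM; last exact: cvg_cst.
by rewrite expr2; under eq_fun do rewrite expr2; apply: cvgM; exact: cvgB.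
Qed.

(** Indicators carry the integrals over the varying sets [T_set (hspace (t k))] to the fixed set
    [T_set O]; at each point of it they are eventually [1]. *)
Lemma limit_energy_le1 : (EE O U <= 1)%E.
Proof.
rewrite leNgt; apply/negP => H.
have mT := measurable_T_set mO.
have [] := @fatou_eventually _ _ R mu2 (Tset O)
  (fun k z => \1_(Tset (hspace (t k))) z * edens (uk k) z) (edens U) 1 mT _ _ _ _ _ H.
- move=> k; apply: measurable_funM; last exact: mE.
  by apply: measurable_indic; exact: measurable_T_set.
- by move=> k z _; rewrite mulr_ge0 ?energy_density_ge0.
- exact: mE.
- by move=> z _; exact: energy_density_ge0.
- apply: filterS (ae_pairs cvU) => z [c1 c2] zO.
  by apply: indic_ev; [exact: T_ev|exact: energy_density_cvg].
move=> N /(_ N (leqnn _)); rewrite integral_indicM//; apply/negP; rewrite -leNgt.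
by have [_ _ EN] := Hk N; rewrite -energyTE energyRE// lee_fin.
Qed.

Lemma limit_mass_le : (MM O U <= lam%:E)%E.
Proof.
rewrite leNgt; apply/negP => H.
have mq (u : Rn R n -> R) (D : set (Rn R n)) : measurable_fun setT u -> measurable_fun D (fun x => `|u x| `^ q).
  by move=> m_; apply: measurable_funTS; exact: measurable_powR_norm.
have [] := @fatou_eventually _ _ R mu O
  (fun k x => \1_(hspace (t k)) x * `|uk k x| `^ q) (fun x => `|U x| `^ q) lam%:E mO _ _ _ _ _ H.
- by move=> k; apply: measurable_funM; [exact: measurable_indic|exact: mq].
- by move=> k x _; rewrite mulr_ge0 ?powR_ge0.
- exact: mq.
- by move=> x _; rewrite powR_ge0.
- apply: filterS cvU => x c1 xO.
  by apply: indic_ev; [exact: Ot|apply: powR_norm_cvg => //; move: q1; lra].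
move=> N /(_ N (leqnn _)); rewrite integral_indicM//; apply/negP; rewrite -leNgt.
have [_ MN _] := Hk N; rewrite -/(MM (hspace (t N)) (uk N)) massRE// lee_fin.
apply: (le_trans (best_constant_ineq hs0 n0 hns (Hk N))).
rewrite ler_piMr ?best_constant_ge0//; apply: (@le_trans _ _ (1 `^ (q / 2))); last by rewrite powR1.
by apply: ge0_ler_powR; rewrite ?nnegrE ?energyR_ge0//; move: q1; lra.
Qed.

Lemma Hs_on_limit : Hs O U.
Proof.
split => //; first exact: le_lt_trans limit_mass_le (ltry _).
exact: le_lt_trans limit_energy_le1 (ltry _).
Qed.

Let Hs_on_subset A B u : measurable A -> measurable B -> A `<=` B -> Hs B u ->
  Hs A u.
Proof.
move=> mA mB AB [mu_ Mu Eu]; split => //.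
- apply: le_lt_trans Mu; apply: ge0_subset_integral => //.
  apply: measurable_funTS; apply/measurable_EFinP.
  exact: measurable_powR_norm.
- apply: le_lt_trans Eu; rewrite !energyTE; apply: ge0_subset_integral => //.
  + exact: measurable_T_set.
  + exact: measurable_T_set.
  + by apply/measurable_EFinP; exact: mE.
  + by move=> z _; rewrite lee_fin energy_density_ge0.
  + by move=> z zA [z1 z2]; apply: zA; split => /AB.
Qed.

Let g k x : R := uk k x - U x.

Let Hg k : Hs (hspace (t k)) (g k).
Proof.
rewrite (_ : g k = (fun x => uk k x + -1 * U x)); last by apply/funext => x; rewrite mulN1r.
apply: Hs_on_add => //; apply: Hs_on_scale => //; exact: Hs_on_subset (@tO k) Hs_on_limit.
Qed.

Let mg k : measurable_fun setT (g k). Proof. by have [] := Hg k. Qed.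

Let cvg0 x : uk k x @[k --> \oo] --> U x -> g k x @[k --> \oo] --> (0 : R).
Proof. by move=> c; rewrite -(subrr (U x)); apply: cvgB => //; exact: cvg_cst. Qed.

(** One half of the Brezis-Lieb identity suffices: asymptotically the remainder has no more energy
    than [U] leaves. Weakening it by the factor [1 - eps] pays for the cross term through a
    completed square. *)
Let energy_gap eps delta : 0 < eps -> eps < 1 -> 0 < delta -> exists N, forall k, (N <= k)%N ->
  (1 - eps) * eR (hspace (t k)) (g k) <= 1 - eR O U + delta.
Proof.
move=> e0 e1 d0.
have mT := measurable_T_set mO.
have [mU' MU EU] := Hs_on_limit.
pose I k := \1_(Tset (hspace (t k))) : Rn R n * Rn R n -> R.
have mI k : measurable_fun (Tset O) (I k) by apply: measurable_indic; exact: measurable_T_set.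
(* The last term makes [f k] nonnegative, so that Fatou's lemma applies to it. *)
pose f k z := I k z * (edens (uk k) z - (1 - eps) * edens (g k) z) + eps^-1 * edens U z.
have mf k : measurable_fun (Tset O) (f k).
  apply: measurable_funD; last by apply: measurable_funM => //; exact: mE.
  apply: measurable_funM => //; apply: measurable_funB; first exact: mE.
  by apply: measurable_funM => //; exact: mE.
have f0 k z : 0 <= f k z.
  have ei : 0 < eps^-1 by rewrite invr_gt0.
  have U0 : 0 <= eps^-1 * edens U z by rewrite mulr_ge0 ?energy_density_ge0// ltW.
  rewrite /f /I indicE; case: (z \in _); last by rewrite mul0r add0r.
  rewrite mul1r /edens /g.
  set a := uk k z.1 - U z.1 - (uk k z.2 - U z.2); set b := U z.1 - U z.2.
  have -> : uk k z.1 - uk k z.2 = a + b by rewrite /a /b; ring.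
  have -> : (a + b) ^+ 2 * J z - (1 - eps) * (a ^+ 2 * J z) + eps^-1 * (b ^+ 2 * J z) =
    (eps * (a + eps^-1 * b) ^+ 2 + b ^+ 2) * J z by field; rewrite gt_eqF.
  by rewrite mulr_ge0 ?riesz_ge0// addr_ge0 ?sqr_ge0// mulr_ge0 ?sqr_ge0// ltW.
pose c := (1 + eps^-1) * eR O U - delta.
have e'0 : 0 <= eps^-1 by rewrite invr_ge0 ltW.
have fU0 z : 0 <= (1 + eps^-1) * edens U z by rewrite mulr_ge0 ?energy_density_ge0// addr_ge0.
have H : (c%:E < \int[mu2]_(z in Tset O) ((1 + eps^-1) * edens U z)%:E)%E.
  rewrite ge0_integralZl_real ?addr_ge0//; last 2 first.
  - exact: mE.
  - exact: energy_density_ge0.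
  by rewrite -energyTE energyRE// -EFinM lte_fin /c gtrBl.
have [] := @fatou_eventually _ _ R _ (Tset O) f _ c%:E mT mf (fun k z _ => f0 k z) _ _ _ H.
- by apply: measurable_funM => //; exact: mE.
- by move=> z _.
- apply: filterS (ae_pairs cvU) => z [c1 c2] zO.
  rewrite mulrDl mul1r; apply: cvgD; last exact: cvg_cst.
  apply: indic_ev; first exact: T_ev.
  rewrite -[X in _ --> X]subr0; apply: cvgB; first exact: energy_density_cvg.
  rewrite -[X in _ --> X](mulr0 (1 - eps)); apply: cvgM; first exact: cvg_cst.
  have -> : 0 = edens (fun=> 0) z by rewrite /edens subrr expr0n/= mul0r.
  by apply: energy_density_cvg; exact: cvg0.
move=> N HN; exists N => k /HN {}HN.
have [_ _ Egk] := Hg k; have [_ _ Euk] := Hk k.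
have mIe u : measurable_fun setT u -> measurable_fun (Tset O) (fun z => I k z * edens u z).
  by move=> m_; apply: measurable_funM => //; exact: mE.
have I0 u z : 0 <= I k z * edens u z by rewrite mulr_ge0 ?energy_density_ge0.
have E1 : (\int[mu2]_(z in Tset O) (f k z + (1 - eps) * (I k z * edens (g k) z))%:E =
  \int[mu2]_(z in Tset O) (I k z * edens (uk k) z + eps^-1 * edens U z)%:E)%E.
  by apply: eq_integral => z _; congr EFin; rewrite /f; ring.
have ep0 : 0 <= 1 - eps by lra.
have mIg := mIe _ (mg k); have mIu := mIe _ (mk k); have mEU := @mE U (Tset O) mU.
have mIg' : measurable_fun (Tset O) (fun z => (1 - eps) * (I k z * edens (g k) z)) by exact: measurable_funM.
have mEU' : measurable_fun (Tset O) (fun z => eps^-1 * edens U z) by exact: measurable_funM.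
move: E1; rewrite (ge0_integralD_real _ mT (mf k) mIg'); last 2 first.
- by move=> z _; exact: f0.
- by move=> z _; rewrite mulr_ge0.
rewrite (ge0_integralZl_real _ mT ep0 mIg (I0 _)).
rewrite (ge0_integralD_real _ mT mIu mEU'); last 2 first.
- by move=> z _; exact: I0.
- by move=> z _; rewrite mulr_ge0 ?energy_density_ge0.
rewrite (ge0_integralZl_real _ mT e'0 mEU (energy_density_ge0 s U)).
have IE u : (EE (hspace (t k)) u < +oo)%E ->
    (\int[mu2]_(z in Tset O) (I k z * edens u z)%:E = (eR (hspace (t k)) u)%:E)%E.
  by move=> Eu; rewrite -energyRE//; exact: integral_indicM (T_sub (k := k)).
rewrite (IE _ Egk) (IE _ Euk) -energyTE (energyRE EU) -!EFinM -EFinD => E1.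
have : (c%:E + ((1 - eps) * eR (hspace (t k)) (g k))%:E <=
   (eR (hspace (t k)) (uk k) + eps^-1 * eR O U)%:E)%E.
  by rewrite -E1 leeD2r// ltW.
have := ek k; rewrite -EFinD lee_fin /c; move: (eR _ (uk k)) (eR _ (g k)) (eR O U) => x y z xx.
by set w := eps^-1; lra.
Qed.

(** The counterpart for the mass, in the opposite direction: the remainder carries at least what [U]
    misses. Fatou's lemma is applied to the nonnegative defect in [powR_split]. *)
Let mass_gap eps delta : 0 < eps -> 0 < delta -> exists N, forall k, (N <= k)%N ->
  mR (hspace (t k)) (uk k) - mR O U - delta <= (1 + eps) * mR (hspace (t k)) (g k).
Proof.
move=> e0 d0; have q0 : 0 < q by move: q1; lra.
have [mU' MU EU] := Hs_on_limit.
have [C C0 HC] := powR_split q0 e0.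
have C1 : 1 <= C.
  by have := HC 0 1; rewrite add0r normr0 normr1 powR1 powR0 ?gt_eqF// mulr0 add0r mulr1.
have mq (u : Rn R n -> R) (D : set (Rn R n)) : measurable_fun setT u -> measurable_fun D (fun x => `|u x| `^ q).
  by move=> m_; apply: measurable_funTS; exact: measurable_powR_norm.
pose I k := \1_(hspace (t k)) : Rn R n -> R.
have mI k : measurable_fun O (I k) by exact: measurable_indic.
pose f k x := I k x * ((1 + eps) * `|g k x| `^ q - `|uk k x| `^ q) + C * `|U x| `^ q.
have mf k : measurable_fun O (f k).
  apply: measurable_funD; last by apply: measurable_funM => //; exact: mq.
  apply: measurable_funM => //; apply: measurable_funB; last exact: mq.
  by apply: measurable_funM => //; exact: mq.
have f0 k x : 0 <= f k x.
  have U0 : 0 <= C * `|U x| `^ q by rewrite mulr_ge0 ?powR_ge0.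
  rewrite /f /I indicE; case: (x \in _); last by rewrite mul0r add0r.
  have := HC (g k x) (U x); rewrite mul1r {1}/g subrK; lra.
pose c := (C - 1) * mR O U - delta.
have C10 : 0 <= C - 1 by lra.
have H : (c%:E < \int[mu]_(x in O) ((C - 1) * `|U x| `^ q)%:E)%E.
  rewrite ge0_integralZl_real//; last exact: mq.
  by rewrite -/(MM O U) massRE// -EFinM lte_fin /c gtrBl.
have [] := @fatou_eventually _ _ R _ O f _ c%:E mO mf (fun k z _ => f0 k z) _ _ _ H.
- by apply: measurable_funM => //; exact: mq.
- by move=> x _; rewrite mulr_ge0 ?powR_ge0.
- apply: filterS cvU => x cx xO.
  rewrite (_ : (C - 1) * `|U x| `^ q = ((1 + eps) * `|0 : R| `^ q - `|U x| `^ q) + C * `|U x| `^ q); last first.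
    by rewrite normr0 powR0 ?gt_eqF//; ring.
  apply: cvgD; last exact: cvg_cst.
  apply: indic_ev; first exact: Ot.
  apply: cvgB; last exact: powR_norm_cvg.
  by apply: cvgM; [exact: cvg_cst|apply: powR_norm_cvg => //; exact: cvg0].
move=> N HN; exists N => k /HN {}HN.
have [_ Mgk _] := Hg k; have [_ Muk _] := Hk k.
have mIe (u : Rn R n -> R) : measurable_fun setT u -> measurable_fun O (fun x => I k x * `|u x| `^ q).
  by move=> m_; apply: measurable_funM => //; exact: mq.
have I0 (u : Rn R n -> R) x : 0 <= I k x * `|u x| `^ q by rewrite mulr_ge0 ?powR_ge0.
have E1 : (\int[mu]_(x in O) (f k x + I k x * `|uk k x| `^ q)%:E =
  \int[mu]_(x in O) ((1 + eps) * (I k x * `|g k x| `^ q) + C * `|U x| `^ q)%:E)%E.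
  by apply: eq_integral => z _; congr EFin; rewrite /f; ring.
have ep0 : 0 <= 1 + eps by lra.
have mIg := mIe _ (mg k); have mIu := mIe _ (mk k); have mUq := @mq U O mU.
have mIg' : measurable_fun O (fun x => (1 + eps) * (I k x * `|g k x| `^ q)) by exact: measurable_funM.
have mUq' : measurable_fun O (fun x => C * `|U x| `^ q) by exact: measurable_funM.
have U0 x : 0 <= `|U x| `^ q by exact: powR_ge0.
move: E1; rewrite (ge0_integralD_real _ mO (mf k) mIu); last 2 first.
- by move=> z _; exact: f0.
- by move=> z _; exact: I0.
rewrite (ge0_integralD_real _ mO mIg' mUq'); last 2 first.
- by move=> z _; rewrite mulr_ge0.
- by move=> z _; rewrite mulr_ge0 ?powR_ge0.
rewrite (ge0_integralZl_real _ mO ep0 mIg (I0 _)) (ge0_integralZl_real _ mO C0 mUq U0).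
have IE u : (MM (hspace (t k)) u < +oo)%E ->
    (\int[mu]_(x in O) (I k x * `|u x| `^ q)%:E = (mR (hspace (t k)) u)%:E)%E.
  by move=> Mu; rewrite -massRE//; exact: integral_indicM (tO (k := k)).
rewrite (IE _ Mgk) (IE _ Muk) -/(MM O U) (massRE MU) -!EFinM -EFinD => E1.
have : (c%:E + (mR (hspace (t k)) (uk k))%:E <=
   ((1 + eps) * mR (hspace (t k)) (g k) + C * mR O U)%:E)%E.
  by rewrite -E1 leeD2r// ltW.
rewrite -EFinD lee_fin /c; move: (mR _ (uk k)) (mR _ (g k)) (mR O U) => x y z.
lra.
Qed.

Hypothesis mk_lam : forall delta, 0 < delta -> exists N, forall k, (N <= k)%N ->
  lam - delta < mR (hspace (t k)) (uk k).

(** The remainder has energy [E] at most about [1 - e], hence mass at most about [lam * (1 - e)]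
    since [E^(q/2) <= E]; but the total mass tends to [lam]. *)
Let limit_mass_ge : 0 < eR O U -> lam * eR O U <= mR O U.
Proof.
set e := eR O U; set m := mR O U => e0; rewrite leNgt; apply/negP => H.
have e1 : e <= 1 by rewrite /e -lee_fin -energyRE ?limit_energy_le1//; have [] := Hs_on_limit.
have l0 : 0 <= lam := best_constant_ge0 hs0 n0 hns.
(* The first bound keeps the energy of the remainder in [[0, 1]]; the second keeps the accumulated
   error, [(2 + 5 * lam) * x], below the assumed deficit. *)
pose x := Num.min (e / 3) ((lam * e - m) / (2 * (2 + 5 * lam))).
have x0 : 0 < x by rewrite lt_min !divr_gt0//; lra.
have xe : 3 * x <= e by rewrite mulrC -ler_pdivlMr// ge_min lexx.
have xm : (2 + 5 * lam) * x <= (lam * e - m) / 2.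
  have : x <= (lam * e - m) / (2 * (2 + 5 * lam)) by rewrite ge_min lexx orbT.
  rewrite -(@ler_pM2l _ (2 + 5 * lam)); last lra.
  by move=> /le_trans; apply; rewrite le_eqVlt; apply/orP; left; apply/eqP; field; lra.
have x1 : x < 1 by lra.
have [N1 H1] := energy_gap x0 x1 x0; have [N2 H2] := mass_gap x0 x0.
have [N3 H3] := mk_lam x0.
pose k := maxn N1 (maxn N2 N3).
have {}H1 : (1 - x) * eR (hspace (t k)) (g k) <= 1 - e + x by apply: H1; rewrite leq_maxl.
have {}H2 : mR (hspace (t k)) (uk k) - m - x <= (1 + x) * mR (hspace (t k)) (g k).
  by apply: H2; rewrite /k maxnCA leq_maxl.
have {}H3 : lam - x < mR (hspace (t k)) (uk k) by apply: H3; rewrite /k maxnA leq_maxr.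
have H4 := best_constant_ineq hs0 n0 hns (Hg k).
have E0 := energyR_ge0 s (hspace (t k)) (g k).
move: H1 H2 H3 H4 E0; move: (eR _ (g k)) (mR _ (g k)) (mR _ (uk k)) => E M M' H1 H2 H3 H4 E0.
have E3 : E <= 1 - e + 3 * x.
  rewrite -(@ler_pM2l _ (1 - x)); last lra.
  by apply: (le_trans H1); nra.
have E1 : E `^ (q / 2) <= E by apply: powR_le_id; [apply/andP; split; lra|move: q2; lra].
have M1 : M <= lam * (1 - e + 3 * x).
  by apply: (le_trans H4); rewrite ler_wpM2l//; lra.
have : lam - x - m - x < (1 + x) * (lam * (1 - e + 3 * x)).
  apply: (@lt_le_trans _ _ ((1 + x) * M)); first lra.
  by rewrite ler_wpM2l//; lra.
have lx : lam * x * (1 - e + 3 * x) <= lam * x * 2.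
  by rewrite ler_wpM2l ?mulr_ge0//; [exact: ltW|lra].
have : (1 + x) * (lam * (1 - e + 3 * x)) = lam - lam * e + 3 * (lam * x) + lam * x * (1 - e + 3 * x) by ring.
move: xm lx H; rewrite mulrDl -mulrA; set lxx := lam * x; set le := lam * e; lra.
Qed.

(** Positive mass excludes [e = 0], and then [lam * e <= m <= lam * e^(q/2)] with [e <= 1] leaves
    only [e = 1]. *)
Theorem limit_maximizer : (forall u, Hs O u -> mR O u <= lam * eR O u `^ (q / 2)) ->
  0 < mR O U -> [/\ Hs O U, eR O U = 1 & mR O U = lam].
Proof.
move=> lamO m0; have HU := Hs_on_limit; have H := lamO _ HU.
have l0 : 0 < lam := best_constant_gt0 hs0 hs1 n0 hns.
have e1 : eR O U <= 1 by rewrite -lee_fin -energyRE ?limit_energy_le1//; have [] := HU.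
have e0 : 0 < eR O U.
  rewrite lt_neqAle energyR_ge0 andbT; apply/eqP => e0; move: H; rewrite -e0 powR0 ?mulr0.
    by rewrite leNgt m0.
  by rewrite gt_eqF//; move: q2; lra.
have lm := limit_mass_ge e0.
have E1 : eR O U = 1.
  apply/eqP; rewrite eq_le e1 /= leNgt; apply/negP => e1'.
  have : eR O U `^ (q / 2) < eR O U by apply: powR_lt_id; [rewrite e0|move: q2; lra].
  by rewrite -(ltr_pM2l l0) => /(le_lt_trans H)/(le_lt_trans lm); rewrite ltxx.
split => //; apply/le_anti; move: H lm; rewrite E1 powR1 !mulr1 => -> ->//.
Qed.

End Splitting.

(** * Concentration of near-maximizers and its normalization *)

Section Concentration.
Context (R : realType) (n : nat) (s : R).
Hypotheses (hs0 : 0 < s) (hs1 : s < 1) (n0 : (0 < n)%N) (hns : 2 * s < n%:R).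
Local Notation q := (@crit_exp R n s).
Local Notation mu := (lebesgue_Rn R n).
Local Notation EE := (@energyT R n s).
Local Notation MM := (@mass R n s).
Local Notation CC := (@average_const R n s).
Local Notation SobC := (@refined_sobolev_const R n s).
Local Notation Hs := (@Hs_on R n s).
Local Notation mR := (@massR R n s).
Local Notation eR := (@energyR R n s).
Local Notation lam := (@best_constant R n s).

Let q2 : 2 < q. Proof. exact: crit_exp_gt2. Qed.
Let q1 : 1 <= q. Proof. by move: q2; lra. Qed.
Let mH t : measurable (@hspace R n t). Proof. exact: measurable_half. Qed.
Let l0 : 0 < lam. Proof. exact: best_constant_gt0 hs0 hs1 n0 hns. Qed.

Let ltB_trans (a d d' m : R) : d <= d' -> a - d < m -> a - d' < m.
Proof. by move=> dd; apply: le_lt_trans; rewrite lerB. Qed.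

Let subset_integral_norm (A B : set (Rn R n)) (u : Rn R n -> R) : measurable A -> measurable B ->
  measurable_fun setT u -> A `<=` B ->
  (\int[mu]_(y in A) (`|u y|)%:E <= \int[mu]_(y in B) (`|u y|)%:E)%E.
Proof.
move=> mA mB mu_ AB; apply: ge0_subset_integral => //.
apply: measurable_funTS; apply/measurable_EFinP.
exact: measurableT_comp.
Qed.

Let mHC t (x : Rn R n) r : measurable (hspace t `&` cube x r).
Proof. by apply: measurableI; [exact: mH|exact: measurable_cube]. Qed.

Lemma nonvanishing : exists2 c : R, 0 < c & forall u, Hs (hspace 0) u -> eR (hspace 0) u <= 1 ->
  lam / 2 < mR (hspace 0) u -> exists x r, [/\ hspace 0 x, 0 < r &
    ((c * r `^ (n%:R - n%:R / q))%:E < \int[mu]_(y in hspace 0 `&` cube x r) (`|u y|)%:E)%E].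
Proof.
have CC1 : 0 < CC + 1 by have := CC_ge0 n s; lra.
(* Chosen so that the refined Sobolev constant equals [lam / 4]: with less concentration than this,
   energy at most [1] cannot carry the mass [lam / 2]. *)
pose c := (lam / (4 * (CC + 1) `^ q)) `^ (q - 2)^-1.
have a0 : 0 < lam / (4 * (CC + 1) `^ q) by rewrite divr_gt0// mulr_gt0// powR_gt0.
have c0 : 0 < c by exact: powR_gt0.
exists c => // u [mu_ Mu Eu] eu lu; apply: contrapT => H.
have : (MM (hspace 0) u <= (SobC c)%:E * \int[mu]_(x in hspace 0) (@inner_energy R n s (hspace 0) u x))%E.
  apply: sobolev_refined => //; first exact: fat_half.
  move=> x r Px r0; rewrite leNgt; apply/negP => cx; apply: H; exists x, r.
  by split.
have Sc : SobC c = lam / 4.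
  rewrite /refined_sobolev_const /c -powRrM mulVf; last by rewrite gt_eqF//; move: q2; lra.
  by rewrite powRr1 ?(ltW a0)//; field; rewrite gt_eqF// powR_gt0.
rewrite Sc; apply/negP; rewrite -ltNge (massRE Mu).
apply: (@le_lt_trans _ _ ((lam / 4)%:E * EE (hspace 0) u)%E).
  by rewrite lee_wpmul2l ?lee_fin ?divr_ge0 ?(ltW l0)//; exact: integral_inner_energy_le_energyT.
rewrite (energyRE Eu) -EFinM lte_fin; apply: le_lt_trans lu.
have : lam / 4 * eR (hspace 0) u <= lam / 4 * 1 by rewrite ler_wpM2l ?divr_ge0 ?(ltW l0).
by move: l0; lra.
Qed.

(** The tangential part of the center is moved to the origin, while the height [a] that becomes [0]
    is free. Taking [a = x_n] centers the cube and moves the boundary to level [- x_n / r]; taking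
    [a = 0] keeps the half space and leaves the center at height [x_n / r]. *)
Lemma renormalize (u : Rn R n -> R) (x : Rn R n) (r a c : R) : Hs (hspace 0) u -> (forall y, 0 <= u y) -> 0 < r ->
  ((c * r `^ (n%:R - n%:R / q))%:E < \int[mu]_(y in hspace 0 `&` cube x r) (`|u y|)%:E)%E ->
  exists v, [/\ Hs (hspace (a / r)) v, (forall y, 0 <= v y),
    eR (hspace (a / r)) v = eR (hspace 0) u, mR (hspace (a / r)) v = mR (hspace 0) u &
    (c%:E < \int[mu]_(y in hspace (a / r) `&` cube (origin R n) (`|nth 0 x n.-1 - a| / r + 1)%R)
      (`|v y|)%:E)%E].
Proof.
move=> [mu_ Mu Eu] u0 r0 cu.
pose h (i : 'I_n) := if val i == n.-1 then a else tnth x i.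
have hE : affine r h @^-1` (hspace 0) = hspace (a / r).
  by rewrite half_affine// /h /= eqxx add0r.
have ME := mass_dilate hs0 hns h r0 (mH 0) mu_; have E_ := energyT_dilate n0 hns h r0 (mH 0) mu_.
rewrite hE in ME E_.
exists (dilate s r h u); split.
- by split; [exact: measurable_dilate|rewrite ME|rewrite E_].
- by move=> y; rewrite mulr_ge0 ?powR_ge0.
- by rewrite /energyR E_.
- by rewrite /massR ME.
move: cu; rewrite (integral_cube_dilate s h x r0 (mH 0) mu_) hE mulrC EFinM.
rewrite lte_pmul2l ?lte_fin ?powR_gt0// => cu; apply: (lt_le_trans cu).
apply: (subset_integral_norm (mHC _ _ _) (mHC _ _ _)); first exact: measurable_dilate.
move=> y [Hy Qy]; split=> // i; have := Qy i; rewrite /origin tnth_nseq subr0 tnth_mktuple /h => H.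
rewrite (_ : tnth y i = (tnth y i - (r^-1 * tnth x i + - (if val i == n.-1 then a else tnth x i) / r))
  + (r^-1 * tnth x i + - (if val i == n.-1 then a else tnth x i) / r)); last by ring.
apply: (le_trans (ler_normD _ _)); rewrite addrC lerD//.
case: eqP => [iE|_].
  rewrite (_ : _ + _ = (tnth x i - a) / r); last by ring.
  by rewrite normrM (gtr0_norm (x := r^-1)) ?invr_gt0// (tnth_nth 0) iE.
rewrite mulNr mulrC subrr normr0 divr_ge0//; exact: ltW.
Qed.

Definition near_max (t rho c delta : R) (v : Rn R n -> R) :=
  [/\ Hs (hspace t) v, (forall y, 0 <= v y), eR (hspace t) v <= 1, lam - delta < mR (hspace t) v &
    (c%:E < \int[mu]_(y in hspace t `&` cube (origin R n) rho) (`|v y|)%:E)%E].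

(* The two cases: the heights of the concentration points, in units of the scale of
   concentration, remain bounded along a subsequence, or they tend to infinity. *)
Lemma concentration_dichotomy : exists2 c : R, 0 < c &
  (exists rho, forall delta, 0 < delta -> exists v, near_max 0 rho c delta v) \/
  (forall T delta, 0 < delta -> exists t v, T <= t /\ near_max t 1 c delta v).
Proof.
have [c c0 nv] := nonvanishing; exists c => //.
have near_u delta : 0 < delta -> exists u x r, [/\ Hs (hspace 0) u, (forall y, 0 <= u y),
    eR (hspace 0) u <= 1, lam - delta < mR (hspace 0) u & [/\ hspace 0 x, 0 < r &
    ((c * r `^ (n%:R - n%:R / q))%:E < \int[mu]_(y in hspace 0 `&` cube x r) (`|u y|)%:E)%E]].
  move=> d0; pose d := Num.min delta (lam / 2).
  have d'0 : 0 < d by rewrite lt_min d0 divr_gt0.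
  have [u [Hu eu lu]] := best_constant_sup_adherent hs0 n0 hns d'0.
  have Ha := Hs_on_abs (mH 0) Hu.
  have ea : eR (hspace 0) (fun x => `|u x|) <= 1.
    apply: le_trans eu; rewrite -lee_fin; have [mu_ _ Eu] := Hu; have [_ _ Ea] := Ha.
    by rewrite -!energyRE//; exact: energyT_abs_le.
  have ma : mR (hspace 0) (fun x => `|u x|) = mR (hspace 0) u by rewrite /massR mass_abs.
  have dd : d <= delta by rewrite ge_min lexx.
  have dl : d <= lam / 2 by rewrite ge_min lexx orbT.
  have la : lam / 2 < mR (hspace 0) (fun x => `|u x|) by rewrite ma; have := ltB_trans dl lu; rewrite {1}[X in X - _](splitr lam) addrK.
  have la' : lam - delta < mR (hspace 0) (fun x => `|u x|) by rewrite ma; exact: ltB_trans lu.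
  have [x [r H]] := nv _ Ha ea la.
  exists (fun x => `|u x|), x, r; exact: (And5 Ha (fun y => normr_ge0 (u y)) ea la' H).
have [HA|HA] := pselect (exists rho, forall delta, 0 < delta -> exists v, near_max 0 rho c delta v).
  by left.
right=> T delta d0.
(* The first alternative fails for the radius [|T| + 1]. A near-maximizer concentrating at height
   below [T * r] would contradict this after [renormalize] with height [0]. *)
have [d1 d10 Hd1] : exists2 d1 : R, 0 < d1 & forall v, ~ near_max 0 (`|T| + 1) c d1 v.
  apply: contrapT => H; apply: HA; exists (`|T| + 1) => d1 d10; apply: contrapT => Hd.
  by apply: H; exists d1 => // v Hv; apply: Hd; exists v.
have d'0 : 0 < Num.min delta d1 by rewrite lt_min d0.
have [u [x [r [Hu u0 eu lu [Hx r0 cu]]]]] := near_u _ d'0.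
have dd : Num.min delta d1 <= delta by rewrite ge_min lexx.
have dl : Num.min delta d1 <= d1 by rewrite ge_min lexx orbT.
have x0 : 0 <= nth 0 x n.-1 by move: Hx; rewrite /hspace/= oppr0.
exists (nth 0 x n.-1 / r).
have [v [Hv v0 ev mv cv]] := renormalize (nth 0 x n.-1) Hu u0 r0 cu.
have lv : lam - delta < mR (hspace (nth 0 x n.-1 / r)) v by rewrite mv; exact: ltB_trans lu.
have lw (t : R) w : mR (hspace t) w = mR (hspace 0) u -> lam - d1 < mR (hspace t) w.
  by move=> ->; exact: ltB_trans lu.
exists v; split; last first.
  rewrite subrr normr0 mul0r add0r in cv.
  have ev1 : eR (hspace (nth 0 x n.-1 / r)) v <= 1 by rewrite ev.
  exact: (And5 Hv v0 ev1 lv cv).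
rewrite leNgt; apply/negP => xT.
have [w [Hw w0 ew mw cw]] := renormalize 0 Hu u0 r0 cu.
rewrite mul0r in Hw ew mw cw; have ew1 : eR (hspace 0) w <= 1 by rewrite ew.
apply: (Hd1 w (And5 Hw w0 ew1 (lw _ _ mw) _)).
apply: (lt_le_trans cw); have [mw_ _ _] := Hw.
apply: (subset_integral_norm (mHC _ _ _) (mHC _ _ _) mw_).
move=> y [Hy Qy]; split; first exact: Hy.
move=> i; apply: (le_trans (Qy i)); rewrite lerD2r subr0 ger0_norm//.
by apply: (le_trans (ltW xT)); exact: ler_norm.
Qed.

End Concentration.

(** * Maximizers as limits of concentrated sequences *)

Section MaximizerFromConcentration.
Context (R : realType) (n : nat) (s : R).
Hypotheses (hs0 : 0 < s) (hs1 : s < 1) (n0 : (0 < n)%N) (hns : 2 * s < n%:R).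
Local Notation q := (@crit_exp R n s).
Local Notation mu := (lebesgue_Rn R n).
Local Notation MM := (@mass R n s).
Local Notation Hs := (@Hs_on R n s).
Local Notation mR := (@massR R n s).
Local Notation eR := (@energyR R n s).
Local Notation lam := (@best_constant R n s).
Local Notation near_max := (@near_max R n s).

Let q2 : 2 < q. Proof. exact: crit_exp_gt2. Qed.
Let q1 : 1 <= q. Proof. by move: q2; lra. Qed.
Let q0 : 0 < q. Proof. by move: q2; lra. Qed.
Let mH t : measurable (@hspace R n t). Proof. exact: measurable_half. Qed.
Let l0 : 0 < lam. Proof. exact: best_constant_gt0 hs0 hs1 n0 hns. Qed.

(** The upper limit is measurable whether or not the sequence converges, and agrees with the limit
    wherever there is one. *)
Definition lim_fun (f : nat -> Rn R n -> R) x : R := fine (limn_esup (fun j => (f j x)%:E)).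

Lemma measurable_lim_fun f : (forall j, measurable_fun setT (f j)) ->
  measurable_fun setT (lim_fun f).
Proof.
move=> mf; apply: (measurableT_comp (fine_measurable measurableT)).
apply: (measurable_fun_limn_esup (f := fun j x => (f j x)%:E)) => // j.
exact/measurable_EFinP.
Qed.

Lemma lim_fun_cvg f x : cvgn (fun j => f j x) -> f j x @[j --> \oo] --> lim_fun f x.
Proof.
move=> /cvg_ex[l fl]; rewrite /lim_fun.
have gx : (f j x)%:E @[j --> \oo] --> l%:E by apply: cvg_EFin; [exact: nearW|exact: fl].
by rewrite (cvg_limn_einf_sup gx).
Qed.

Lemma best_constant_mass_le t u : Hs (hspace t) u -> eR (hspace t) u <= 1 -> mR (hspace t) u <= lam.
Proof.
move=> Hu eu; apply: (le_trans (best_constant_ineq hs0 n0 hns Hu)).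
rewrite ler_piMr ?(ltW l0)//; apply: (@le_trans _ _ (1 `^ (q / 2))); last by rewrite powR1.
by apply: ge0_ler_powR; rewrite ?nnegrE ?energyR_ge0//; move: q1; lra.
Qed.

(** The half spaces [hspace k] exhaust the space: their energies are at most the full one, and the
    mass passes to the limit. *)
Lemma best_constant_ineq_full u : Hs setT u -> mR setT u <= lam * eR setT u `^ (q / 2).
Proof.
move=> [mu_ Mu Eu]; rewrite leNgt; apply/negP => H.
have mq D : measurable_fun D (fun x => `|u x| `^ q).
  by apply: measurable_funTS; exact: measurable_powR_norm.
have Hk k : Hs (hspace k%:R) u.
  split => //.
  - apply: le_lt_trans Mu; apply: ge0_subset_integral => //.
    exact/measurable_EFinP.
  - apply: le_lt_trans Eu; rewrite !energyTE; apply: ge0_subset_integral => //.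
    + exact: measurable_T_set.
    + exact: measurable_T_set.
    + by apply/measurable_EFinP; apply: measurable_funTS; exact: measurable_energy_density.
    + by move=> z _; rewrite lee_fin energy_density_ge0.
    + by move=> z _ [/(_ I)].
have ek k : eR (hspace k%:R) u <= eR setT u.
  have [_ _ Ek] := Hk k; rewrite -lee_fin -!energyRE// !energyTE; apply: ge0_subset_integral => //.
  + exact: measurable_T_set.
  + exact: measurable_T_set.
  + by apply/measurable_EFinP; apply: measurable_funTS; exact: measurable_energy_density.
  + by move=> z _; rewrite lee_fin energy_density_ge0.
  + by move=> z _ [/(_ I)].
have H' : ((lam * eR setT u `^ (q / 2))%:E < MM setT u)%E by rewrite massRE// lte_fin.
have [] := @fatou_eventually _ _ R mu setT
  (fun k x => \1_(hspace k%:R) x * `|u x| `^ q) (fun x => `|u x| `^ q) _ measurableT _ _ _ _ _ H'.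
- by move=> k; apply: measurable_funM; [exact: measurable_indic|exact: mq].
- by move=> k x _; rewrite mulr_ge0 ?powR_ge0.
- exact: mq.
- by move=> x _; rewrite powR_ge0.
- apply: aeW => x _.
  have : (fun=> `|u x| `^ q) @ \oo --> `|u x| `^ q by exact: cvg_cst.
  apply: cvg_trans; apply: near_eq_cvg.
  exists (Num.truncn `|nth 0 x n.-1|).+1 => // k /= Nk.
  rewrite indicE mem_set ?mul1r// /hspace/=.
  have h1 := ler_norm (- nth 0 x n.-1); rewrite normrN in h1.
  rewrite lerNl; apply: (le_trans h1); apply: ltW; apply: (lt_le_trans (truncnS_gt _)).
  by rewrite ler_nat.
move=> N /(_ N (leqnn _)); rewrite integral_indicM//; apply/negP; rewrite -leNgt.
have [_ MN _] := Hk N; rewrite -/(MM (hspace N%:R) u) massRE// lee_fin.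
apply: (le_trans (best_constant_ineq hs0 n0 hns (Hk N))).
apply: ler_wpM2l (ltW l0) _ _ _; apply: ge0_ler_powR.
- by rewrite divr_ge0// ltW.
- by rewrite nnegrE energyR_ge0.
- by rewrite nnegrE energyR_ge0.
- exact: ek.
Qed.

Section MassPersists.
Variables (O : set (Rn R n)) (t : nat -> R) (uk : nat -> Rn R n -> R) (U : Rn R n -> R).
Variables (c rho : R).
Hypothesis mO : measurable O.
Hypothesis tO : forall k, hspace (t k) `<=` O.
Hypothesis Ot : forall x, O x -> exists N, forall k, (N <= k)%N -> hspace (t k) x.
Hypothesis mU : measurable_fun setT U.
Hypothesis Hk : forall k, Hs (hspace (t k)) (uk k).
Hypothesis ek : forall k, eR (hspace (t k)) (uk k) <= 1.
Hypothesis cvU : {ae mu, forall x, uk k x @[k --> \oo] --> U x}.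
Hypothesis c0 : 0 < c.
Hypothesis ck : forall k,
  (c%:E < \int[mu]_(y in hspace (t k) `&` cube (origin R n) rho) (`|uk k y|)%:E)%E.

Let Q := cube (origin R n) rho.
Let mQ : measurable Q. Proof. exact: measurable_cube. Qed.
Let D := O `&` Q.
Let mD : measurable D. Proof. exact: measurableI. Qed.
Let E k := hspace (t k) `&` Q.
Let mE_ k : measurable (E k). Proof. exact: measurableI. Qed.

Let rho0 : 0 <= rho.
Proof.
rewrite leNgt; apply/negP => r0; have := ck 0%N.
rewrite (_ : _ `&` _ = set0) ?integral_set0; first by rewrite lte_fin ltNge ltW.
apply/seteqP; split => // y [_ /(_ (Ordinal n0))] /(le_trans (normr_ge0 _)).
by rewrite leNgt r0.
Qed.

Let Qfin (A : set (Rn R n)) : measurable A -> A `<=` Q -> exists m : R, mu A = m%:E.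
Proof.
move=> mA AQ; have : (mu A < +oo)%E.
  apply: (@le_lt_trans _ _ (mu Q)); last by rewrite lebesgue_cube// ltry.
  by apply: le_measure; rewrite ?inE.
by move=> Afin; exists (fine (mu A)); rewrite fineK// ge0_fin_numE.
Qed.

(* Interleaving with zero functions reduces the passage to the limit to the mere
   convergence of the integrals. *)
Let f k x : R := if odd k then 0 else \1_(E k./2) x * `|uk k./2 x|.

(** If [U] had no mass it would vanish almost everywhere on [O], and the L^q bound would force the
    integrals over the fixed cube to tend to [0], against [ck]. *)
Lemma limit_mass_gt0 : 0 < mR O U.
Proof.
have HU := Hs_on_limit hs0 n0 hns mO tO Ot mU Hk ek cvU.
have [_ MU _] := HU.
rewrite lt_neqAle massR_ge0 andbT; apply/eqP => m0.
have mk k : measurable_fun setT (uk k) by have [] := Hk k.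
have mq (u : Rn R n -> R) (A : set (Rn R n)) : measurable_fun setT u -> measurable_fun A (fun x => `|u x| `^ q).
  by move=> m_; apply: measurable_funTS; exact: measurable_powR_norm.
have U0 : {ae mu, forall x, O x -> U x = 0}.
  have : (\int[mu]_(x in O) `|(`|U x| `^ q)%:E| = 0)%E.
    rewrite (eq_integral (fun x => (`|U x| `^ q)%:E)); last first.
      by move=> x _; rewrite /= ger0_norm// powR_ge0.
    by rewrite -/(MM O U) massRE// -m0.
  have mUE : measurable_fun O (EFin \o (fun x => `|U x| `^ q)) by apply/measurable_EFinP; exact: mq.
  move/(ae_eq_integral_abs mu mO mUE); apply: filterS => x H Ox.
  by have [] := H Ox => /powR_eq0_eq0/normr0_eq0.
have mf k : measurable_fun D (f k).
  rewrite /f; case: odd; first exact: measurable_cst.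
  apply: measurable_funM; first exact: measurable_indic.
  by apply: measurable_funTS; exact: measurableT_comp.
have f0 k x : 0 <= f k x by rewrite /f; case: odd => //; rewrite mulr_ge0.
have ml1 : 1 < q by move: q2; lra.
have m1 : measurable_fun D (fun=> 1 : R) by exact: measurable_cst.
have [mDv mDE] := Qfin mD (@subIsetr _ _ _).
have i1 : mu.-integrable D (EFin \o (fun=> 1)).
  apply/integrableP; split; first exact/measurable_EFinP.
  rewrite (eq_integral (fun=> 1%:E)); last by move=> x _; rewrite /= normr1.
  by rewrite integral_cst// mul1e [X in (X < _)%E](mDE : mu D = _) ltry.
have fB k : (\int[mu]_(x in D) (f k x `^ q * 1)%:E <= lam%:E)%E.
  rewrite /f; case: odd.
    rewrite integral0_eq ?lee_fin ?(ltW l0)// => x _.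
    by rewrite powR0 ?mul0r// gt_eqF.
  apply: (@le_trans _ _ (\int[mu]_(x in D) (\1_(E k./2) x * `|uk k./2 x| `^ q)%:E)%E).
    rewrite le_eqVlt; apply/orP; left; apply/eqP; apply: eq_integral => x _; congr EFin.
    rewrite mulr1 indicE; case: (x \in _); rewrite ?mul1r// !mul0r powR0//.
    by rewrite gt_eqF.
  have [_ Mk _] := Hk k./2.
  rewrite integral_indicM; last by move=> x [/tO].
  apply: (@le_trans _ _ (MM (hspace (t k./2)) (uk k./2))).
    apply: ge0_subset_integral; [exact: mE_|exact: mH| | |exact: subIsetl].
      by apply/measurable_EFinP; exact: mq.
    by move=> x _; rewrite lee_fin powR_ge0.
  by rewrite massRE// lee_fin; exact: best_constant_mass_le.
have cvf : {ae mu, forall x, D x -> f k x @[k --> \oo] --> (0 : R)}.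
  apply: filterS2 cvU U0 => x cx Ux [Ox _]; rewrite (Ux Ox) in cx.
  apply/cvgrPdist_lt => e e0; have /cvgrPdist_lt/(_ _ e0)[N _ HN] := cx.
  exists N.*2 => // k /= Nk; rewrite sub0r normrN /f; case: odd; first by rewrite normr0.
  have Nk2 : (N <= k./2)%N by rewrite -(doubleK N) half_leq.
  have := HN _ Nk2; rewrite /= sub0r normrN; apply: le_lt_trans.
  by rewrite normrM normr_id indicE; case: (_ \in _); rewrite ?normr1 ?mul1r// normr0 mul0r.
have /cvg_ex[l cvl] := @vitali_weighted _ _ _ mu D (fun=> 1) (fun=> 0) f q lam mD ml1 m1
  (fun _ _ => ler01) i1 mf f0 (measurable_cst _) fB cvf.
have c20 : 0 < c / 2 by rewrite divr_gt0.
(* Two consecutive integrals lie within [c / 2] of the limit, yet the odd one is [0] and the even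
   one exceeds [c]. *)
have /cvgrPdist_lt/(_ _ c20)[N _ HN] := cvl.
have H1 := HN N.*2.+1; have H2 := HN N.*2.
rewrite /= -addnn leq_addl in H2; rewrite /= -addnn -addnS leq_addr in H1.
have {}H1 := H1 isT; have {}H2 := H2 isT.
have I1 : \int[mu]_(x in D) (f (N + N.+1)%N x * 1) = 0.
  rewrite /Rintegral integral0_eq// => x _.
  by rewrite /f addnS addnn /= odd_double/= mul0r.
have I2 : c < \int[mu]_(x in D) (f (N + N)%N x * 1).
  have E1 : (\int[mu]_(x in D) (f (N + N)%N x * 1)%:E =
      \int[mu]_(y in E N) (`|uk N y|)%:E)%E.
    have ED : E N `<=` D by move=> x [/tO Ox Qx]; split.
    rewrite -(integral_indicM mu (fun y => `|uk N y|) ED).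
    by apply: eq_integral => x _; rewrite /f addnn odd_double doubleK mulr1.
  rewrite /Rintegral E1 -lte_fin fineK; first exact: ck.
  have [m Em] := Qfin (mE_ N) (@subIsetr _ _ _).
  have [mN MN _] := Hk N.
  have MB : (MM (hspace (t N)) (uk N) <= (mR (hspace (t N)) (uk N))%:E)%E by rewrite massRE.
  have [iu _] := integrable_loc hs0 hns (mE_ N) (mH (t N)) (@subIsetl _ _ _) mN Em MB.
  have := integrable_fin_num (mE_ N) (integrable_abse iu).
  by [].
move: H1 H2; rewrite I1 !ltr_norml => /andP[a1 a2] /andP[b1 b2].
by move: I2 a1 a2 b1 b2; set X := Rintegral _ _ _; lra.
Qed.

End MassPersists.

Lemma inv_succ_small delta : 0 < delta -> exists N, forall k, (N <= k)%N -> k.+1%:R^-1 < delta :> R.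
Proof.
move=> d0; exists (Num.truncn delta^-1) => k Nk.
rewrite -[ltRHS]invrK ltf_pV2 ?posrE ?invr_gt0//.
by apply: (lt_le_trans (truncnS_gt _)); rewrite ler_nat ltnS.
Qed.

Let inner_energy_le t v : Hs (hspace t) v -> eR (hspace t) v <= 1 ->
  (\int[mu]_(x in hspace t) @inner_energy R n s (hspace t) v x <= 1%:E)%E.
Proof.
move=> [mv Mv Ev] ev; apply: (le_trans (integral_inner_energy_le_energyT s (mH t) mv)).
by rewrite energyRE// lee_fin.
Qed.

Lemma bounded_maximizer rho c : 0 < c ->
  (forall delta, 0 < delta -> exists v, near_max 0 rho c delta v) ->
  exists U, [/\ Hs (hspace 0) U, eR (hspace 0) U = 1 & mR (hspace 0) U = lam].
Proof.
move=> c0 H.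
have H1 (k : nat) : exists v, near_max 0 rho c k.+1%:R^-1 v by apply: H; rewrite invr_gt0.
have [v Hv] := choice H1.
have Hvk k : Hs (hspace 0) (v k) by have [] := Hv k.
have v0 k x : 0 <= v k x by have [_ + _ _ _] := Hv k; apply.
have ev k : eR (hspace 0) (v k) <= 1 by have [] := Hv k.
have mv k : measurable_fun setT (v k) by have [] := Hvk k.
have Mv k : (MM (hspace 0) (v k) < +oo)%E by have [] := Hvk k.
have lv k : lam - k.+1%:R^-1 < mR (hspace 0) (v k) by have [] := Hv k.
have cv k : (c%:E < \int[mu]_(y in hspace 0 `&` cube (origin R n) rho) (`|v k y|)%:E)%E by have [] := Hv k.
pose B := Num.max lam 1.
have MB k : (MM (hspace 0) (v k) <= B%:E)%E.
  by rewrite massRE// lee_fin le_max best_constant_mass_le.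
have DB k : (\int[mu]_(x in hspace 0) @inner_energy R n s (hspace 0) (v k) x <= B%:E)%E.
  by apply: (le_trans (inner_energy_le (Hvk k) (ev k))); rewrite lee_fin le_max lexx orbT.
have [sigma [sj cvs]] := subsequence_ae hs0 n0 hns (fun=> mH 0) mv MB DB.
(* [subsequence_ae] asks for a neighborhood inside the half space, so the boundary hyperplane is
   discarded. *)
have bnd : {ae mu, forall x : Rn R n, nth 0 x n.-1 <> 0}.
  exists [set x : Rn R n | nth 0 x n.-1 = 0]; split; last by move=> x /= /contrapT.
    rewrite (_ : [set _ | _] = (fun x : Rn R n => nth 0 x n.-1 : R) @^-1` [set 0])//.
    by rewrite -[X in measurable X]setTI; apply: measurable_nth.
  exact: hyperplane_null.
have cvO : {ae mu, forall x, hspace 0 x -> cvgn (fun j => v (sigma j) x)}.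
  apply: filterS2 cvs bnd => x cx x0 Ox; apply: cx.
  have xp : 0 < nth 0 x n.-1.
    by rewrite lt_neqAle eq_sym; move/eqP: x0 => ->/=; move: Ox; rewrite /hspace/= oppr0.
  exists (nth 0 x n.-1); split => //; exists 0%N => k _ y Qy.
  have ln : (n.-1 < n)%N by rewrite prednK.
  have := Qy (Ordinal ln); rewrite /hspace/= oppr0 !(tnth_nth 0)/= ler_norml => /andP[h1 _].
  by lra.
pose U0 := lim_fun (fun j => v (sigma j)).
have mU0 : measurable_fun setT U0 by exact: measurable_lim_fun.
have cvU0 : {ae mu, forall x, hspace 0 x -> v (sigma k) x @[k --> \oo] --> U0 x}.
  by apply: filterS cvO => x H' Ox; apply: lim_fun_cvg; exact: H'.
(* The extension changes nothing on the half space and does not raise the energy, so the sequence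
   remains maximizing and concentrated. *)
pose w j := ext s (v (sigma j)).
have mw j : measurable_fun setT (w j) by exact: measurable_ext.
pose U := lim_fun w.
have mU : measurable_fun setT U by exact: measurable_lim_fun.
have cvU : {ae mu, forall x, w k x @[k --> \oo] --> U x}.
  apply: filterS cvO => x H'; apply: lim_fun_cvg.
  have [Ox|Ox] := pselect (hspace 0 x).
    rewrite (_ : (fun j => w j x) = (fun j => v (sigma j) x)); first exact: H'.
    by apply/funext => j; rewrite /w /ext mem_set.
  have mvs k := mv (sigma k); have v0s k := v0 (sigma k); have MBs k := MB (sigma k).
  exact: (ext_cvg hs0 hs1 n0 hns mvs v0s mU0 MBs cvU0 Ox).
have Hw j : Hs (hspace 0) (w j) by exact: Hs_on_ext.
have ew j : eR (hspace 0) (w j) <= 1.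
  apply: le_trans (ev (sigma j)); have [_ _ E1] := Hw j; have [_ _ E2] := Hvk (sigma j).
  by rewrite -lee_fin -!energyRE//; exact: energyT_ext_le.
have mwv j : mR (hspace 0) (w j) = mR (hspace 0) (v (sigma j)) by rewrite /massR mass_ext.
have mlim delta : 0 < delta -> exists N, forall k, (N <= k)%N -> lam - delta < mR (hspace 0) (w k).
  move=> /inv_succ_small[N HN]; exists N => k Nk; rewrite mwv; apply: lt_trans (lv (sigma k)).
  by rewrite ltrD2l ltrN2; apply: HN; exact: leq_trans (sj k).
have cw k : (c%:E < \int[mu]_(y in hspace 0 `&` cube (origin R n) rho) (`|w k y|)%:E)%E.
  apply: (lt_le_trans (cv (sigma k))); rewrite le_eqVlt; apply/orP; left; apply/eqP.
  by apply: eq_integral => x /[!inE] -[Ox _]; rewrite /w /ext mem_set.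
have O0 (x : Rn R n) : hspace 0 x -> exists N, forall k, (N <= k)%N -> hspace 0 x by exists 0%N.
have m0 := limit_mass_gt0 (mH 0) (fun=> @subset_refl _ (hspace 0)) O0 mU Hw ew cvU c0 cw.
exists U.
exact: (limit_maximizer hs0 hs1 n0 hns (mH 0) (fun=> @subset_refl _ (hspace 0)) O0 mU Hw ew cvU mlim
  (fun u => best_constant_ineq hs0 n0 hns (t := 0) (u := u)) m0).
Qed.

(** Every point eventually has the cube of radius [1] around it inside [hspace (t k)], so
    [subsequence_ae] gives convergence almost everywhere in the whole space. *)
Lemma escaping_maximizer rho c : 0 < c ->
  (forall T delta, 0 < delta -> exists t v, T <= t /\ near_max t rho c delta v) ->
  exists U, [/\ Hs setT U, eR setT U = 1 & mR setT U = lam].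
Proof.
move=> c0 H.
have H1 (k : nat) : exists tv : R * (Rn R n -> R), k%:R <= tv.1 /\ near_max tv.1 rho c k.+1%:R^-1 tv.2.
  have k0 : 0 < k.+1%:R^-1 :> R by rewrite invr_gt0.
  by have [t [v tv]] := H k%:R _ k0; exists (t, v).
have [tv Htv] := choice H1.
pose t k := (tv k).1; pose v k := (tv k).2.
have tk k : k%:R <= t k by have [] := Htv k.
have Hv k : near_max (t k) rho c k.+1%:R^-1 (v k) by have [] := Htv k.
have Hvk k : Hs (hspace (t k)) (v k) by have [] := Hv k.
have ev k : eR (hspace (t k)) (v k) <= 1 by have [] := Hv k.
have mv k : measurable_fun setT (v k) by have [] := Hvk k.
have Mv k : (MM (hspace (t k)) (v k) < +oo)%E by have [] := Hvk k.
have lv k : lam - k.+1%:R^-1 < mR (hspace (t k)) (v k) by have [] := Hv k.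
have cv k : (c%:E < \int[mu]_(y in hspace (t k) `&` cube (origin R n) rho) (`|v k y|)%:E)%E by have [] := Hv k.
pose B := Num.max lam 1.
have MB k : (MM (hspace (t k)) (v k) <= B%:E)%E.
  by rewrite massRE// lee_fin le_max best_constant_mass_le.
have DB k : (\int[mu]_(x in hspace (t k)) @inner_energy R n s (hspace (t k)) (v k) x <= B%:E)%E.
  by apply: (le_trans (inner_energy_le (Hvk k) (ev k))); rewrite lee_fin le_max lexx orbT.
have [sigma [sj cvs]] := subsequence_ae hs0 n0 hns (fun k => mH (t k)) mv MB DB.
have big (a : R) : exists N, forall k, (N <= k)%N -> a <= t k.
  exists (Num.truncn a).+1 => k Nk; apply: le_trans (tk k); apply: ltW.
  by apply: (lt_le_trans (truncnS_gt _)); rewrite ler_nat.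
pose U := lim_fun (fun j => v (sigma j)).
have mU : measurable_fun setT U by exact: measurable_lim_fun.
have cvU : {ae mu, forall x, v (sigma k) x @[k --> \oo] --> U x}.
  apply: filterS cvs => x H'; apply: lim_fun_cvg; apply: H'.
  exists 1; split => //; have [N HN] := big (1 - nth 0 x n.-1); exists N => k /HN tk1 y Qy.
  have ln : (n.-1 < n)%N by rewrite prednK.
  have := Qy (Ordinal ln); rewrite /hspace/= !(tnth_nth 0)/= ler_norml => /andP[h1 _].
  by lra.
have mlim delta : 0 < delta -> exists N, forall k, (N <= k)%N ->
    lam - delta < mR (hspace (t (sigma k))) (v (sigma k)).
  move=> /inv_succ_small[N HN]; exists N => k Nk; apply: lt_trans (lv (sigma k)).
  by rewrite ltrD2l ltrN2; apply: HN; exact: leq_trans (sj k).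
have OT (x : Rn R n) : [set: Rn R n] x -> exists N, forall k, (N <= k)%N -> hspace (t (sigma k)) x.
  move=> _; have [N HN] := big (- nth 0 x n.-1); exists N => k Nk.
  by rewrite /hspace/= lerNl; apply: HN; exact: leq_trans (sj k).
have m0 := limit_mass_gt0 measurableT (fun k => @subsetT _ (hspace (t (sigma k)))) OT mU
  (fun k => Hvk (sigma k)) (fun k => ev (sigma k)) cvU c0 (fun k => cv (sigma k)).
exists U.
exact: (limit_maximizer hs0 hs1 n0 hns measurableT (fun k => @subsetT _ (hspace (t (sigma k)))) OT mU
  (fun k => Hvk (sigma k)) (fun k => ev (sigma k)) cvU mlim best_constant_ineq_full m0).
Qed.

End MaximizerFromConcentration.

(** * No maximizer on the whole space attains the constant of the half space *)

Section NoEscape.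
Context (R : realType) (n : nat) (s : R).
Hypotheses (hs0 : 0 < s) (hs1 : s < 1) (n0 : (0 < n)%N) (hns : 2 * s < n%:R).
Local Notation q := (@crit_exp R n s).
Local Notation mu := (lebesgue_Rn R n).
Local Notation mu2 := (lebesgue_RnRn R n).
Local Notation EE := (@energyT R n s).
Local Notation MM := (@mass R n s).
Local Notation edens := (@energy_density R n s).
Local Notation Hs := (@Hs_on R n s).
Local Notation mR := (@massR R n s).
Local Notation eR := (@energyR R n s).
Local Notation lam := (@best_constant R n s).
Local Notation SobK := (@sobolev_const R n s).
Local Notation Tset := (@T_set R n).

Let q2 : 2 < q. Proof. exact: crit_exp_gt2. Qed.
Let mH t : measurable (@hspace R n t). Proof. exact: measurable_half. Qed.
Let mHC t : measurable (~` @hspace R n t). Proof. exact: measurableC. Qed.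
Let l0 : 0 < lam. Proof. exact: best_constant_gt0 hs0 hs1 n0 hns. Qed.

Variable U : Rn R n -> R.
Hypothesis HU : Hs setT U.
Hypothesis eU : eR setT U = 1.
Hypothesis mU1 : mR setT U = lam.

Let mU : measurable_fun setT U. Proof. by have [] := HU. Qed.

Let mE (D : set (Rn R n * Rn R n)) : measurable_fun D (fun z => (edens U z)%:E).
Proof.
apply: measurable_funTS; apply/measurable_EFinP.
exact: measurable_energy_density.
Qed.

Let e0 z : (0 <= (edens U z)%:E)%E. Proof. by rewrite lee_fin energy_density_ge0. Qed.

Let energy_lsc (S : set (Rn R n * Rn R n)) (Sk : nat -> set (Rn R n * Rn R n)) (c : \bar R) :
  measurable S -> (forall k, measurable (Sk k)) ->
  {ae mu2, forall z, S z -> exists N, forall k, (N <= k)%N -> Sk k z} ->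
  (c < \int[mu2]_(z in S) (edens U z)%:E)%E ->
  exists N, (c < \int[mu2]_(z in Sk N) (edens U z)%:E)%E.
Proof.
move=> mS mk SSk cS.
have [] := @fatou_eventually _ _ R _ S (fun k z => \1_(Sk k `&` S) z * edens U z) (edens U) c
  mS _ _ _ _ _ cS.
- move=> k; apply: measurable_funM; first by apply: measurable_indic; exact: measurableI.
  by apply/measurable_EFinP; exact: mE.
- by move=> k z _; rewrite mulr_ge0 ?energy_density_ge0.
- by apply/measurable_EFinP; exact: mE.
- by move=> z _; exact: energy_density_ge0.
- apply: filterS SSk => z H Sz; have [N HN] := H Sz.
  have : (fun=> edens U z) @ \oo --> edens U z by exact: cvg_cst.
  apply: cvg_trans; apply: near_eq_cvg.
  by exists N => // k /= Nk; rewrite indicE mem_set ?mul1r//; split => //; exact: HN.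
move=> N /(_ N (leqnn _)); rewrite (integral_indicM _ (edens U) (@subIsetr _ (Sk N) S)) => cN.
exists N; apply: (lt_le_trans cN); apply: ge0_subset_integral.
- exact: measurableI.
- exact: mk.
- exact: mE.
- by move=> z _; exact: e0.
- exact: subIsetl.
Qed.

Let F t : \bar R :=
  (\int[mu2]_(z in (~` hspace t) `*` (~` hspace t)) (edens U z)%:E)%E.

Let EE1 : EE setT U = 1%:E.
Proof. by have [_ _ Eu] := HU; rewrite energyRE// eU. Qed.

Let TsetT : Tset setT = setT.
Proof. by apply/seteqP; split => // z _ [/(_ I)]. Qed.

Let energy_split t : 1%:E = (EE (hspace t) U + F t)%E.
Proof.
rewrite -EE1 !energyTE /F.
have TU : Tset setT = Tset (hspace t) `|` ((~` hspace t) `*` (~` hspace t)).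
  by rewrite TsetT /T_set setUC setUv.
rewrite {1}TU; apply: ge0_integral_setU.
- exact: measurable_T_set.
- exact: measurableX.
- exact: mE.
- by move=> z _; exact: e0.
- by apply/disj_setPLR => z; rewrite /T_set.
Qed.

Let EEfin t : (EE (hspace t) U < +oo)%E.
Proof.
apply: (@le_lt_trans _ _ 1%:E); last exact: ltry.
by rewrite (energy_split t) leeDl//; apply: integral_ge0 => z _; exact: e0.
Qed.

Let e t : R := eR (hspace t) U.

Let FE t : F t = (1 - e t)%:E.
Proof.
have := energy_split t; rewrite (energyRE (EEfin t)) -/(e t).
have : (0 <= F t)%E by apply: integral_ge0 => z _; exact: e0.
case: (F t) => [f _| |]//; rewrite -EFinD => -[] ->.
by rewrite addrC addKr.
Qed.

Let e_le1 t : e t <= 1.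
Proof.
rewrite -subr_ge0 -lee_fin -FE; apply: integral_ge0 => z _; exact: e0.
Qed.

Let Hst t : Hs (hspace t) U.
Proof.
have [_ Mu _] := HU; split => //.
apply: le_lt_trans Mu; apply: ge0_subset_integral => //.
by apply/measurable_EFinP; exact: measurable_powR_norm.
Qed.

Let e_mono t t' : t <= t' -> e t <= e t'.
Proof.
move=> tt; rewrite -lee_fin -!energyRE// !energyTE; apply: ge0_subset_integral.
- exact: measurable_T_set.
- exact: measurable_T_set.
- exact: mE.
- by move=> z _; exact: e0.
- by move=> z zt [/= z1 z2]; apply: zt; split => /= H; [apply: z1|apply: z2];
    move: H; rewrite /hspace/=; apply: le_trans; rewrite lerN2.
Qed.

Let mass_split t : lam%:E = (MM (hspace t) U + MM (~` hspace t) U)%E.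
Proof.
have [_ Mu _] := HU; rewrite -mU1 -massRE// -[in LHS](setUv (hspace t)).
apply: ge0_integral_setU => //.
- by apply: measurable_funTS; apply/measurable_EFinP; exact: measurable_powR_norm.
- by apply/disj_setPLR => z Hz /(_ Hz).
Qed.

(** The mass above the level is at most [lam * e^(q/2) <= lam * e], the mass below it is bounded by
    the Sobolev inequality on the lower half space, and the two add up to [lam]. *)
Let gap t : lam * (1 - e t) <= SobK * (1 - e t) `^ (q / 2).
Proof.
have et0 : 0 <= e t := energyR_ge0 s (hspace t) U.
have Mt : mR (hspace t) U <= lam * e t.
  apply: (le_trans (best_constant_ineq hs0 n0 hns (Hst t))); apply: ler_wpM2l; first exact: ltW.
  by apply: powR_le_id; [rewrite et0 e_le1|move: q2; lra].
have MC : (MM (~` hspace t) U < +oo)%E.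
  have [_ Mu _] := HU.
  apply: le_lt_trans Mu; apply: ge0_subset_integral => //.
  by apply/measurable_EFinP; exact: measurable_powR_norm.
have : (MM (~` hspace t) U <= (SobK * (1 - e t) `^ (q / 2))%:E)%E.
  apply: sobolev => //; first exact: fat_lower_half.
  by rewrite integral_inner_energy// -/(F t) FE.
have [_ Mh _] := Hst t.
have := mass_split t; rewrite (massRE MC) (massRE Mh) -EFinD => -[] lE.
rewrite lee_fin; apply: le_trans.
by rewrite mulrBr mulr1 lerBlDr [leLHS]lE addrC lerD2l.
Qed.

(** For an energy [f < kappa] the factor [SobK * f^(q/2 - 1)] is at most [lam / 2], which is
    incompatible with [gap]. *)
Let kappa : R := (lam / (2 * (SobK + 1))) `^ (q / 2 - 1)^-1.
Let SobK0 : 0 <= SobK. Proof. exact: powR_ge0. Qed.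
Let q21 : 0 < q / 2 - 1. Proof. by move: q2; lra. Qed.
Let kb : 0 < lam / (2 * (SobK + 1)).
Proof. by rewrite divr_gt0// mulr_gt0// ltr_wpDl. Qed.
Let kappa0 : 0 < kappa. Proof. exact: powR_gt0. Qed.

(* Maximality of [U] on the half space is played against Sobolev's inequality on its
   complement: the exponent [q / 2 > 1] excludes small nonzero energies. *)
Let quantum t : e t < 1 -> kappa <= 1 - e t.
Proof.
move=> et; rewrite leNgt; apply/negP; set f := 1 - e t => fk.
have f0 : 0 < f by rewrite subr_gt0.
have G := gap t; rewrite -/f in G.
have fE : f `^ (q / 2) = f `^ (q / 2 - 1) * f.
  by rewrite -[X in _ = _ * X](powRr1 (ltW f0)) -powRD ?(gt_eqF f0) ?implybT// subrK.
rewrite fE mulrA ler_pM2r// in G.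
have H : f `^ (q / 2 - 1) <= lam / (2 * (SobK + 1)).
  have -> : lam / (2 * (SobK + 1)) = kappa `^ (q / 2 - 1).
    by rewrite /kappa -powRrM mulVf ?(gt_eqF q21)// powRr1// ltW.
  by apply: ge0_ler_powR; rewrite ?nnegrE ?(ltW f0) ?(ltW kappa0) ?(ltW q21) ?(ltW fk).
have H2 : SobK * f `^ (q / 2 - 1) <= SobK * (lam / (2 * (SobK + 1))) by rewrite ler_wpM2l.
have : SobK * (lam / (2 * (SobK + 1))) <= lam / 2.
  rewrite (_ : SobK * (lam / (2 * (SobK + 1))) = lam / 2 * (SobK / (SobK + 1))); last first.
    by field; rewrite gt_eqF// ltr_wpDl.
  rewrite ler_piMr ?divr_ge0 ?(ltW l0)// ler_pdivrMr ?mul1r ?lerDl//.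
  by rewrite ltr_wpDl.
move: G H2 l0; set A := SobK * _; set B := SobK * _; lra.
Qed.

Let coordinate_ne c : {ae mu, forall x : Rn R n, nth 0 x n.-1 <> c}.
Proof.
exists [set x : Rn R n | nth 0 x n.-1 = c]; split; last by move=> x /= /contrapT.
  rewrite (_ : [set _ | _] = (fun x : Rn R n => nth 0 x n.-1 : R) @^-1` [set c])//.
  by rewrite -[X in measurable X]setTI; apply: measurable_nth.
exact: hyperplane_null.
Qed.

(** Together with [lower_lsc] this replaces the continuity of [e]: the energies above and below the
    level are both lower semicontinuous, being integrals of one density over sets that eventually
    contain almost every point of the limit set. *)
Let upper_lsc (A : set (Rn R n)) (t : nat -> R) (c : R) : measurable A ->
  {ae mu, forall x, A x -> exists N, forall k, (N <= k)%N -> hspace (t k) x} ->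
  (c%:E < EE A U)%E -> exists N, c < e (t N).
Proof.
move=> mA At; rewrite energyTE => cA.
have [||| N] := @energy_lsc (Tset A) (fun k => Tset (hspace (t k))) c%:E _ _ _ cA.
- exact: measurable_T_set.
- by move=> k; exact: measurable_T_set.
- apply: filterS (ae_pairs At) => z [z1 z2] /not_andP[/contrapT/z1|/contrapT/z2] [N HN];
    by exists N => k /HN Hk [a b].
by rewrite -energyTE energyRE// lte_fin => cN; exists N.
Qed.

Let lower_lsc (B : set (Rn R n)) (t : nat -> R) : measurable B ->
  (forall x, B x -> exists N, forall k, (N <= k)%N -> ~ hspace (t k) x) ->
  (0 < \int[mu2]_(z in B `*` B) (edens U z)%:E)%E -> exists N, e (t N) < 1.
Proof.
move=> mB Bt cB.
have [||| N] := @energy_lsc (B `*` B) (fun k => (~` hspace (t k)) `*` (~` hspace (t k))) 0%E _ _ _ cB.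
- exact: measurableX.
- by move=> k; exact: measurableX.
- apply: aeW => z [/Bt[N1 H1] /Bt[N2 H2]]; exists (maxn N1 N2) => k.
  by rewrite geq_max => /andP[/H1 h1 /H2 h2]; split.
by rewrite -/(F (t N)) FE lte_fin subr_gt0 => tN; exists N.
Qed.

Let big (a : R) : exists N, forall k, (N <= k)%N -> a < k%:R.
Proof.
exists (Num.truncn a).+1 => k Nk.
by apply: (lt_le_trans (truncnS_gt _)); rewrite ler_nat.
Qed.

(** Consider the supremum of the levels with [e t < 1]. If [e t < 1] there, the inequality persists
    slightly to the right; if [e t = 1] there, values above [1 - kappa], hence equal to [1], occur
    slightly to the left. Both contradict the supremum. *)
Lemma no_maximizer_full : False.
Proof.
pose S := [set t | e t < 1].
have [N0 HN0] : exists N, e (- N%:R) < 1.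
  apply: (@lower_lsc setT (fun k => - k%:R)) => //.
    move=> x _; have [N HN] := big (nth 0 x n.-1); exists N => k /HN Nk.
    by rewrite /hspace/= opprK; apply/negP; rewrite -ltNge.
  rewrite (_ : setT `*` setT = Tset setT); last by rewrite TsetT setXTT.
  by rewrite -energyTE EE1 lte_fin.
have [N1 HN1] : exists N, 1 - kappa < e N%:R.
  apply: (@upper_lsc setT (fun k => k%:R)) => //.
    apply: aeW => x _; have [N HN] := big (- nth 0 x n.-1); exists N => k /HN Nk.
    by rewrite /hspace/= lerNl ltW.
  by rewrite EE1 lte_fin ltrBlDr ltrDl.
have e1 t : 1 - kappa < e t -> e t = 1.
  move=> H; apply/eqP; rewrite eq_le e_le1/= leNgt; apply/negP => /quantum.
  by move: H; set a := e t; set b := kappa; lra.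
have Sub : ubound S N1%:R.
  move=> t St; rewrite leNgt; apply/negP => /ltW/e_mono; rewrite (e1 _ HN1).
  by rewrite leNgt; move: St; rewrite /S/= => ->.
have hS : has_sup S by split; [exists (- N0%:R)|exists N1%:R].
pose t := sup S.
have et : e t = 1.
  apply/eqP; rewrite eq_le e_le1/= leNgt; apply/negP => et.
  have [N HN] : exists N, e (t + N.+1%:R^-1) < 1.
    apply: (@lower_lsc (~` hspace t) (fun k => t + k.+1%:R^-1)) => //.
      move=> x; rewrite /hspace/= => /negP; rewrite -ltNge => xt.
      have d0 : 0 < - t - nth 0 x n.-1 by rewrite subr_gt0.
      have [N HN] := inv_succ_small d0; exists N => k /HN Nk.
      by apply/negP; rewrite -ltNge; move: Nk; set a := _^-1; lra.
    by rewrite -/(F t) FE lte_fin subr_gt0.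
  have := ub_le_sup hS.2 HN; rewrite -/t leNgt => /negP; apply.
  by rewrite ltrDl invr_gt0.
have [N HN] : exists N, 1 - kappa < e (t - N.+1%:R^-1).
  apply: (@upper_lsc (hspace t) (fun k => t - k.+1%:R^-1)) => //.
    (* Points of the boundary itself lie in none of the smaller half spaces; they form a null
       set. *)
    apply: filterS (coordinate_ne (- t)) => x xt; rewrite /hspace/= => tx.
    have d0 : 0 < nth 0 x n.-1 + t.
      rewrite lt_neqAle -lerBlDr sub0r tx andbT eq_sym addr_eq0; exact/eqP.
    have [N H] := inv_succ_small d0; exists N => k /H Nk.
    by move: Nk; set a := _^-1; lra.
  by rewrite energyRE// -/(e t) et lte_fin ltrBlDr ltrDl.
have d0 : 0 < N.+1%:R^-1 :> R by rewrite invr_gt0.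
have [t' St' tt'] := sup_adherent d0 hS.
have := e_mono (ltW tt'); rewrite -/t (e1 _ HN) leNgt; move: St'; rewrite /S/= => ->//.
Qed.

End NoEscape.

(** * The maximizer and its Euler-Lagrange equation *)

Section EulerLagrange.
Context (R : realType) (n : nat) (s : R).
Hypotheses (hs0 : 0 < s) (hs1 : s < 1) (n0 : (0 < n)%N) (hns : 2 * s < n%:R).
Local Notation q := (@crit_exp R n s).
Local Notation J := (@riesz R n s).
Local Notation mu := (lebesgue_Rn R n).
Local Notation mu2 := (lebesgue_RnRn R n).
Local Notation edens := (@energy_density R n s).
Local Notation Hs := (@Hs_on R n s).
Local Notation mR := (@massR R n s).
Local Notation eR := (@energyR R n s).
Local Notation lam := (@best_constant R n s).
Local Notation Tset := (@T_set R n).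

Let q2 : 2 < q. Proof. exact: crit_exp_gt2. Qed.
Let l0 : 0 < lam. Proof. exact: best_constant_gt0 hs0 hs1 n0 hns. Qed.
Let O : set (Rn R n) := hspace 0.
Let mO : measurable O. Proof. exact: measurable_half. Qed.
Let mT : measurable (Tset O). Proof. exact: measurable_T_set. Qed.

(** Passing to the absolute value keeps the mass and can only lower the energy; a strict drop would
    force the mass below [lam]. *)
Lemma maximizer_exists : exists U, [/\ Hs O U, (forall x, 0 <= U x), eR O U = 1 & mR O U = lam].
Proof.
have [c c0 [[rho H]|H]] := concentration_dichotomy hs0 hs1 n0 hns; last first.
  have [U [HU eU mU]] := escaping_maximizer hs0 hs1 n0 hns c0 H.
  by have := no_maximizer_full hs0 hs1 n0 hns HU eU mU.
have [U [HU eU mU]] := bounded_maximizer hs0 hs1 n0 hns c0 H.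
have Ha := Hs_on_abs mO HU; exists (fun x => `|U x|).
have ma : mR O (fun x => `|U x|) = lam by rewrite /massR mass_abs.
split => //; apply/eqP; rewrite eq_le; apply/andP; split.
  have [_ _ Ea] := Ha; have [mU' _ EU] := HU.
  by rewrite -eU -lee_fin -!energyRE//; exact: energyT_abs_le.
rewrite leNgt; apply/negP => ea.
have := best_constant_ineq hs0 n0 hns Ha; rewrite -/O ma -{1}[lam]mulr1 ler_pM2l//.
apply/negP; rewrite -ltNge; apply: le_lt_trans ea; apply: powR_le_id.
  rewrite energyR_ge0/=; have [_ _ Ea] := Ha; have [mU' _ EU] := HU.
  by rewrite -eU -lee_fin -!energyRE//; exact: energyT_abs_le.
by move: q2; lra.
Qed.

Definition cross (u v : Rn R n -> R) (z : Rn R n * Rn R n) : R :=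
  (u z.1 - u z.2) * (v z.1 - v z.2) * J z.

Lemma measurable_cross u v : measurable_fun setT u -> measurable_fun setT v ->
  measurable_fun setT (cross u v).
Proof.
have md (f : Rn R n -> R) : measurable_fun setT f ->
    measurable_fun setT (fun z : Rn R n * Rn R n => f z.1 - f z.2).
  move=> mf; apply: measurable_funB.
    exact: (measurableT_comp mf measurable_fst).
  exact: (measurableT_comp mf measurable_snd).
move=> mu_ mv; apply: measurable_funM; last exact: measurable_riesz.
by apply: measurable_funM; exact: md.
Qed.

Lemma integrable_energy_density u : Hs O u ->
  mu2.-integrable (Tset O) (EFin \o edens u).
Proof.
move=> [mu_ _ Eu]; apply/integrableP; split.
  apply/measurable_EFinP; apply: measurable_funTS => //.
  exact: measurable_energy_density.
apply: le_lt_trans Eu; rewrite energyTE le_eqVlt; apply/orP; left; apply/eqP.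
by apply: eq_integral => z _; rewrite /= ger0_norm// energy_density_ge0.
Qed.

Lemma integrable_cross u v : Hs O u -> Hs O v ->
  mu2.-integrable (Tset O) (EFin \o cross u v).
Proof.
move=> Hu Hv; have [mu_ _ _] := Hu; have [mv _ _] := Hv.
apply: (le_integrable mT _ _ (integrableD mT (integrable_energy_density Hu) (integrable_energy_density Hv))).
  apply/measurable_EFinP; apply: measurable_funTS => //.
  exact: measurable_cross.
move=> z _; change (`|(cross u v z)%:E| <= `|(edens u z + edens v z)%:E|)%E.
rewrite lee_fin [leRHS]ger0_norm ?addr_ge0 ?energy_density_ge0// /cross /energy_density normrM (ger0_norm (riesz_ge0 _ _)).
rewrite -mulrDl ler_wpM2r ?riesz_ge0// ler_norml.
set a := u z.1 - _; set b := v z.1 - _.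
have h1 := sqr_ge0 (a + b); have h2 := sqr_ge0 (a - b); have h3 := sqr_ge0 a; have h4 := sqr_ge0 b.
rewrite sqrrD in h1; rewrite sqrrB in h2.
by apply/andP; split; lra.
Qed.

Lemma energy_expansion u v t : Hs O u -> Hs O v ->
  eR O (fun x => u x + t * v x) =
  eR O u + t * (2 * \int[mu2]_(z in Tset O) cross u v z) + t ^+ 2 * eR O v.
Proof.
move=> Hu Hv.
have iu := integrable_energy_density Hu; have iv := integrable_energy_density Hv; have iuv := integrable_cross Hu Hv.
have i2 := integrableZl mT (t * 2) iuv; have i3 := integrableZl mT (t ^+ 2) iv.
rewrite (_ : eR O (fun x => u x + t * v x) =
    \int[mu2]_(z in Tset O) (edens u z + t * 2 * cross u v z + t ^+ 2 * edens v z)); last first.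
  rewrite /energyR energyTE /Rintegral; congr fine; apply: eq_integral => z _; congr EFin.
  by rewrite /energy_density /cross; ring.
have i12 : mu2.-integrable (Tset O)
  (EFin \o (fun z => edens u z + t * 2 * cross u v z)) by exact: (integrableD mT iu i2).
rewrite (RintegralD mT i12 i3) (RintegralD mT iu i2) RintegralZl// RintegralZl//.
by rewrite /energyR !energyTE /Rintegral mulrA.
Qed.

Let mpow (u : Rn R n -> R) (a : R) : measurable_fun setT u -> measurable_fun O (fun x => u x `^ a).
Proof.
move=> mu_; apply: measurable_funTS => //.
rewrite (_ : (fun _ => _) = (fun y : R => y `^ a) \o u)//.
by apply: measurableT_comp => //; exact: measurable_powR.
Qed.

Let integrable_powR u : Hs O u -> mu.-integrable O (EFin \o (fun x => `|u x| `^ q)).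
Proof.
move=> [mu_ Mu _]; apply/integrableP; split.
  apply/measurable_EFinP; apply: measurable_funTS => //.
  exact: measurable_powR_norm.
apply: le_lt_trans Mu; rewrite le_eqVlt; apply/orP; left; apply/eqP.
by apply: eq_integral => z _; rewrite /= ger0_norm// powR_ge0.
Qed.

(** [q * u^(q - 1) * |v|] is at most [(u + |v|)^q - u^q] by the tangent inequality, hence at most
    [u^q + C * |v|^q] by [powR_split]. *)
Lemma integrable_pairing u v : (forall x, 0 <= u x) -> Hs O u -> Hs O v ->
  mu.-integrable O (EFin \o (fun x => u x `^ (q - 1) * v x)).
Proof.
move=> u0 Hu Hv; have [mu_ _ _] := Hu; have [mv _ _] := Hv.
have q0 : 0 < q by move: q2; lra.
have q1 : 1 < q by move: q2; lra.
have [C C0 HC] := powR_split q0 (@ltr01 R).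
apply: (le_integrable mO _ _ (integrableD mO (integrable_powR Hu) (integrableZl mO C (integrable_powR Hv)))).
  apply/measurable_EFinP; apply: measurable_funM; first exact: mpow.
  exact: measurable_funTS.
move=> x _; change (`|(u x `^ (q - 1) * v x)%:E| <= `|(`|u x| `^ q + C * `|v x| `^ q)%:E|)%E.
have T := powR_tangent `|v x| (u0 x) q1; have S := HC (u x) `|v x|; rewrite normr_id in S.
have P0 : 0 <= u x `^ (q - 1) * `|v x| by rewrite mulr_ge0 ?powR_ge0.
have uE : `|u x| `^ q = u x `^ q by rewrite ger0_norm.
have K : u x `^ (q - 1) * `|v x| <= q * (u x `^ (q - 1) * `|v x|) by rewrite ler_peMl// ltW.
rewrite lee_fin [leRHS]ger0_norm ?addr_ge0 ?mulr_ge0 ?powR_ge0//.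
rewrite normrM (ger0_norm (powR_ge0 _ _)).
by move: T S K; rewrite uE; lra.
Qed.

(** The mass of [U + t v] is bounded below by an affine function of [t], its energy is an exact
    quadratic, and the best constant compares the two for every real [t]. This avoids
    differentiating under the integral sign; [powR_variation] extracts the equality. *)
Theorem euler_lagrange U v : Hs O U -> (forall x, 0 <= U x) -> eR O U = 1 -> mR O U = lam ->
  Hs O v -> \int[mu]_(x in O) (U x `^ (q - 1) * v x) =
    lam * \int[mu2]_(z in Tset O) cross U v z.
Proof.
move=> HU U0 eU mU Hv.
set A := \int[mu]_(x in O) _; set B := \int[_]_(z in _) _.
have Ht t : Hs O (fun x => U x + t * v x) by apply: Hs_on_add => //; exact: Hs_on_scale.
have eE t : eR O (fun x => U x + t * v x) = 1 + t * (2 * B) + t ^+ 2 * eR O v.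
  by rewrite energy_expansion// eU.
have q1 : 1 < q by move: q2; lra.
have iA := integrable_pairing U0 HU Hv; have iU := integrable_powR HU.
have M t : lam + t * (q * A) <= mR O (fun x => U x + t * v x).
  have it := integrableZl mO (t * q) iA.
  have -> : lam + t * (q * A) = \int[mu]_(x in O) (`|U x| `^ q + t * q * (U x `^ (q - 1) * v x)).
    by rewrite (RintegralD mO iU it) RintegralZl// -mU mulrA.
  apply: le_Rintegral => //; first exact: (integrableD mO iU it).
    exact: integrable_powR.
  move=> x _; have := powR_tangent (t * v x) (U0 x) q1; rewrite (ger0_norm (U0 x)).
  by apply: le_trans; rewrite lerD2l le_eqVlt; apply/orP; left; apply/eqP; ring.
have E : q * A / lam = q / 2 * (2 * B).
  apply: (@powR_variation _ _ _ (eR O v)).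
  - by move: q2; lra.
  - by move=> t; rewrite -eE energyR_ge0.
  move=> t; rewrite -eE -(ler_pM2l l0); apply: le_trans (best_constant_ineq hs0 n0 hns (Ht t)).
  apply: le_trans (M t); rewrite le_eqVlt; apply/orP; left; apply/eqP.
  by field; rewrite gt_eqF.
have qn0 : q != 0 by rewrite gt_eqF//; lra.
have ln0 : lam != 0 by rewrite gt_eqF.
apply: (mulfI qn0); apply: (mulIf (invr_neq0 ln0)).
rewrite E; field; exact: ln0.
Qed.

End EulerLagrange.

(** * Return to the original problem *)

Section Conclusion.
Context (R : realType) (n : nat) (s : R).
Hypotheses (hs0 : 0 < s) (hs1 : s < 1) (n0 : (0 < n)%N) (hns : 2 * s < n%:R).
Local Notation q := (@crit_exp R n s).
Local Notation mu := (lebesgue_Rn R n).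
Local Notation mu2 := (lebesgue_RnRn R n).
Local Notation pos := (@half_space_pos R n).

Let O : set (Rn R n) := hspace 0.
Let mO : measurable O. Proof. exact: measurable_half. Qed.
Let N := [set x : Rn R n | nth 0 x n.-1 = 0].
Let mN : measurable N.
Proof.
rewrite (_ : N = (fun x : Rn R n => nth 0 x n.-1 : R) @^-1` [set 0])//.
by rewrite -[X in measurable X]setTI; apply: measurable_nth.
Qed.
Let N0 : mu N = 0%E. Proof. exact: hyperplane_null. Qed.

Let posE : pos = O `\` N.
Proof.
apply/seteqP; split => x; rewrite /half_space_pos /O /hspace /N /= oppr0.
  by move=> x0; split; [exact: ltW|move=> xE; move: x0; rewrite xE ltxx].
by move=> [x0 /eqP xN]; rewrite lt_neqAle eq_sym xN.
Qed.

(** The complement of the open lower half space is exactly [hspace 0], which is why the proof works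
    with closed half spaces. *)
Lemma T_half_spaceE : @T_half_space R n = T_set O.
Proof.
suff E : @half_space_neg R n = ~` O by rewrite /T_half_space E.
apply/seteqP; split => x; rewrite /half_space_neg /O /hspace/= oppr0.
  by move=> x0; apply/negP; rewrite -ltNge.
by move/negP; rewrite -ltNge.
Qed.

(** The mass is taken over the open half space on one side and over the closed one on the other; the
    hyperplane between them is a null set. *)
Lemma Hs_half_spaceE u : Hs_half_space s u <-> Hs_on s O u.
Proof.
have E : measurable_fun setT u ->
    (\int[mu]_(x in pos) (`|u x| `^ q)%:E)%E = @mass R n s O u.
  move=> mu_; rewrite posE -ge0_negligible_integral//.
  apply: measurable_funTS; apply/measurable_EFinP.
  exact: measurable_powR_norm.
split => -[mu_ Mu Eu]; (split; first exact: mu_).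
- by rewrite -E.
- by rewrite T_half_spaceE in Eu.
- by rewrite E.
- by rewrite T_half_spaceE.
Qed.

Lemma positive_energy_non_constant u : (0 < energyT s O u)%E -> measurable_fun setT u -> non_constant u.
Proof.
move=> Eu mu_ [c uc]; move: Eu; rewrite energyTE (_ : integral _ _ _ = 0%E) ?ltxx//.
rewrite (ge0_ae_eq_integral (g := cst 0%E)) ?integral0//.
- exact: measurable_T_set.
- apply: measurable_funTS; apply/measurable_EFinP.
  exact: measurable_energy_density.
- by move=> z _; rewrite lee_fin energy_density_ge0.
- apply: filterS (ae_pairs uc) => z [z1 z2] _.
  by rewrite /energy_density z1 z2 subrr expr0n/= mul0r.
Qed.

(* The multiplier [best_constant] is absorbed by scaling, the exponent [q - 1] differing from 1. *)
Lemma scaled_maximizer U : Hs_on s O U -> (forall x, 0 <= U x) -> energyR s O U = 1 ->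
  massR s O U = @best_constant R n s -> exists2 k : R, 0 < k & weak_solution s (q - 1) (fun x => k * U x).
Proof.
move=> HU U0 eU mU.
have q2 : 2 < q by exact: crit_exp_gt2.
have l0 : 0 < @best_constant R n s by exact: best_constant_gt0.
pose c := @frac_lap_const R n s.
have c0 : 0 < c by exact: frac_lap_const_gt0.
(* The weak equation for [k * U] reads [(c / 2) * k * B = k^(q - 1) * lam * B], which asks for
   [k^(q - 2) = c / (2 * lam)]. *)
pose a := c / (2 * @best_constant R n s).
have a0 : 0 < a by rewrite divr_gt0// mulr_gt0.
pose k := a `^ (q - 2)^-1.
have k0 : 0 < k by exact: powR_gt0.
have kE : k `^ (q - 1) = a * k.
  rewrite (_ : q - 1 = (q - 2) + 1); last by ring.
  rewrite powRD ?(gt_eqF k0) ?implybT// powRr1 ?(ltW k0)// -powRrM mulVf ?powRr1 ?(ltW a0)//.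
  by rewrite gt_eqF// subr_gt0.
have mT : measurable (@T_set R n O) by exact: measurable_T_set.
exists k => //; split.
- by apply/Hs_half_spaceE; exact: Hs_on_scale.
- by apply: aeW => x _; rewrite mulr_ge0// ltW.
move=> v /Hs_half_spaceE Hv; rewrite T_half_spaceE.
have EL := euler_lagrange hs0 hs1 n0 hns HU U0 eU mU Hv.
pose B := \int[mu2]_(z in T_set O) cross s U v z.
rewrite -/O -/B in EL.
have iB := integrableZl mT k (integrable_cross HU Hv).
have iA := integrableZl mO (k `^ (q - 1)) (integrable_pairing hs0 hns U0 HU Hv).
have -> : gagliardo s (fun x => k * U x) v (T_set O) = (k * B)%:E.
  transitivity (\int[mu2]_(z in T_set O) (k * cross s U v z)%:E)%E.
    apply: eq_integral => z _; congr EFin; rewrite /cross /riesz; ring.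
  rewrite /B -RintegralZl//; last exact: integrable_cross.
  by rewrite /Rintegral fineK//; exact: (integrable_fin_num mT iB).
have -> : (\int[mu]_(x in pos) ((k * U x) `^ (q - 1) * v x)%:E)%E =
    (k `^ (q - 1) * \int[mu]_(x in O) (U x `^ (q - 1) * v x))%:E.
  transitivity (\int[mu]_(x in O) (k `^ (q - 1) * (U x `^ (q - 1) * v x))%:E)%E.
    rewrite posE [RHS](negligible_integral mN mO iA N0).
    by apply: eq_integral => x _; congr EFin; rewrite powRM ?mulrA// ltW.
  rewrite -RintegralZl//; last exact: integrable_pairing.
  by rewrite /Rintegral fineK//; exact: (integrable_fin_num mO iA).
rewrite EL kE -EFinM; congr EFin; rewrite -/c /a; field.
by rewrite gt_eqF.
Qed.

End Conclusion.

Theorem theorem1p2 (R : realType) (s : R) (n : nat)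
    (hs0 : 0 < s) (hs1 : s < 1) (hn : (1 <= n)%N) (hns : 2 * s < n%:R) :
  exists u : Rn R n -> R,
    weak_solution s ((n%:R + 2 * s) / (n%:R - 2 * s)) u /\ non_constant u.
Proof.
have mO := @measurable_half R n 0.
have [U [HU U0 eU mU]] := maximizer_exists hs0 hs1 hn hns.
have [k k0 wk] := scaled_maximizer hs0 hs1 hn hns HU U0 eU mU.
exists (fun x => k * U x); split; first by rewrite crit_expN.
have [mU' _ EU] := HU.
apply: (positive_energy_non_constant (s := s)); last exact: measurable_funM.
by rewrite energyT_scale// energyRE// eU mule1 lte_fin exprn_gt0.
Qed.
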